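(* Let $\lambda>0$ and $0\le k<1$. (1) If $\lambda<1$, then $\mathcal{B}_H(\lambda)\cap\mathcal{S}_H\subset h^\infty$. (2) If $\lambda=1$, then $\mathcal{B}_H(\lambda)\cap\mathcal{S}_H\subset\mathrm{BMOH}$. (3) If $\lambda>1$, then $\mathcal{B}_H(\lambda)\cap\mathcal{S}_{H_k}\subset h^p$ for every $0<p<1/(\lambda-1)$.
   Context: $\mathbb{D}$ is the open unit disk. $\mathcal{H}$ is the class of harmonic mappings $f=h+\overline g$ in $\mathbb{D}$ ($h,g$ analytic) with $h(0)=g(0)=h'(0)-1=0$. $\|T_f\|=\sup_{z\in\mathbb{D},\ \theta\in[0,2\pi]}(1-|z|^2)\left|\frac{h''(z)+e^{i\theta}g''(z)}{h'(z)+e^{i\theta}g'(z)}\right|$, with $\|T_f\|=\infty$ if $h'+e^{i\theta}g'$ has a zero in $\mathbb{D}$ for some $\theta$; and $\mathcal{B}_H(\lambda)=\{f\in\mathcal{H}:\|T_f\|\le 2\lambda\}$. $\mathcal{S}_H$ is the set of $f\in\mathcal{H}$ that are sense-preserving (i.e. $|g'|<|h'|$ in $\mathbb{D}$) and univalent in $\mathbb{D}$. $\mathcal{S}_{H_k}$ is the set of $f=h+\overline g\in\mathcal{S}_H$ that are $k$-quasiconformal, i.e. $|g'(z)/h'(z)|\le k$ for all $z\in\mathbb{D}$. For $0<p<\infty$, $h^p$ is the set of harmonic mappings $f$ in $\mathbb{D}$ for which $M_p(r,f)=\left\{\frac1{2\pi}\int_0^{2\pi}|f(re^{i\theta})|^p\,d\theta\right\}^{1/p}$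 is bounded on $0<r<1$; $h^\infty$ is the set of bounded harmonic mappings in $\mathbb{D}$. $\mathrm{BMOH}$ is the class of harmonic mappings in $\mathbb{D}$ of bounded mean oscillation, i.e. harmonic $f$ with $\sup_{a\in\mathbb{D}}\sup_{0<r<1}\frac1{2\pi}\int_0^{2\pi}|f(\varphi_a(re^{it}))-f(a)|^2\,dt<\infty$, where $\varphi_a(z)=\frac{z+a}{1+\overline a z}$. *)

(* Defs.v *)
From Stdlib Require Export Reals.
From Coquelicot Require Export Coquelicot.
Open Scope R_scope.

Definition in_disk (z : C) : Prop := Cmod z < 1.

Definition cis (t : R) : C := (cos t, sin t).

Definition analytic (h : C -> C) : Prop :=
  forall z : C, in_disk z -> @ex_derive C_AbsRing C_NormedModule h z.

(* [ex_diff_n u 2 x y] at every point of the disk says that u is C^2 there. *)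
Definition real_harmonic (u : R -> R -> R) : Prop :=
  forall x y : R, in_disk (x, y) ->
    ex_diff_n u 2 x y /\
    partial_derive 2 0 u x y + partial_derive 0 2 u x y = 0.

Definition harmonic (f : C -> C) : Prop :=
  real_harmonic (fun x y => Re (f (x, y))) /\
  real_harmonic (fun x y => Im (f (x, y))).

(* A mapping of the disk is represented by a total function C -> C whose values
   outside the disk are irrelevant.  On the disk, h and g are determined by f,
   because of the normalization g 0 = 0; the classes below therefore quantify
   existentially over the pair (h, g). *)
Definition canonical_decomposition (f h g : C -> C) : Prop :=
  analytic h /\ analytic g /\
  (forall z : C, in_disk z -> f z = (h z + Cconj (g z))%C) /\
  h 0 = 0 /\ g 0 = 0 /\ C_derive h 0 = 1.

Definition class_H (f : C -> C) : Prop :=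
  exists h g : C -> C, canonical_decomposition f h g.

(* The value is +oo at a zero of h' + e^{it} g', so that the supremum below is
   +oo as soon as there is such a zero. *)
Definition preSchwarzian_term (h g : C -> C) (z : C) (t : R) : Rbar :=
  let d1 := (C_derive h z + cis t * C_derive g z)%C in
  let d2 := (C_derive (C_derive h) z + cis t * C_derive (C_derive g) z)%C in
  if Ceq_dec d1 0 then p_infty
  else Finite ((1 - Cmod z ^ 2) * Cmod (d2 / d1)).

Definition preSchwarzian_norm (h g : C -> C) : Rbar :=
  Rbar_lub (fun x : Rbar => exists (z : C) (t : R),
    in_disk z /\ 0 <= t <= 2 * PI /\ x = preSchwarzian_term h g z t).

Definition class_B (lambda : R) (f : C -> C) : Prop :=
  exists h g : C -> C, canonical_decomposition f h g /\
    Rbar_le (preSchwarzian_norm h g) (2 * lambda).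

Definition univalent (f : C -> C) : Prop :=
  forall z w : C, in_disk z -> in_disk w -> f z = f w -> z = w.

Definition class_S (f : C -> C) : Prop :=
  univalent f /\
  exists h g : C -> C, canonical_decomposition f h g /\
    forall z : C, in_disk z -> Cmod (C_derive g z) < Cmod (C_derive h z).

Definition class_S_qc (k : R) (f : C -> C) : Prop :=
  class_S f /\
  exists h g : C -> C, canonical_decomposition f h g /\
    forall z : C, in_disk z -> Cmod (C_derive g z / C_derive h z) <= k.

(* x^p for x >= 0 and p > 0; [Rpower 0 p] would be 1, since [ln 0 = 0]. *)
Definition nonneg_power (x p : R) : R :=
  if Req_EM_T x 0 then 0 else Rpower x p.

(* For f harmonic, the integrands below are continuous, so that the total
   operator [RInt] returns the actual integral. *)
Definition integral_mean (p r : R) (f : C -> C) : R :=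
  nonneg_power
    (/ (2 * PI) *
     RInt (fun t => nonneg_power (Cmod (f (r * cis t)%C)) p) 0 (2 * PI))
    (1 / p).

Definition hardy (p : R) (f : C -> C) : Prop :=
  harmonic f /\
  exists M : R, forall r : R, 0 < r < 1 -> integral_mean p r f <= M.

Definition hardy_infty (f : C -> C) : Prop :=
  harmonic f /\
  exists M : R, forall z : C, in_disk z -> Cmod (f z) <= M.

Definition disk_automorphism (a z : C) : C :=
  ((z + a) / (1 + Cconj a * z))%C.

Definition BMOH (f : C -> C) : Prop :=
  harmonic f /\
  exists M : R, forall (a : C) (r : R), in_disk a -> 0 < r < 1 ->
    / (2 * PI) *
    RInt (fun t =>
      Cmod (f (disk_automorphism a (r * cis t)%C) - f a)%C ^ 2) 0 (2 * PI)
    <= M.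

(* Main.v *)
Require Import Defs.
From Stdlib Require Import Reals Lra Lia.
From Coquelicot Require Import Coquelicot.
Open Scope R_scope.

(** Write [f = h + conj g] and [F_t = h + e^(it) g]. The bound on the
    pre-Schwarzian norm says that [(1 - |z|^2) |F_t''| <= 2 lambda |F_t'|], with
    [F_t'] free of zeros, for every [t]. Integrating it along a radius gives
    [|F_t'| = O((1 - |z|)^(- lambda))], and the two values [t = 0] and [t = PI]
    give the same growth for [h'] and [g'] ([class_B_derivative_growth]).

    For [lambda < 1] this growth is integrable along radii, so [f] is bounded.

    For [lambda = 1], let [F] be [h + g] or [h - g]. The hyperbolic derivative
    [E = (1 - |z|^2) |F'|] is bounded. Since [ln |F'|] is harmonic, [ln E] has
    Laplacian [- 4 / (1 - |z|^2)^2], while the pre-Schwarzian bound controls its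
    gradient by [4 / (1 - |z|^2)]. Hence a small power [E^(1/8)] is superharmonic,
    with a Laplacian so negative that a multiple of it absorbs the Laplacian
    [4 |F'|^2 = 4 E^2 / (1 - |z|^2)^2] of [|F - F(0)|^2]. The circular means of the
    sum of the two functions are then at most an upper bound of it near the centre
    ([circle_mean_bound]). Both properties of [E] are invariant under
    automorphisms of the disk, so the same constant serves for [F] composed with
    any automorphism: this is bounded mean oscillation. Finally [Re f] is the
    real part of [h + g] and [Im f] the imaginary part of [h - g].

    For [lambda > 1], let [m(s)] be the integral of [(1 + |f|^2)^(p/2)] over the
    circle [|z| = e^s]. In the coordinates [z = e^(s + it)] the second derivative
    of [m] is the integral of the Laplacian, which is at most a constant times
    that of [|h'|^2 (1 + |f|^2)^(p/2 - 1)]. To estimate the latter at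
    [d = 1 - e^s], take about [1 / d] equally spaced points [z_j] on the circle.
    By distortion and quasiconformality, [f] is nearly real-linear on the disk
    of radius [c d] around [z_j], whose image therefore contains a disk around
    [f(z_j)] of radius [a_j] comparable to [d |h'(z_j)|] ([qc_harmonic_covering]).
    By univalence the other values [f(z_i)], and [f(0) = 0], stay outside it, so
    the squares of half-side [a_j / 3] around the [f(z_j)] are disjoint and
    comparing areas gives: the sum of the [a_j^2] over the [j] with
    [|f(z_j)| <= rho] is [O(rho^2)] ([separated_points_sum]). Summation over dyadic
    values of [rho] bounds the sum of [a_j^2 (1 + |f(z_j)|^2)^(p/2 - 1)] by [O(M^p)],
    where [M = O(d^(1 - lambda))] bounds [|f|] on the circle. Averaging over
    rotations of the points yields [m'' = O(d^(- 1 - p (lambda - 1)))]. This has a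
    bounded second antiderivative because [p (lambda - 1) < 1], so [m] is bounded.

    Analyticity is mere complex differentiability here, so the derivatives of
    [h] and [g] are first shown to be differentiable: Goursat's lemma on
    rectangles gives Cauchy's formula on a circle, which is then differentiated
    under the integral. *)

(** * Differentiation over the complex numbers *)

Definition is_C_derive (h : C -> C) (z d : C) : Prop :=
  @is_derive C_AbsRing C_NormedModule h z d.

Lemma is_C_derive_eps (h : C -> C) (z d : C) :
  is_C_derive h z d <->
  forall eps : posreal, exists delta : posreal, forall w : C,
    Cmod (w - z) < delta ->
    Cmod (h w - h z - d * (w - z))%C <= eps * Cmod (w - z).
Proof.
  split.
  - intros [_ H] eps.
    destruct (H z (fun P HP => HP) eps) as [delta Hd].
    exists delta. intros w Hw.
    specialize (Hd w Hw).
    replace (h w - h z - d * (w - z))%C with (h w - h z - (w - z) * d)%C by ring.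
    exact Hd.
  - intros H; split.
    + apply is_linear_scal_l.
    + intros x Hx.
      assert (Hxz : z = x) by exact (@is_filter_lim_locally_unique C_AbsRing (AbsRing_NormedModule C_AbsRing) z x Hx).
      rewrite <- Hxz.
      intros eps; destruct (H eps) as [delta Hd].
      exists delta; intros w Hw.
      specialize (Hd w Hw).
      replace (h w - h z - d * (w - z))%C with (h w - h z - (w - z) * d)%C in Hd by ring.
      exact Hd.
Qed.

(** The ring [C] carries two normed module structures over itself; the rules of
    calculus available for the ring structure transfer to the other one. *)
Lemma is_C_derive_AbsRing (h : C -> C) (z d : C) :
  @is_derive C_AbsRing (AbsRing_NormedModule C_AbsRing) h z d <->
  is_C_derive h z d.
Proof.
  split; intros [_ H]; (split; [ apply is_linear_scal_l | ]); exact H.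
Qed.

Lemma is_C_derive_ext_loc (f g : C -> C) (z d : C) (r : R) : 0 < r ->
  (forall w, Cmod (w - z) < r -> f w = g w) ->
  is_C_derive f z d -> is_C_derive g z d.
Proof.
  intros Hr H. apply is_derive_ext_loc.
  exists (mkposreal r Hr). exact H.
Qed.

Lemma is_C_derive_const (c z : C) : is_C_derive (fun _ => c) z 0.
Proof. apply (@is_derive_const C_AbsRing C_NormedModule). Qed.

Lemma is_C_derive_id (z : C) : is_C_derive (fun w => w) z 1.
Proof. apply is_C_derive_AbsRing, (@is_derive_id C_AbsRing). Qed.

Lemma is_C_derive_plus (f g : C -> C) (z a b : C) :
  is_C_derive f z a -> is_C_derive g z b ->
  is_C_derive (fun w => f w + g w)%C z (a + b)%C.
Proof. apply (@is_derive_plus C_AbsRing C_NormedModule). Qed.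

Lemma is_C_derive_minus (f g : C -> C) (z a b : C) :
  is_C_derive f z a -> is_C_derive g z b ->
  is_C_derive (fun w => f w - g w)%C z (a - b)%C.
Proof. apply (@is_derive_minus C_AbsRing C_NormedModule). Qed.

Lemma is_C_derive_mult (f g : C -> C) (z a b : C) :
  is_C_derive f z a -> is_C_derive g z b ->
  is_C_derive (fun w => f w * g w)%C z (a * g z + f z * b)%C.
Proof.
  intros H1 H2.
  rewrite <- is_C_derive_AbsRing in *.
  exact (@is_derive_mult C_AbsRing f g z a b H1 H2 Cmult_comm).
Qed.

Lemma is_C_derive_scal (f : C -> C) (c z a : C) :
  is_C_derive f z a -> is_C_derive (fun w => c * f w)%C z (c * a)%C.
Proof.
  intros H.
  replace (c * a)%C with (0 * f z + c * a)%C by ring.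
  apply (is_C_derive_mult (fun _ => c)); [ apply is_C_derive_const | exact H ].
Qed.

Lemma is_C_derive_comp (f g : C -> C) (z a b : C) :
  is_C_derive f (g z) a -> is_C_derive g z b ->
  is_C_derive (fun w => f (g w)) z (a * b)%C.
Proof.
  intros H1 H2.
  rewrite Cmult_comm.
  rewrite <- is_C_derive_AbsRing in H2.
  exact (@is_derive_comp C_AbsRing C_NormedModule f g z a b H1 H2).
Qed.

Lemma is_C_derive_inv (z : C) : z <> 0 ->
  is_C_derive (fun w => / w)%C z (- / (z * z))%C.
Proof.
  intros Hz. apply is_C_derive_eps. intros eps.
  assert (Hm : 0 < Cmod z) by now apply Cmod_gt_0.
  assert (He := cond_pos eps).
  set (m := Cmod z) in *.
  assert (Hd : 0 < Rmin (m / 2) (eps * (m * m * m) / 2)).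
  { apply Rmin_glb_lt.
    - lra.
    - apply Rdiv_lt_0_compat; [ | lra ].
      repeat apply Rmult_lt_0_compat; assumption. }
  exists (mkposreal _ Hd). simpl. intros w Hw.
  assert (Hw1 : Cmod (w - z) < m / 2) by (eapply Rlt_le_trans; [ exact Hw | apply Rmin_l ]).
  assert (Hw2 : Cmod (w - z) < eps * (m * m * m) / 2)
    by (eapply Rlt_le_trans; [ exact Hw | apply Rmin_r ]).
  assert (Hwm : m / 2 <= Cmod w).
  { assert (H := Cmod_triangle w (z - w)%C).
    replace (w + (z - w))%C with z in H by ring.
    replace (z - w)%C with (- (w - z))%C in H by ring.
    rewrite Cmod_opp in H. fold m in H. lra. }
  assert (Hwn : w <> 0) by (apply Cmod_gt_0; lra).
  replace (/ w - / z - - / (z * z) * (w - z))%C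
    with ((w - z) * ((w - z) * / (z * z * w)))%C by (field; split; assumption).
  rewrite !Cmod_mult, Cmod_inv; [ | repeat apply Cmult_neq_0; assumption ].
  rewrite !Cmod_mult. fold m.
  rewrite (Rmult_comm eps).
  apply Rmult_le_compat_l; [ apply Cmod_ge_0 | ].
  apply Rmult_le_reg_r with (m * m * Cmod w).
  { repeat apply Rmult_lt_0_compat; lra. }
  rewrite Rmult_assoc, Rinv_l; [ | apply Rgt_not_eq; repeat apply Rmult_lt_0_compat; lra ].
  rewrite Rmult_1_r.
  apply Rle_trans with (eps * (m * m * m) / 2); [ lra | ].
  replace (eps * (m * m * m) / 2) with (eps * (m * m * (m/2))) by field.
  apply Rmult_le_compat_l; [ lra | ].
  apply Rmult_le_compat_l; [ apply Rmult_le_pos; lra | assumption ].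
Qed.

Lemma Re_le_Cmod (z : C) : Rabs (Re z) <= Cmod z.
Proof. eapply Rle_trans; [ apply Rmax_l | apply Rmax_Cmod ]. Qed.

Lemma Im_le_Cmod (z : C) : Rabs (Im z) <= Cmod z.
Proof. eapply Rle_trans; [ apply Rmax_r | apply Rmax_Cmod ]. Qed.

Lemma Cmod_le_Rabs (z : C) : Cmod z <= Rabs (Re z) + Rabs (Im z).
Proof.
  destruct z as [x y]. unfold Cmod, Re, Im. cbn [fst snd].
  assert (Hx := Rabs_pos x). assert (Hy := Rabs_pos y).
  apply Rle_trans with (sqrt ((Rabs x + Rabs y) ^ 2)).
  - apply sqrt_le_1_alt.
    rewrite <- (pow2_abs x), <- (pow2_abs y). nra.
  - rewrite sqrt_pow2; lra.
Qed.

Lemma Cmod_sqr (z : C) : Cmod z ^ 2 = Re z ^ 2 + Im z ^ 2.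
Proof.
  unfold Cmod. rewrite <- Rsqr_pow2, Rsqr_sqrt; [ reflexivity | ].
  apply Rplus_le_le_0_compat; apply pow2_ge_0.
Qed.

(** The Jacobian is the matrix of the multiplication by [d]. The resulting
    Cauchy-Riemann equations are what makes the forms in Goursat's lemma closed. *)
Lemma is_C_derive_differentiable (h : C -> C) (x y : R) (d : C) :
  is_C_derive h (x, y) d ->
  differentiable_pt_lim (fun u v => Re (h (u, v))) x y (Re d) (- Im d) /\
  differentiable_pt_lim (fun u v => Im (h (u, v))) x y (Im d) (Re d).
Proof.
  intros H. rewrite is_C_derive_eps in H.
  assert (Hmain : forall eps : posreal, locally_2d (fun u v =>
    Cmod (h (u, v) - h (x, y) - d * ((u, v) - (x, y)))%C
      <= eps * Rmax (Rabs (u - x)) (Rabs (v - y))) x y).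
  { intros eps.
    assert (He : 0 < eps / 2) by (assert (H1 := cond_pos eps); lra).
    destruct (H (mkposreal _ He)) as [delta Hd]. simpl in Hd.
    assert (Hdp : 0 < delta / 2) by (assert (H1 := cond_pos delta); lra).
    exists (mkposreal _ Hdp). simpl. intros u v Hu Hv.
    assert (Hb : Cmod ((u, v) - (x, y))%C <= Rabs (u - x) + Rabs (v - y)).
    { eapply Rle_trans; [ apply Cmod_le_Rabs | simpl; unfold Rminus; lra ]. }
    eapply Rle_trans; [ apply Hd; lra | ].
    assert (H1 := Rmax_l (Rabs (u - x)) (Rabs (v - y))).
    assert (H2 := Rmax_r (Rabs (u - x)) (Rabs (v - y))).
    assert (H3 := cond_pos eps).
    apply Rle_trans with (eps / 2 * (2 * Rmax (Rabs (u - x)) (Rabs (v - y)))).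
    - apply Rmult_le_compat_l; lra.
    - lra. }
  split; intros eps; destruct (Hmain eps) as [delta Hd]; exists delta;
    intros u v Hu Hv; specialize (Hd u v Hu Hv).
  - eapply Rle_trans; [ | exact Hd ].
    eapply Rle_trans; [ | apply Re_le_Cmod ].
    right; f_equal. unfold Re, Im; simpl. ring.
  - eapply Rle_trans; [ | exact Hd ].
    eapply Rle_trans; [ | apply Im_le_Cmod ].
    right; f_equal. unfold Re, Im; simpl. ring.
Qed.

Lemma is_C_derive_eq (h : C -> C) (z a b : C) :
  is_C_derive h z a -> a = b -> is_C_derive h z b.
Proof. intros H <-. exact H. Qed.

(** * Goursat's lemma for differentiable closed forms on a rectangle *)

(** [P dx + Q dy] is closed at the point: [dP/dy] and [dQ/dx] are the same number
    [m]. Only differentiability is asked, since the continuity of the partial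
    derivatives is not available for a function known to be holomorphic. *)
Definition closed_form_at (P Q : R -> R -> R) (x y : R) : Prop :=
  exists p m q, differentiable_pt_lim P x y p m /\ differentiable_pt_lim Q x y m q.

Definition boundary_integral (P Q : R -> R -> R) (a b c d : R) : R :=
  RInt (fun x => P x c - P x d) a b + RInt (fun y => Q b y - Q a y) c d.

Definition closed_on (P Q : R -> R -> R) (a b c d : R) : Prop :=
  forall x y, a <= x <= b -> c <= y <= d -> closed_form_at P Q x y.

Lemma continuity_2d_pt_section_l (f : R -> R -> R) (x y : R) :
  continuity_2d_pt f x y -> continuous (fun u => f u y) x.
Proof.
  intros H. apply continuity_2d_pt_filterlim in H.
  apply (continuous_comp_2 (fun u => u) (fun _ => y) f).
  - apply continuous_id.
  - apply continuous_const.
  - exact H.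
Qed.

Lemma continuity_2d_pt_section_r (f : R -> R -> R) (x y : R) :
  continuity_2d_pt f x y -> continuous (fun v => f x v) y.
Proof.
  intros H. apply continuity_2d_pt_filterlim in H.
  apply (continuous_comp_2 (fun _ => x) (fun v => v) f).
  - apply continuous_const.
  - apply continuous_id.
  - exact H.
Qed.

Lemma closed_on_ex_RInt (P Q : R -> R -> R) (a b c d : R) :
  closed_on P Q a b c d ->
  (forall y u v, c <= y <= d -> a <= u <= v -> v <= b -> ex_RInt (fun x => P x y) u v) /\
  (forall x u v, a <= x <= b -> c <= u <= v -> v <= d -> ex_RInt (fun y => Q x y) u v).
Proof.
  intros H; split; intros z u v Hz Hu Hv; apply (@ex_RInt_continuous R_CompleteNormedModule);
    intros t; rewrite Rmin_left, Rmax_right by lra; intros Ht.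
  - destruct (H t z) as (p & m & q & Hp & _); [ lra | lra | ].
    apply continuity_2d_pt_section_l, differentiable_continuity_pt.
    now exists p, m.
  - destruct (H z t) as (p & m & q & _ & Hq); [ lra | lra | ].
    apply (continuity_2d_pt_section_r Q z t), differentiable_continuity_pt.
    now exists m, q.
Qed.

Lemma closed_on_sub (P Q : R -> R -> R) (a b c d a' b' c' d' : R) :
  a <= a' -> b' <= b -> c <= c' -> d' <= d ->
  closed_on P Q a b c d -> closed_on P Q a' b' c' d'.
Proof. intros Ha Hb Hc Hd H x y Hx Hy. apply H; lra. Qed.

Lemma boundary_integral_split (P Q : R -> R -> R) (a b c d m n : R) :
  a <= m <= b -> c <= n <= d -> closed_on P Q a b c d ->
  boundary_integral P Q a b c d =
    boundary_integral P Q a m c n + boundary_integral P Q m b c n +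
    (boundary_integral P Q a m n d + boundary_integral P Q m b n d).
Proof.
  intros Hm Hn H. destruct (closed_on_ex_RInt _ _ _ _ _ _ H) as [HP HQ].
  unfold boundary_integral.
  assert (EP : forall y y' u v, c <= y <= d -> c <= y' <= d -> a <= u <= v -> v <= b ->
    RInt (fun x => P x y - P x y') u v =
    RInt (fun x => P x y) u v - RInt (fun x => P x y') u v).
  { intros. apply (RInt_minus (fun x => P x y) (fun x => P x y')); apply HP; lra. }
  assert (EQ : forall x x' u v, a <= x <= b -> a <= x' <= b -> c <= u <= v -> v <= d ->
    RInt (fun y => Q x y - Q x' y) u v =
    RInt (fun y => Q x y) u v - RInt (fun y => Q x' y) u v).
  { intros. apply (RInt_minus (fun y => Q x y) (fun y => Q x' y)); apply HQ; lra. }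
  rewrite !EP, !EQ by lra.
  assert (CP : forall y, c <= y <= d ->
    RInt (fun x => P x y) a m + RInt (fun x => P x y) m b = RInt (fun x => P x y) a b).
  { intros. apply (RInt_Chasles (fun x => P x y)); apply HP; lra. }
  assert (CQ : forall x, a <= x <= b ->
    RInt (fun y => Q x y) c n + RInt (fun y => Q x y) n d = RInt (fun y => Q x y) c d).
  { intros. apply (RInt_Chasles (fun y => Q x y)); apply HQ; lra. }
  assert (HCP := CP c ltac:(lra)). assert (HCP' := CP d ltac:(lra)).
  assert (HCQ := CQ a ltac:(lra)). assert (HCQ' := CQ b ltac:(lra)).
  lra.
Qed.

(** An affine closed form has zero boundary integral, so only the errors of
    the two linearizations contribute. *)
Lemma boundary_integral_small (P Q : R -> R -> R) (x0 y0 eps : R) :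
  0 < eps -> closed_form_at P Q x0 y0 ->
  exists delta, 0 < delta /\ forall a b c d,
    a <= x0 <= b -> c <= y0 <= d -> b - a < delta -> d - c < delta ->
    closed_on P Q a b c d ->
    Rabs (boundary_integral P Q a b c d) <= eps * ((b - a) + (d - c)) ^ 2.
Proof.
  intros He (p & m & q & HP & HQ).
  assert (He2 : 0 < eps / 2) by lra.
  destruct (HP (mkposreal _ He2)) as [d1 H1].
  destruct (HQ (mkposreal _ He2)) as [d2 H2]. simpl in H1, H2.
  exists (Rmin d1 d2). split; [ apply Rmin_glb_lt; apply cond_pos | ].
  intros a b c d Ha Hc Hab Hcd H.
  assert (Hm1 := Rmin_l d1 d2). assert (Hm2 := Rmin_r d1 d2).
  destruct (closed_on_ex_RInt _ _ _ _ _ _ H) as [IP IQ].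
  set (s := (b - a) + (d - c)).
  assert (HP1 : forall x y, a <= x <= b -> c <= y <= d ->
    Rabs (P x y - P x0 y0 - (p * (x - x0) + m * (y - y0))) <= eps / 2 * s).
  { intros x y Hx Hy. eapply Rle_trans; [ apply H1; apply Rabs_def1; lra | ].
    apply Rmult_le_compat_l; [ lra | ].
    apply Rmax_lub; apply Rabs_le; unfold s; lra. }
  assert (HQ1 : forall x y, a <= x <= b -> c <= y <= d ->
    Rabs (Q x y - Q x0 y0 - (m * (x - x0) + q * (y - y0))) <= eps / 2 * s).
  { intros x y Hx Hy. eapply Rle_trans; [ apply H2; apply Rabs_def1; lra | ].
    apply Rmult_le_compat_l; [ lra | ].
    apply Rmax_lub; apply Rabs_le; unfold s; lra. }
  assert (EX1 : ex_RInt (fun x => P x c - P x d) a b)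
    by (apply (ex_RInt_minus (fun x => P x c) (fun x => P x d)); apply IP; lra).
  assert (EX2 : ex_RInt (fun y => Q b y - Q a y) c d)
    by (apply (ex_RInt_minus (fun y => Q b y) (fun y => Q a y)); apply IQ; lra).
  assert (B1 : Rabs (RInt (fun x => P x c - P x d - m * (c - d)) a b) <= (b - a) * (eps * s)).
  { apply abs_RInt_le_const; [ lra | | ].
    - apply (ex_RInt_minus (fun x => P x c - P x d) (fun _ => m * (c - d)));
        [ exact EX1 | apply ex_RInt_const ].
    - intros x Hx.
      assert (K1 := HP1 x c Hx ltac:(lra)). assert (K2 := HP1 x d Hx ltac:(lra)).
      apply Rabs_le_between in K1. apply Rabs_le_between in K2. apply Rabs_le. lra. }
  assert (B2 : Rabs (RInt (fun y => Q b y - Q a y - m * (b - a)) c d) <= (d - c) * (eps * s)).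
  { apply abs_RInt_le_const; [ lra | | ].
    - apply (ex_RInt_minus (fun y => Q b y - Q a y) (fun _ => m * (b - a)));
        [ exact EX2 | apply ex_RInt_const ].
    - intros y Hy.
      assert (K1 := HQ1 b y ltac:(lra) Hy). assert (K2 := HQ1 a y ltac:(lra) Hy).
      apply Rabs_le_between in K1. apply Rabs_le_between in K2. apply Rabs_le. lra. }
  rewrite (RInt_minus (fun x => P x c - P x d) (fun _ => m * (c - d))) in B1
    by (exact EX1 || apply ex_RInt_const).
  rewrite (RInt_minus (fun y => Q b y - Q a y) (fun _ => m * (b - a))) in B2
    by (exact EX2 || apply ex_RInt_const).
  rewrite RInt_const in B1, B2.
  unfold minus, plus, opp, scal in B1, B2; simpl in B1, B2; unfold mult in B1, B2; simpl in B1, B2.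
  unfold boundary_integral.
  apply Rabs_le_between in B1. apply Rabs_le_between in B2.
  assert (Hs : eps * s ^ 2 = (b - a) * (eps * s) + (d - c) * (eps * s)) by (unfold s; ring).
  rewrite Hs. apply Rabs_le. lra.
Qed.

Lemma nested_intervals (a b : nat -> R) :
  (forall n, a n <= a (S n)) -> (forall n, b (S n) <= b n) -> (forall n, a n <= b n) ->
  exists x, forall n, a n <= x <= b n.
Proof.
  intros Ha Hb Hab.
  assert (Ha' : forall n k, a n <= a (n + k)%nat).
  { intros n k; induction k as [|k IH]; [ rewrite Nat.add_0_r; lra | ].
    rewrite Nat.add_succ_r. specialize (Ha (n + k)%nat). lra. }
  assert (Hb' : forall n k, b (n + k)%nat <= b n).
  { intros n k; induction k as [|k IH]; [ rewrite Nat.add_0_r; lra | ].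
    rewrite Nat.add_succ_r. specialize (Hb (n + k)%nat). lra. }
  assert (Hnm : forall n m, a n <= b m).
  { intros n m. apply Rle_trans with (a (n + m)%nat); [ apply Ha' | ].
    apply Rle_trans with (b (n + m)%nat); [ apply Hab | ].
    rewrite Nat.add_comm. apply Hb'. }
  destruct (completeness (fun x => exists n, x = a n)) as [x [Hub Hlub]].
  - exists (b 0%nat). intros x [n ->]. apply Hnm.
  - exists (a 0%nat). now exists 0%nat.
  - exists x. intros n. split.
    + apply Hub. now exists n.
    + apply Hlub. intros y [k ->]. apply Hnm.
Qed.

Definition quarter (P Q : R -> R -> R) (r : R * R * R * R) : R * R * R * R :=
  let '(a, b, c, d) := r in
  let m := (a + b) / 2 in
  let n := (c + d) / 2 in
  let e := Rabs (boundary_integral P Q a b c d) / 4 in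
  if Rle_dec e (Rabs (boundary_integral P Q a m c n)) then (a, m, c, n)
  else if Rle_dec e (Rabs (boundary_integral P Q m b c n)) then (m, b, c, n)
  else if Rle_dec e (Rabs (boundary_integral P Q a m n d)) then (a, m, n, d)
  else (m, b, n, d).

Lemma quarter_spec (P Q : R -> R -> R) (a b c d : R) :
  a <= b -> c <= d -> closed_on P Q a b c d ->
  exists a' b' c' d', quarter P Q (a, b, c, d) = (a', b', c', d') /\
    a <= a' <= b' /\ b' <= b /\ c <= c' <= d' /\ d' <= d /\
    b' - a' = (b - a) / 2 /\ d' - c' = (d - c) / 2 /\
    Rabs (boundary_integral P Q a b c d) / 4 <= Rabs (boundary_integral P Q a' b' c' d').
Proof.
  intros Hab Hcd H.
  assert (S := boundary_integral_split P Q a b c d ((a + b) / 2) ((c + d) / 2)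
                 ltac:(lra) ltac:(lra) H).
  unfold quarter.
  destruct Rle_dec as [H1 | H1]; [ | destruct Rle_dec as [H2 | H2];
    [ | destruct Rle_dec as [H3 | H3] ] ];
    do 4 eexists; (split; [ reflexivity | ]);
    repeat (split; [ lra | ]); try assumption.
  apply Rnot_le_lt in H1, H2, H3.
  rewrite S in H1, H2, H3 |- *.
  set (B1 := boundary_integral P Q a ((a + b) / 2) c ((c + d) / 2)) in *.
  set (B2 := boundary_integral P Q ((a + b) / 2) b c ((c + d) / 2)) in *.
  set (B3 := boundary_integral P Q a ((a + b) / 2) ((c + d) / 2) d) in *.
  set (B4 := boundary_integral P Q ((a + b) / 2) b ((c + d) / 2) d) in *.
  assert (T1 := Rabs_triang (B1 + B2) (B3 + B4)).
  assert (T2 := Rabs_triang B1 B2). assert (T3 := Rabs_triang B3 B4).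
  lra.
Qed.

(** A rectangle whose boundary integral is [eta <> 0] contains a quarter with
    integral at least [eta / 4], and so on. The quarters shrink to a point, and
    an integral of size [eta / 4^n] over a rectangle of side [O(1 / 2^n)]
    contradicts [boundary_integral_small] at that point. *)
Theorem goursat (P Q : R -> R -> R) (a b c d : R) :
  a <= b -> c <= d -> closed_on P Q a b c d ->
  boundary_integral P Q a b c d = 0.
Proof.
  intros Hab Hcd H.
  destruct (Req_dec (boundary_integral P Q a b c d) 0) as [H0 | H0]; [ exact H0 | exfalso ].
  set (eta := Rabs (boundary_integral P Q a b c d)).
  assert (Heta : 0 < eta) by (apply Rabs_pos_lt; exact H0).
  set (r := fix r n := match n with O => (a, b, c, d) | S k => quarter P Q (r k) end).
  set (A n := fst (fst (fst (r n)))). set (B n := snd (fst (fst (r n)))).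
  set (C n := snd (fst (r n))). set (D n := snd (r n)).
  assert (Hr : forall n, r n = (A n, B n, C n, D n)).
  { intros n; unfold A, B, C, D; destruct (r n) as [[[? ?] ?] ?]; reflexivity. }
  assert (Inv : forall n, a <= A n <= B n /\ B n <= b /\ c <= C n <= D n /\ D n <= d /\
    B n - A n = (b - a) / 2 ^ n /\ D n - C n = (d - c) / 2 ^ n /\
    eta / 4 ^ n <= Rabs (boundary_integral P Q (A n) (B n) (C n) (D n)) /\
    A n <= A (S n) /\ B (S n) <= B n /\ C n <= C (S n) /\ D (S n) <= D n).
  { intros n.
    assert (Hstep : forall n, a <= A n <= B n /\ B n <= b /\ c <= C n <= D n /\ D n <= d ->
      A n <= A (S n) <= B (S n) /\ B (S n) <= B n /\ C n <= C (S n) <= D (S n) /\ D (S n) <= D n /\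
      B (S n) - A (S n) = (B n - A n) / 2 /\ D (S n) - C (S n) = (D n - C n) / 2 /\
      Rabs (boundary_integral P Q (A n) (B n) (C n) (D n)) / 4 <=
      Rabs (boundary_integral P Q (A (S n)) (B (S n)) (C (S n)) (D (S n)))).
    { intros k Hk.
      destruct (quarter_spec P Q (A k) (B k) (C k) (D k)) as (a' & b' & c' & d' & E & K);
        [ lra | lra | apply (closed_on_sub P Q a b c d); try lra; exact H | ].
      assert (E' : r (S k) = (a', b', c', d')).
      { change (r (S k)) with (quarter P Q (r k)). rewrite Hr. exact E. }
      replace (A (S k)) with a' by (unfold A; rewrite E'; reflexivity).
      replace (B (S k)) with b' by (unfold B; rewrite E'; reflexivity).
      replace (C (S k)) with c' by (unfold C; rewrite E'; reflexivity).
      replace (D (S k)) with d' by (unfold D; rewrite E'; reflexivity).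
      exact K. }
    assert (H1 : a <= A n <= B n /\ B n <= b /\ c <= C n <= D n /\ D n <= d /\
      B n - A n = (b - a) / 2 ^ n /\ D n - C n = (d - c) / 2 ^ n /\
      eta / 4 ^ n <= Rabs (boundary_integral P Q (A n) (B n) (C n) (D n))).
    { induction n as [|n IH].
      - unfold A, B, C, D; simpl. repeat (split; [ lra | ]). unfold eta. lra.
      - destruct (Hstep n ltac:(lra)) as (K1 & K2 & K3 & K4 & K5 & K6 & K7).
        destruct IH as (I1 & I2 & I3 & I4 & I5 & I6 & I7).
        repeat (split; [ lra | ]).
        split; [ rewrite K5, I5; simpl; field; apply pow_nonzero; lra | ].
        split; [ rewrite K6, I6; simpl; field; apply pow_nonzero; lra | ].
        eapply Rle_trans; [ | exact K7 ].
        replace (eta / 4 ^ S n) with (eta / 4 ^ n / 4)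
          by (simpl; field; apply pow_nonzero; lra).
        lra. }
    destruct (Hstep n ltac:(lra)) as (K1 & K2 & K3 & K4 & _).
    repeat (split; [ lra | ]). destruct H1 as (_ & _ & _ & _ & I5 & I6 & I7).
    repeat (split; [ assumption || lra | ]). lra. }
  destruct (nested_intervals A B) as [x0 Hx0]; try (intros n; apply Inv).
  destruct (nested_intervals C D) as [y0 Hy0]; try (intros n; apply Inv).
  set (s := (b - a) + (d - c)).
  assert (Hs : 0 <= s) by (unfold s; lra).
  assert (Heps : 0 < eta / (2 * (s ^ 2 + 1))).
  { apply Rdiv_lt_0_compat; [ exact Heta | nra ]. }
  assert (H00 : closed_form_at P Q x0 y0).
  { apply H; [ generalize (Hx0 0%nat) | generalize (Hy0 0%nat) ]; unfold A, B, C, D; simpl; lra. }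
  destruct (boundary_integral_small P Q x0 y0 _ Heps H00) as (delta & Hdelta & Hsmall).
  assert (Hn : exists n : nat, s / 2 ^ n < delta).
  { destruct (archimed_cor1 (delta / (s + 1))) as (N & HN & HN0);
      [ apply Rdiv_lt_0_compat; lra | ].
    exists N.
    assert (HN1 : 0 < INR N) by (apply lt_0_INR; exact HN0).
    assert (HN2 : INR N <= 2 ^ N).
    { clear. induction N as [|N IH]; [ simpl; lra | ].
      rewrite S_INR. simpl.
      assert (1 <= 2 ^ N) by (apply pow_R1_Rle; lra). lra. }
    apply Rle_lt_trans with (s / INR N).
    - apply Rmult_le_compat_l; [ exact Hs | ]. apply Rinv_le_contravar; assumption.
    - apply Rlt_le_trans with ((s + 1) * (delta / (s + 1))).
      + apply Rle_lt_trans with ((s + 1) * / INR N).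
        * apply Rmult_le_compat_r; [ left; apply Rinv_0_lt_compat; exact HN1 | lra ].
        * apply Rmult_lt_compat_l; [ lra | exact HN ].
      + right; field; lra. }
  destruct Hn as [n Hn].
  destruct (Inv n) as (I1 & I2 & I3 & I4 & I5 & I6 & I7 & _).
  assert (Hp : 0 < 2 ^ n) by (apply pow_lt; lra).
  assert (Hsum : (B n - A n) + (D n - C n) = s / 2 ^ n)
    by (rewrite I5, I6; unfold s; field; lra).
  assert (Hfin := Hsmall (A n) (B n) (C n) (D n) (Hx0 n) (Hy0 n) ltac:(lra) ltac:(lra)
    ltac:(apply (closed_on_sub P Q a b c d); try lra; exact H)).
  rewrite Hsum in Hfin.
  assert (Hlt : eta / (2 * (s ^ 2 + 1)) * (s / 2 ^ n) ^ 2 < eta / 4 ^ n).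
  { replace (4 ^ n) with (2 ^ n * 2 ^ n) by (rewrite <- Rpow_mult_distr; f_equal; lra).
    replace (eta / (2 * (s ^ 2 + 1)) * (s / 2 ^ n) ^ 2)
      with (eta / (2 ^ n * 2 ^ n) * (s ^ 2 / (2 * (s ^ 2 + 1)))).
    2:{ field. split; [ lra | nra ]. }
    rewrite <- (Rmult_1_r (eta / (2 ^ n * 2 ^ n))) at 2.
    apply Rmult_lt_compat_l; [ apply Rdiv_lt_0_compat; nra | ].
    apply Rmult_lt_reg_r with (2 * (s ^ 2 + 1)); [ nra | ].
    unfold Rdiv. rewrite Rmult_assoc, Rinv_l by nra. nra. }
  lra.
Qed.

(** * Paths and integrals with values in C *)

Definition is_path_derive (g : R -> C) (t : R) (v : C) : Prop :=
  is_derive (fun s => Re (g s)) t (Re v) /\ is_derive (fun s => Im (g s)) t (Im v).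

Definition continuous_path (g : R -> C) (t : R) : Prop :=
  continuous (fun s => Re (g s)) t /\ continuous (fun s => Im (g s)) t.

Definition C_int (g : R -> C) (a b : R) : C :=
  (RInt (fun t => Re (g t)) a b, RInt (fun t => Im (g t)) a b).

Lemma is_path_derive_continuous (g : R -> C) (t : R) (v : C) :
  is_path_derive g t v -> continuous_path g t.
Proof.
  intros [H1 H2]; split; apply (@ex_derive_continuous R_AbsRing R_NormedModule).
  - now exists (Re v).
  - now exists (Im v).
Qed.

Lemma is_path_derive_const (c : C) (t : R) : is_path_derive (fun _ => c) t 0.
Proof. split; apply (@is_derive_const R_AbsRing R_NormedModule). Qed.

Lemma is_path_derive_plus (f g : R -> C) (t : R) (a b : C) :
  is_path_derive f t a -> is_path_derive g t b ->
  is_path_derive (fun s => f s + g s)%C t (a + b)%C.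
Proof.
  intros [H1 H2] [H3 H4]; split.
  - exact (is_derive_plus _ _ _ _ _ H1 H3).
  - exact (is_derive_plus _ _ _ _ _ H2 H4).
Qed.

Lemma is_path_derive_minus (f g : R -> C) (t : R) (a b : C) :
  is_path_derive f t a -> is_path_derive g t b ->
  is_path_derive (fun s => f s - g s)%C t (a - b)%C.
Proof.
  intros [H1 H2] [H3 H4]; split.
  - exact (is_derive_minus _ _ _ _ _ H1 H3).
  - exact (is_derive_minus _ _ _ _ _ H2 H4).
Qed.

Lemma is_path_derive_mult (f g : R -> C) (t : R) (a b : C) :
  is_path_derive f t a -> is_path_derive g t b ->
  is_path_derive (fun s => f s * g s)%C t (a * g t + f t * b)%C.
Proof.
  intros [H1 H2] [H3 H4].
  assert (M : forall u v t a b, is_derive u t a -> is_derive v t b ->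
    is_derive (fun s : R => u s * v s) t (a * v t + u t * b)).
  { intros u v s a' b' Hu Hv. exact (is_derive_mult u v s a' b' Hu Hv Rmult_comm). }
  split.
  - eapply eq_rect.
    + exact (is_derive_minus _ _ _ _ _ (M _ _ _ _ _ H1 H3) (M _ _ _ _ _ H2 H4)).
    + unfold minus, plus, opp, Re, Im; simpl; ring.
  - eapply eq_rect.
    + exact (is_derive_plus _ _ _ _ _ (M _ _ _ _ _ H1 H4) (M _ _ _ _ _ H2 H3)).
    + unfold plus, Re, Im; simpl; ring.
Qed.

Lemma is_path_derive_scal (c : C) (g : R -> C) (t : R) (a : C) :
  is_path_derive g t a -> is_path_derive (fun s => c * g s)%C t (c * a)%C.
Proof.
  intros H. replace (c * a)%C with (0 * g t + c * a)%C by ring.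
  apply (is_path_derive_mult (fun _ => c)); [ apply is_path_derive_const | exact H ].
Qed.

Lemma is_path_derive_real (f : R -> R) (t v : R) :
  is_derive f t v -> is_path_derive (fun s => RtoC (f s)) t (RtoC v).
Proof.
  intros H; split; [ exact H | ].
  exact (@is_derive_const R_AbsRing R_NormedModule 0 t).
Qed.

Lemma is_path_derive_comp (h : C -> C) (g : R -> C) (t : R) (d v : C) :
  is_C_derive h (g t) d -> is_path_derive g t v ->
  is_path_derive (fun s => h (g s)) t (d * v)%C.
Proof.
  intros H [H1 H2].
  rewrite (surjective_pairing (g t)) in H.
  destruct (is_C_derive_differentiable _ _ _ _ H) as [D1 D2].
  assert (E : forall s, g s = (Re (g s), Im (g s))) by (intros; apply surjective_pairing).
  apply is_derive_Reals in H1, H2.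
  split; apply is_derive_Reals.
  - eapply derivable_pt_lim_ext; [ intros s; rewrite E; reflexivity | ].
    eapply eq_rect; [ exact (derivable_pt_lim_comp_2d _ _ _ _ _ _ _ _ D1 H1 H2) | ].
    unfold Re, Im; simpl; ring.
  - eapply derivable_pt_lim_ext; [ intros s; rewrite E; reflexivity | ].
    eapply eq_rect; [ exact (derivable_pt_lim_comp_2d _ _ _ _ _ _ _ _ D2 H1 H2) | ].
    unfold Re, Im; simpl; ring.
Qed.

Lemma is_path_derive_cis (t : R) : is_path_derive cis t (Ci * cis t)%C.
Proof.
  split.
  - eapply eq_rect; [ exact (is_derive_cos t) | simpl; ring ].
  - eapply eq_rect; [ exact (is_derive_sin t) | simpl; ring ].
Qed.

Lemma continuous_path_plus (f g : R -> C) (t : R) :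
  continuous_path f t -> continuous_path g t -> continuous_path (fun s => f s + g s)%C t.
Proof.
  intros [H1 H2] [H3 H4]; split.
  - exact (continuous_plus _ _ _ H1 H3).
  - exact (continuous_plus _ _ _ H2 H4).
Qed.

Lemma continuous_path_mult (f g : R -> C) (t : R) :
  continuous_path f t -> continuous_path g t -> continuous_path (fun s => f s * g s)%C t.
Proof.
  intros [H1 H2] [H3 H4]; split.
  - exact (continuous_minus _ _ _ (continuous_mult _ _ _ H1 H3) (continuous_mult _ _ _ H2 H4)).
  - exact (continuous_plus _ _ _ (continuous_mult _ _ _ H1 H4) (continuous_mult _ _ _ H2 H3)).
Qed.

Lemma continuous_path_ex_RInt (g : R -> C) (a b : R) :
  (forall t, continuous_path g t) ->
  ex_RInt (fun t => Re (g t)) a b /\ ex_RInt (fun t => Im (g t)) a b.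
Proof.
  intros H; split; apply (@ex_RInt_continuous R_CompleteNormedModule); intros t _; apply H.
Qed.

Lemma C_int_ext (f g : R -> C) (a b : R) :
  (forall t, f t = g t) -> C_int f a b = C_int g a b.
Proof.
  intros H. unfold C_int; f_equal; apply RInt_ext; intros; rewrite H; reflexivity.
Qed.

Lemma C_int_plus (f g : R -> C) (a b : R) :
  (forall t, continuous_path f t) -> (forall t, continuous_path g t) ->
  C_int (fun t => f t + g t)%C a b = (C_int f a b + C_int g a b)%C.
Proof.
  intros Hf Hg.
  destruct (continuous_path_ex_RInt f a b Hf) as [F1 F2].
  destruct (continuous_path_ex_RInt g a b Hg) as [G1 G2].
  unfold C_int, Cplus; simpl; f_equal.
  - exact (RInt_plus _ _ _ _ F1 G1).
  - exact (RInt_plus _ _ _ _ F2 G2).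
Qed.

Lemma C_int_scal (c : C) (g : R -> C) (a b : R) :
  (forall t, continuous_path g t) ->
  C_int (fun t => c * g t)%C a b = (c * C_int g a b)%C.
Proof.
  intros Hg.
  destruct (continuous_path_ex_RInt g a b Hg) as [G1 G2].
  assert (S : forall (k : R) (f : R -> R), ex_RInt f a b ->
    RInt (fun t => k * f t) a b = k * RInt f a b).
  { intros k f Hf. exact (RInt_scal f a b k Hf). }
  unfold C_int, Cmult; simpl; f_equal.
  - rewrite <- !S by assumption.
    apply (RInt_minus (fun t => fst c * fst (g t)) (fun t => snd c * snd (g t)));
      apply (ex_RInt_scal (V := R_NormedModule)); assumption.
  - rewrite <- !S by assumption.
    apply (RInt_plus (fun t => fst c * snd (g t)) (fun t => snd c * fst (g t)));
      apply (ex_RInt_scal (V := R_NormedModule)); assumption.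
Qed.

(** The factor 2 comes from bounding real and imaginary parts separately. *)
Lemma C_int_bound (g : R -> C) (a b M : R) : a <= b ->
  (forall t, continuous_path g t) -> (forall t, a <= t <= b -> Cmod (g t) <= M) ->
  Cmod (C_int g a b) <= 2 * ((b - a) * M).
Proof.
  intros Hab Hg HM.
  destruct (continuous_path_ex_RInt g a b Hg) as [G1 G2].
  eapply Rle_trans; [ apply Cmod_le_Rabs | ].
  assert (H1 : Rabs (Re (C_int g a b)) <= (b - a) * M).
  { apply abs_RInt_le_const; [ exact Hab | exact G1 | ].
    intros t Ht. eapply Rle_trans; [ apply Re_le_Cmod | apply HM, Ht ]. }
  assert (H2 : Rabs (Im (C_int g a b)) <= (b - a) * M).
  { apply abs_RInt_le_const; [ exact Hab | exact G2 | ].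
    intros t Ht. eapply Rle_trans; [ apply Im_le_Cmod | apply HM, Ht ]. }
  lra.
Qed.

Lemma C_int_derive (g dg : R -> C) (a b : R) :
  (forall t, is_path_derive g t (dg t)) -> (forall t, continuous_path dg t) ->
  C_int dg a b = (g b - g a)%C.
Proof.
  intros H Hc.
  unfold C_int. apply injective_projections; simpl; apply is_RInt_unique.
  - apply (is_RInt_derive (fun t => Re (g t)) (fun t => Re (dg t))); intros t _; [ apply H | apply Hc ].
  - apply (is_RInt_derive (fun t => Im (g t)) (fun t => Im (dg t))); intros t _; [ apply H | apply Hc ].
Qed.

Lemma is_C_derive_zero_const (h : C -> C) (z w : C) :
  (forall t, 0 <= t <= 1 -> is_C_derive h (z + t * (w - z))%C 0) -> h w = h z.
Proof.
  intros H.
  assert (P : forall t, 0 <= t <= 1 ->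
    is_path_derive (fun s : R => h (z + s * (w - z))%C) t 0).
  { intros t Ht. replace (RtoC 0) with (0 * (0 + (1 * (w - z) + t * 0)))%C by ring.
    apply (is_path_derive_comp h (fun s : R => z + s * (w - z))%C); [ exact (H t Ht) | ].
    apply is_path_derive_plus; [ apply is_path_derive_const | ].
    apply is_path_derive_mult; [ | apply is_path_derive_const ].
    apply is_path_derive_real. apply (@is_derive_id R_AbsRing). }
  assert (E0 : (z + 0 * (w - z))%C = z) by ring.
  assert (E1 : (z + 1 * (w - z))%C = w) by ring.
  transitivity (h (z + 1 * (w - z))%C); [ now rewrite E1 | ].
  transitivity (h (z + 0 * (w - z))%C); [ | now rewrite E0 ].
  apply injective_projections; symmetry.
  - apply (eq_is_derive (fun s : R => Re (h (z + s * (w - z))%C)) 0 1); [ | lra ].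
    intros t Ht; apply P; exact Ht.
  - apply (eq_is_derive (fun s : R => Im (h (z + s * (w - z))%C)) 0 1); [ | lra ].
    intros t Ht; apply P; exact Ht.
Qed.

Lemma Cmod_cis (t : R) : Cmod (cis t) = 1.
Proof.
  unfold Cmod, cis; simpl.
  replace (cos t * (cos t * 1) + sin t * (sin t * 1)) with (Rsqr (sin t) + Rsqr (cos t))
    by (unfold Rsqr; ring).
  rewrite sin2_cos2. apply sqrt_1.
Qed.

Lemma Cmod_triangle_inv (a b : C) : Cmod a - Cmod b <= Cmod (a - b).
Proof.
  assert (H := Cmod_triangle (a - b) b).
  replace (a - b + b)%C with a in H by ring. lra.
Qed.

(** * Cauchy's formula on a circle, and differentiability of the derivative *)

Lemma differentiable_pt_lim_Rmult (x y : R) :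
  differentiable_pt_lim Rmult x y y x.
Proof.
  intros eps. exists eps. intros u v Hu Hv.
  replace (u * v - x * y - (y * (u - x) + x * (v - y))) with ((u - x) * (v - y)) by ring.
  rewrite Rabs_mult. apply Rmult_le_compat; try apply Rabs_pos; [ lra | apply Rmax_r ].
Qed.

Lemma differentiable_pt_lim_mult (f g : R -> R -> R) (x y a b a' b' : R) :
  differentiable_pt_lim f x y a b -> differentiable_pt_lim g x y a' b' ->
  differentiable_pt_lim (fun u v => f u v * g u v) x y
    (g x y * a + f x y * a') (g x y * b + f x y * b').
Proof.
  apply differentiable_pt_lim_comp, differentiable_pt_lim_Rmult.
Qed.

Lemma differentiable_pt_lim_linear (c d x y : R) :
  differentiable_pt_lim (fun u v => c * u + d * v) x y c d.
Proof.
  intros eps. exists (mkposreal 1 Rlt_0_1). intros u v _ _.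
  replace (c * u + d * v - (c * x + d * y) - (c * (u - x) + d * (v - y))) with 0 by ring.
  rewrite Rabs_R0. apply Rmult_le_pos; [ left; apply cond_pos | ].
  eapply Rle_trans; [ apply Rabs_pos | apply Rmax_l ].
Qed.

Lemma differentiable_pt_lim_lincomb (f g : R -> R -> R) (c d x y a b a' b' : R) :
  differentiable_pt_lim f x y a b -> differentiable_pt_lim g x y a' b' ->
  differentiable_pt_lim (fun u v => c * f u v + d * g u v) x y
    (c * a + d * a') (c * b + d * b').
Proof.
  intros Hf Hg.
  exact (differentiable_pt_lim_comp (fun u v => c * u + d * v) _ _ _ _ _ _ _ _ _ _
    (differentiable_pt_lim_linear c d _ _) Hf Hg).
Qed.

Lemma differentiable_pt_lim_fst (f : R -> R) (x y l : R) :
  is_derive f x l -> differentiable_pt_lim (fun u _ => f u) x y l 0.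
Proof. intros H. apply differentiable_pt_lim_proj1_0, is_derive_Reals, H. Qed.

Lemma differentiable_pt_lim_snd (f : R -> R) (x y l : R) :
  is_derive f y l -> differentiable_pt_lim (fun _ v => f v) x y 0 l.
Proof.
  intros H eps.
  destruct (differentiable_pt_lim_fst f y x l H eps) as [d Hd].
  exists d. intros u v Hu Hv. specialize (Hd v u Hv Hu).
  rewrite Rmax_comm.
  replace (0 * (u - x) + l * (v - y)) with (l * (v - y) + 0 * (u - x)) by ring.
  exact Hd.
Qed.

Lemma differentiable_pt_lim_eq (f g : R -> R -> R) (x y a b a' b' : R) :
  differentiable_pt_lim f x y a b -> (forall u v, f u v = g u v) ->
  a = a' -> b = b' -> differentiable_pt_lim g x y a' b'.
Proof.
  intros H E <- <-. apply (differentiable_pt_lim_ext f); [ | exact H ].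
  exists (mkposreal 1 Rlt_0_1). intros u v _ _. apply E.
Qed.

(** [h(w + e^u g(v)) (du + k(v) dv)] is the pullback of [h(z) dz / (z - w)] under
    [z = w + e^u g(v)], where [k = g' / g]. Polar coordinates remove the
    singularity, which goes to minus infinity. *)
Lemma closed_form_pullback (h : C -> C) (w : C) (g : R -> C) (dg k : R -> C)
  (s t : R) (d k' : C) :
  is_C_derive h (w + exp s * g t)%C d ->
  is_path_derive g t (dg t) -> is_path_derive k t k' ->
  (g t * k t)%C = dg t ->
  closed_form_at (fun u v => Re (h (w + exp u * g v)%C))
                 (fun u v => Re (h (w + exp u * g v) * k v)%C) s t /\
  closed_form_at (fun u v => Im (h (w + exp u * g v)%C))
                 (fun u v => Im (h (w + exp u * g v) * k v)%C) s t.
Proof.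
  intros Hh [Hg1 Hg2] [Hk1 Hk2] Hgk.
  set (Z := fun u v => (w + exp u * g v)%C).
  assert (He : differentiable_pt_lim (fun u _ : R => exp u) s t (exp s) 0)
    by (apply differentiable_pt_lim_fst, is_derive_exp).
  assert (HZ1 : differentiable_pt_lim (fun u v => Re (Z u v)) s t
      (Re (exp s * g t)) (Re (exp s * dg t))).
  { eapply differentiable_pt_lim_eq.
    - apply (differentiable_pt_lim_lincomb (fun _ _ => 1) (fun u v => exp u * Re (g v))
        (Re w) 1 s t 0 0).
      + exact (differentiable_pt_lim_fst (fun _ => 1) s t 0
          (@is_derive_const R_AbsRing R_NormedModule 1 s)).
      + apply (differentiable_pt_lim_mult (fun u _ => exp u) (fun _ v => Re (g v))); [ exact He | ].
        apply (differentiable_pt_lim_snd (fun v => Re (g v))), Hg1.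
    - intros u v. unfold Z, Re, Im; simpl; ring.
    - unfold Re, Im; simpl; ring.
    - unfold Re, Im; simpl; ring. }
  assert (HZ2 : differentiable_pt_lim (fun u v => Im (Z u v)) s t
      (Im (exp s * g t)) (Im (exp s * dg t))).
  { eapply differentiable_pt_lim_eq.
    - apply (differentiable_pt_lim_lincomb (fun _ _ => 1) (fun u v => exp u * Im (g v))
        (Im w) 1 s t 0 0).
      + exact (differentiable_pt_lim_fst (fun _ => 1) s t 0
          (@is_derive_const R_AbsRing R_NormedModule 1 s)).
      + apply (differentiable_pt_lim_mult (fun u _ => exp u) (fun _ v => Im (g v))); [ exact He | ].
        apply (differentiable_pt_lim_snd (fun v => Im (g v))), Hg2.
    - intros u v. unfold Z, Re, Im; simpl; ring.
    - unfold Re, Im; simpl; ring.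
    - unfold Re, Im; simpl; ring. }
  change (w + exp s * g t)%C with (Z s t) in Hh.
  rewrite (surjective_pairing (Z s t)) in Hh.
  destruct (is_C_derive_differentiable _ _ _ _ Hh) as [D1 D2].
  assert (P1 := differentiable_pt_lim_comp _ _ _ _ _ _ _ _ _ _ _ D1 HZ1 HZ2).
  assert (P2 := differentiable_pt_lim_comp _ _ _ _ _ _ _ _ _ _ _ D2 HZ1 HZ2).
  assert (HZ : forall u v, (Re (Z u v), Im (Z u v)) = Z u v)
    by (intros; symmetry; apply surjective_pairing).
  assert (ET : forall f g : R -> R -> R, (forall u v, f u v = g u v) ->
    locally_2d (fun u v => f u v = g u v) s t)
    by (intros f1 g1 E; exists (mkposreal 1 Rlt_0_1); intros; apply E).
  apply (differentiable_pt_lim_ext _ (fun u v => Re (h (Z u v)))) in P1;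
    [ | apply ET; intros; rewrite HZ; reflexivity ].
  apply (differentiable_pt_lim_ext _ (fun u v => Im (h (Z u v)))) in P2;
    [ | apply ET; intros; rewrite HZ; reflexivity ].
  assert (K1 := differentiable_pt_lim_snd (fun v => Re (k v)) s t _ Hk1).
  assert (K2 := differentiable_pt_lim_snd (fun v => Im (k v)) s t _ Hk2).
  assert (Hgk1 : Re (dg t) = Re (g t) * Re (k t) - Im (g t) * Im (k t))
    by (rewrite <- Hgk; reflexivity).
  assert (Hgk2 : Im (dg t) = Re (g t) * Im (k t) + Im (g t) * Re (k t))
    by (rewrite <- Hgk; reflexivity).
  split.
  - do 3 eexists; split; [ exact P1 | ].
    eapply differentiable_pt_lim_eq.
    + exact (differentiable_pt_lim_lincomb _ _ 1 (-1) _ _ _ _ _ _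
        (differentiable_pt_lim_mult _ _ _ _ _ _ _ _ P1 K1)
        (differentiable_pt_lim_mult _ _ _ _ _ _ _ _ P2 K2)).
    + intros u v. unfold Z, Re, Im; simpl; ring.
    + replace (Re (exp s * dg t)%C) with (exp s * Re (dg t)) by (unfold Re; simpl; ring).
      replace (Im (exp s * dg t)%C) with (exp s * Im (dg t)) by (unfold Im; simpl; ring).
      rewrite Hgk1, Hgk2. unfold Re, Im; simpl; ring.
    + reflexivity.
  - do 3 eexists; split; [ exact P2 | ].
    eapply differentiable_pt_lim_eq.
    + exact (differentiable_pt_lim_lincomb _ _ 1 (1) _ _ _ _ _ _
        (differentiable_pt_lim_mult _ _ _ _ _ _ _ _ P1 K2)
        (differentiable_pt_lim_mult _ _ _ _ _ _ _ _ P2 K1)).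
    + intros u v. unfold Z, Re, Im; simpl; ring.
    + replace (Re (exp s * dg t)%C) with (exp s * Re (dg t)) by (unfold Re; simpl; ring).
      replace (Im (exp s * dg t)%C) with (exp s * Im (dg t)) by (unfold Im; simpl; ring).
      rewrite Hgk1, Hgk2. unfold Re, Im; simpl; ring.
    + reflexivity.
Qed.

Lemma exp_lt_pos_small (e : R) : 0 < e -> exists s, s < 0 /\ exp s < e.
Proof.
  intros He. exists (Rmin (-1) (ln (e / 2))). split.
  - eapply Rle_lt_trans; [ apply Rmin_l | lra ].
  - apply Rle_lt_trans with (exp (ln (e / 2))).
    + destruct (Rle_lt_or_eq_dec _ _ (Rmin_r (-1) (ln (e / 2)))) as [H | H];
        [ left; apply exp_increasing; exact H | rewrite H; lra ].
    + rewrite exp_ln; lra.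
Qed.

Lemma eq_of_Cmod_le (a b : C) : (forall e, 0 < e -> Cmod (a - b) <= e) -> a = b.
Proof.
  intros H. apply Ceq_minus. apply Cmod_eq_0.
  assert (H0 := Cmod_ge_0 (a - b)).
  destruct (Req_dec (Cmod (a - b)) 0) as [E | E]; [ exact E | ].
  specialize (H (Cmod (a - b) / 2) ltac:(lra)). lra.
Qed.

(** Contracting the closed curve [w + g] to [w] does not change the integral of
    the closed form h(z) dz / (z - w), by Goursat's lemma in the coordinates
    (s, t) with z = w + e^s g(t). As s tends to minus infinity, h(z) tends to
    h(w). *)
Lemma cauchy_formula (h : C -> C) (w : C) (g dg k dk : R -> C) (G K : R) :
  (forall s t, s <= 0 -> exists d, is_C_derive h (w + exp s * g t)%C d) ->
  (exists d, is_C_derive h w d) ->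
  (forall t, is_path_derive g t (dg t)) -> (forall t, is_path_derive k t (dk t)) ->
  (forall t, (g t * k t)%C = dg t) ->
  g (2 * PI) = g 0 ->
  (forall t, Cmod (g t) <= G) -> (forall t, Cmod (k t) <= K) ->
  C_int (fun t => h (w + g t) * k t)%C 0 (2 * PI) = (h w * C_int k 0 (2 * PI))%C.
Proof.
  intros Hh [d0 Hw] Hg Hk Hgk Hper HG HK.
  assert (HPI := PI_RGT_0).
  assert (HZc : forall s t, s <= 0 ->
    exists v, is_path_derive (fun t => h (w + exp s * g t)%C) t v).
  { intros s t Hs. destruct (Hh s t Hs) as [d Hd].
    exists (d * (0 + exp s * dg t))%C.
    apply (is_path_derive_comp h (fun t => w + exp s * g t)%C); [ exact Hd | ].
    apply is_path_derive_plus; [ apply is_path_derive_const | ].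
    apply is_path_derive_scal, Hg. }
  assert (Cc : forall s t, s <= 0 -> continuous_path (fun t => h (w + exp s * g t)%C) t).
  { intros s t Hs. destruct (HZc s t Hs) as [v Hv]. eapply is_path_derive_continuous, Hv. }
  assert (Ck : forall t, continuous_path k t)
    by (intros t; eapply is_path_derive_continuous, Hk).
  assert (Hshift : forall s, s < 0 ->
    C_int (fun t => h (w + exp 0 * g t) * k t)%C 0 (2 * PI) =
    C_int (fun t => h (w + exp s * g t) * k t)%C 0 (2 * PI)).
  { intros s Hs.
    assert (Hcl : forall u v, u <= 0 ->
      closed_form_at (fun u v => Re (h (w + exp u * g v)%C))
                     (fun u v => Re (h (w + exp u * g v) * k v)%C) u v /\
      closed_form_at (fun u v => Im (h (w + exp u * g v)%C))
                     (fun u v => Im (h (w + exp u * g v) * k v)%C) u v).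
    { intros u v Hu. destruct (Hh u v Hu) as [d Hd].
      exact (closed_form_pullback h w g dg k u v d (dk v) Hd (Hg v) (Hk v) (Hgk v)). }
    assert (G1 := goursat _ _ s 0 0 (2 * PI) ltac:(lra) ltac:(lra)
      (fun u v Hu Hv => proj1 (Hcl u v (proj2 Hu)))).
    assert (G2 := goursat _ _ s 0 0 (2 * PI) ltac:(lra) ltac:(lra)
      (fun u v Hu Hv => proj2 (Hcl u v (proj2 Hu)))).
    unfold boundary_integral in G1, G2. rewrite Hper in G1, G2.
    assert (Cs : forall t, continuous_path (fun t => h (w + exp s * g t) * k t)%C t).
    { intros t; apply (continuous_path_mult (fun t => h (w + exp s * g t)%C)); [ apply Cc; lra | apply Ck ]. }
    assert (C0 : forall t, continuous_path (fun t => h (w + exp 0 * g t) * k t)%C t).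
    { intros t; apply (continuous_path_mult (fun t => h (w + exp 0 * g t)%C)); [ apply Cc; lra | apply Ck ]. }
    destruct (continuous_path_ex_RInt _ 0 (2 * PI) Cs) as [S1 S2].
    destruct (continuous_path_ex_RInt _ 0 (2 * PI) C0) as [S3 S4].
    assert (Z0 : forall f : R -> R, RInt (fun x => f x - f x) s 0 = 0).
    { intros f. rewrite (RInt_ext _ (fun _ => 0)) by (intros; lra).
      rewrite RInt_const. unfold scal; simpl; unfold mult; simpl; ring. }
    rewrite (Z0 (fun x => Re (h (w + exp x * g 0)%C))) in G1.
    rewrite (Z0 (fun x => Im (h (w + exp x * g 0)%C))) in G2.
    assert (M : forall f1 f2 : R -> R, ex_RInt f1 0 (2 * PI) -> ex_RInt f2 0 (2 * PI) ->
      RInt (fun y => f1 y - f2 y) 0 (2 * PI) = RInt f1 0 (2 * PI) - RInt f2 0 (2 * PI))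
      by (intros f1 f2; apply (RInt_minus (V := R_CompleteNormedModule))).
    rewrite (M _ _ S3 S1) in G1. rewrite (M _ _ S4 S2) in G2.
    unfold C_int. f_equal; lra. }
  apply eq_of_Cmod_le. intros e He.
  assert (HK0 : 0 <= K) by (eapply Rle_trans; [ apply Cmod_ge_0 | apply (HK 0) ]).
  assert (HG0 : 0 <= G) by (eapply Rle_trans; [ apply Cmod_ge_0 | apply (HG 0) ]).
  rewrite is_C_derive_eps in Hw. destruct (Hw (mkposreal 1 Rlt_0_1)) as [del Hdel]. simpl in Hdel.
  assert (HD0 := Cmod_ge_0 d0).
  set (A := (Cmod d0 + 1) * (G + 1)).
  assert (HA : 0 < A) by (apply Rmult_lt_0_compat; lra).
  assert (HQ : 0 < 4 * PI * (A * (K + 1))).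
  { apply Rmult_lt_0_compat; [ lra | ]. apply Rmult_lt_0_compat; lra. }
  destruct (exp_lt_pos_small (Rmin (del / (G + 1)) (e / (4 * PI * (A * (K + 1)))))) as [s [Hs Hes]].
  { apply Rmin_glb_lt; apply Rdiv_lt_0_compat; try (apply cond_pos); try lra; exact HQ. }
  assert (Hes1 : exp s < del / (G + 1)) by (eapply Rlt_le_trans; [ exact Hes | apply Rmin_l ]).
  assert (Hes2 : exp s < e / (4 * PI * (A * (K + 1)))) by (eapply Rlt_le_trans; [ exact Hes | apply Rmin_r ]).
  assert (Hep := exp_pos s).
  rewrite (C_int_ext _ (fun t => h (w + exp 0 * g t) * k t)%C) by (intros t; rewrite exp_0; f_equal; f_equal; ring).
  rewrite (Hshift s Hs). rewrite <- C_int_scal by exact Ck.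
  assert (Cd : forall t, continuous_path (fun t => h (w + exp s * g t) * k t)%C t).
  { intros t; apply (continuous_path_mult (fun t => h (w + exp s * g t)%C)); [ apply Cc; lra | apply Ck ]. }
  assert (Cconst : forall c t, continuous_path (fun _ => c) t)
    by (intros c t; eapply is_path_derive_continuous, is_path_derive_const).
  assert (Cm : forall t, continuous_path (fun t => (- (1))%C * (h w * k t))%C t).
  { intros t. apply (continuous_path_mult (fun _ => _)); [ apply Cconst | ].
    apply (continuous_path_mult (fun _ => h w)); [ apply Cconst | apply Ck ]. }
  replace (C_int (fun t => h (w + exp s * g t) * k t) 0 (2 * PI) - C_int (fun t => h w * k t) 0 (2 * PI))%C
    with (C_int (fun t => h (w + exp s * g t) * k t + (- (1))%C * (h w * k t)) 0 (2 * PI))%C.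
  2: { rewrite C_int_plus by assumption.
       rewrite (C_int_scal (- (1))%C) by (intros t; apply (continuous_path_mult (fun _ => h w)); [ apply Cconst | apply Ck ]).
       ring. }
  eapply Rle_trans.
  - apply C_int_bound with (M := A * (K + 1) * exp s); [ lra | | ].
    + intros t. apply continuous_path_plus; [ apply Cd | apply Cm ].
    + intros t _.
      replace (h (w + exp s * g t) * k t + (- (1))%C * (h w * k t))%C
        with ((h (w + exp s * g t) - h w) * k t)%C by ring.
      rewrite Cmod_mult.
      assert (Hnear : Cmod (w + exp s * g t - w)%C <= exp s * G).
      { replace (w + exp s * g t - w)%C with (exp s * g t)%C by ring.
        rewrite Cmod_mult, Cmod_R, Rabs_pos_eq by lra. specialize (HG t). nra. }
      assert (Hlt : exp s * G < del).
      { apply Rlt_le_trans with (del / (G + 1) * (G + 1)); [ nra | right; field; lra ]. }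
      assert (Hx := Hdel (w + exp s * g t)%C ltac:(lra)).
      assert (Hd : Cmod (h (w + exp s * g t) - h w)%C <= (Cmod d0 + 1) * (exp s * G)).
      { replace (h (w + exp s * g t) - h w)%C with
          ((h (w + exp s * g t) - h w - d0 * (w + exp s * g t - w)) + d0 * (w + exp s * g t - w))%C by ring.
        eapply Rle_trans; [ apply Cmod_triangle | ]. rewrite Cmod_mult. nra. }
      assert (Hkt := HK t). assert (Hk0 := Cmod_ge_0 (k t)).
      replace (A * (K + 1) * exp s) with (((Cmod d0 + 1) * (exp s * (G + 1))) * (K + 1)) by (unfold A; ring).
      apply Rmult_le_compat; [ apply Cmod_ge_0 | exact Hk0 | | lra ].
      eapply Rle_trans; [ exact Hd | ]. apply Rmult_le_compat_l; nra.
  - apply Rle_trans with ((4 * PI * (A * (K + 1))) * (e / (4 * PI * (A * (K + 1))))).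
    + replace (2 * ((2 * PI - 0) * (A * (K + 1) * exp s))) with ((4 * PI * (A * (K + 1))) * exp s) by ring.
      apply Rmult_le_compat_l; lra.
    + right; field. repeat split; lra.
Qed.

(** For integrals depending on a parameter: a quadratic remainder of the integrand
    integrates to a quadratic remainder, and no limit has to be exchanged with the
    integral. *)
Lemma is_C_derive_quadratic (h : C -> C) (w d : C) (K r : R) : 0 < r ->
  (forall e, Cmod e < r -> Cmod (h (w + e) - h w - d * e)%C <= K * Cmod e ^ 2) ->
  is_C_derive h w d.
Proof.
  intros Hr H. apply is_C_derive_eps. intros eps.
  assert (He := cond_pos eps). assert (HK := Rabs_pos K).
  assert (Hd : 0 < Rmin r (eps / (Rabs K + 1))).
  { apply Rmin_glb_lt; [ exact Hr | apply Rdiv_lt_0_compat; lra ]. }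
  exists (mkposreal _ Hd); simpl. intros z Hz.
  assert (Hz1 : Cmod (z - w) < r) by (eapply Rlt_le_trans; [ exact Hz | apply Rmin_l ]).
  assert (Hz2 : Cmod (z - w) < eps / (Rabs K + 1)) by (eapply Rlt_le_trans; [ exact Hz | apply Rmin_r ]).
  specialize (H (z - w)%C Hz1). replace (w + (z - w))%C with z in H by ring.
  eapply Rle_trans; [ exact H | ].
  assert (H0 := Cmod_ge_0 (z - w)).
  assert (H1 : (Rabs K + 1) * Cmod (z - w) <= eps).
  { apply Rle_trans with ((Rabs K + 1) * (eps / (Rabs K + 1))).
    - apply Rmult_le_compat_l; lra.
    - right; field; lra. }
  assert (H2 := Rle_abs K).
  replace (K * Cmod (z - w) ^ 2) with (K * Cmod (z - w) * Cmod (z - w)) by ring.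
  apply Rmult_le_compat_r; [ exact H0 | ].
  apply Rle_trans with (Rabs K * Cmod (z - w)); nra.
Qed.

Lemma continuous_path_comp_inv (g : R -> C) (t : R) :
  continuous_path g t -> g t <> 0 -> continuous_path (fun s => / g s)%C t.
Proof.
  intros [H1 H2] Hg.
  assert (Hn : Re (g t) ^ 2 + Im (g t) ^ 2 <> 0).
  { rewrite <- Cmod_sqr. apply pow_nonzero. apply Rgt_not_eq. apply Cmod_gt_0, Hg. }
  assert (Sq : forall f : R -> R, continuous f t -> continuous (fun s => f s ^ 2) t).
  { intros f Hf. apply (continuous_ext (fun s => f s * f s)); [ intros; simpl; ring | ].
    exact (continuous_mult f f t Hf Hf). }
  assert (Cn : continuous (fun s => Re (g s) ^ 2 + Im (g s) ^ 2) t)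
    by exact (continuous_plus _ _ _ (Sq _ H1) (Sq _ H2)).
  assert (Ci : continuous (fun s => / (Re (g s) ^ 2 + Im (g s) ^ 2)) t).
  { apply (continuous_comp (fun s => Re (g s) ^ 2 + Im (g s) ^ 2) Rinv); [ exact Cn | ].
    apply continuous_Rinv, Hn. }
  split.
  - apply (continuous_mult (K := R_AbsRing)); assumption.
  - apply (continuous_mult (K := R_AbsRing)); [ | exact Ci ].
    apply (continuous_opp (V := R_NormedModule)); exact H2.
Qed.

Lemma continuous_path_inv_minus (z : R -> C) (w : C) (t : R) :
  continuous_path z t -> z t <> w -> continuous_path (fun s => / (z s - w))%C t.
Proof.
  intros H Hn. apply (continuous_path_comp_inv (fun s => z s - w)%C).
  - apply (continuous_path_plus z (fun _ => - w)%C); [ exact H | ].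
    eapply is_path_derive_continuous, is_path_derive_const.
  - now apply Cminus_eq_contra.
Qed.

Ltac continuous_path_tac :=
  intros;
  repeat lazymatch goal with
  | |- continuous_path (fun t => Cplus (@?f t) (@?g t)) ?x => apply (continuous_path_plus f g x)
  | |- continuous_path (fun t => Cmult (@?f t) (@?g t)) ?x => apply (continuous_path_mult f g x)
  end;
  match goal with
  | |- continuous_path (fun _ => ?c) _ =>
      exact (is_path_derive_continuous _ _ _ (is_path_derive_const c _))
  | H : forall t, continuous_path _ t |- _ => exact (H _)
  end.

Lemma neq_of_Cmod_ge (a b : C) (rho : R) : 0 < rho -> rho <= Cmod (a - b) -> a <> b.
Proof.
  intros Hr H E. subst. replace (b - b)%C with (RtoC 0) in H by ring.
  rewrite Cmod_0 in H. lra.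
Qed.

Lemma Cmod_inv_le (a : C) (rho : R) : 0 < rho -> rho <= Cmod a -> Cmod (/ a) <= / rho.
Proof.
  intros Hr H. rewrite Cmod_inv by (apply Cmod_gt_0; lra).
  apply Rinv_le_contravar; assumption.
Qed.

(** The expansions of [1 / (z - w)] and [1 / (z - w)^2] in the increment of [w] have
    quadratic remainders, uniformly for [z] at distance at least [rho] of [w]. *)
Lemma cauchy_integral_derive (phi z : R -> C) (w : C) (rho M a b : R) : a <= b -> 0 < rho ->
  (forall t, continuous_path phi t) -> (forall t, continuous_path z t) ->
  (forall t, a <= t <= b -> Cmod (phi t) <= M) -> (forall t, rho <= Cmod (z t - w)) ->
  is_C_derive (fun w => C_int (fun t => phi t * / (z t - w))%C a b) w
    (C_int (fun t => phi t * (/ (z t - w) * / (z t - w)))%C a b) /\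
  is_C_derive (fun w => C_int (fun t => phi t * (/ (z t - w) * / (z t - w)))%C a b) w
    (2 * C_int (fun t => phi t * (/ (z t - w) * / (z t - w) * / (z t - w)))%C a b)%C.
Proof.
  intros Hab Hr Hphi Hz HM Hrho.
  assert (HM0 : 0 <= M) by (eapply Rle_trans; [ apply Cmod_ge_0 | apply (HM a); lra ]).
  set (q := / (rho / 2)).
  assert (Hq : 0 < q) by (apply Rinv_0_lt_compat; lra).
  assert (Far : forall e, Cmod e < rho / 2 -> forall t, rho / 2 <= Cmod (z t - (w + e))).
  { intros e He t. specialize (Hrho t).
    assert (H := Cmod_triangle_inv (z t - w)%C e).
    replace (z t - w - e)%C with (z t - (w + e))%C in H by ring. lra. }
  assert (Cinv : forall e, Cmod e < rho / 2 -> forall t, continuous_path (fun t => / (z t - (w + e)))%C t).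
  { intros e He t. apply continuous_path_inv_minus; [ apply Hz | ].
    apply neq_of_Cmod_ge with (rho / 2); [ lra | apply Far, He ]. }
  assert (C0 : forall t, continuous_path (fun t => / (z t - w))%C t).
  { intros t. apply continuous_path_inv_minus; [ apply Hz | ].
    apply neq_of_Cmod_ge with rho; [ lra | apply Hrho ]. }
  assert (Bi : forall e, Cmod e < rho / 2 -> forall t, Cmod (/ (z t - (w + e))) <= q)
    by (intros e He t; apply Cmod_inv_le; [ lra | apply Far, He ]).
  assert (B0 : forall t, Cmod (/ (z t - w)) <= q).
  { intros t. apply Cmod_inv_le; [ lra | ]. specialize (Hrho t). lra. }
  split.
  - apply is_C_derive_quadratic with (K := 2 * ((b - a) * (M * (q * q * q)))) (r := rho / 2); [ lra | ].
    intros e He.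
    assert (Ce := Cinv e He).
    replace (C_int (fun t => phi t * / (z t - (w + e))) a b - C_int (fun t => phi t * / (z t - w)) a b -
       C_int (fun t => phi t * (/ (z t - w) * / (z t - w))) a b * e)%C
      with (C_int (fun t => (e * e) * (phi t * (/ (z t - w) * / (z t - w) * / (z t - (w + e))))) a b)%C.
    2: { transitivity (C_int (fun t => phi t * / (z t - (w + e)) + (- (1))%C * (phi t * / (z t - w)) +
           (- e) * (phi t * (/ (z t - w) * / (z t - w)))) a b)%C.
      - apply C_int_ext. intros t. field. split; apply Cminus_eq_contra.
        + apply neq_of_Cmod_ge with rho; [ lra | apply Hrho ].
        + apply neq_of_Cmod_ge with (rho / 2); [ lra | apply Far, He ].
      - rewrite !C_int_plus, !C_int_scal; [ ring | continuous_path_tac .. ]. }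
    rewrite C_int_scal by continuous_path_tac.
    rewrite Cmod_mult, Cmod_mult.
    replace (Cmod e * Cmod e) with (Cmod e ^ 2) by ring. rewrite Rmult_comm.
    apply Rmult_le_compat_r; [ apply pow2_ge_0 | ].
    apply C_int_bound; [ exact Hab | | ].
    + continuous_path_tac.
    + intros t Ht. specialize (HM t Ht). rewrite !Cmod_mult.
      repeat (apply Rmult_le_compat || apply Rmult_le_pos || apply Cmod_ge_0 || apply B0 || apply (Bi e He) || exact HM).
  - apply is_C_derive_quadratic with (K := 2 * ((b - a) * (M * (3 * (q * q * q * q) + 1 * (q * q * q * q * q)))))
      (r := Rmin 1 (rho / 2)); [ apply Rmin_glb_lt; lra | ].
    intros e He'.
    assert (He : Cmod e < rho / 2) by (eapply Rlt_le_trans; [ exact He' | apply Rmin_r ]).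
    assert (He1 : Cmod e < 1) by (eapply Rlt_le_trans; [ exact He' | apply Rmin_l ]).
    set (A := fun t => (/ (z t - w))%C). set (B := fun t => (/ (z t - (w + e)))%C).
    assert (CA : forall t, continuous_path A t) by exact C0.
    assert (CB : forall t, continuous_path B t) by exact (Cinv e He).
    replace (C_int (fun t => phi t * (/ (z t - (w + e)) * / (z t - (w + e)))) a b -
       C_int (fun t => phi t * (/ (z t - w) * / (z t - w))) a b -
       2 * C_int (fun t => phi t * (/ (z t - w) * / (z t - w) * / (z t - w))) a b * e)%C
      with (C_int (fun t => (e * e) * (phi t * (3 * (A t * A t * A t * B t) +
              e * (A t * A t * A t * B t * B t)))) a b)%C.
    2: { transitivity (C_int (fun t => phi t * (B t * B t) + (- (1))%C * (phi t * (A t * A t)) +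
           (- (2 * e)) * (phi t * (A t * A t * A t))) a b)%C.
      - apply C_int_ext. intros t. unfold A, B. field. split; apply Cminus_eq_contra.
        + apply neq_of_Cmod_ge with rho; [ lra | apply Hrho ].
        + apply neq_of_Cmod_ge with (rho / 2); [ lra | apply Far, He ].
      - rewrite !C_int_plus, !C_int_scal; [ unfold A, B; ring | continuous_path_tac .. ]. }
    assert (Cb : forall t, continuous_path (fun t => phi t * (3 * (A t * A t * A t * B t) +
              e * (A t * A t * A t * B t * B t)))%C t) by continuous_path_tac.
    rewrite C_int_scal by exact Cb.
    rewrite Cmod_mult, Cmod_mult.
    replace (Cmod e * Cmod e) with (Cmod e ^ 2) by ring. rewrite Rmult_comm.
    apply Rmult_le_compat_r; [ apply pow2_ge_0 | ].
    apply C_int_bound; [ exact Hab | exact Cb | ].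
    intros t Ht. rewrite Cmod_mult.
    apply Rmult_le_compat; [ apply Cmod_ge_0 | apply Cmod_ge_0 | apply HM, Ht | ].
    eapply Rle_trans; [ apply Cmod_triangle | ]. rewrite !Cmod_mult, Cmod_R, Rabs_pos_eq by lra.
    assert (HA := B0 t). assert (HB := Bi e He t).
    apply Rplus_le_compat;
      repeat (apply Rmult_le_compat || apply Rmult_le_pos || apply Cmod_ge_0 || exact HA || exact HB || lra).
Qed.

Lemma continuous_path_bounded (g : R -> C) (a b : R) :
  (forall t, continuous_path g t) -> exists M, forall t, a <= t <= b -> Cmod (g t) <= M.
Proof.
  intros H.
  destruct (bounded_continuity (V := R_NormedModule) (fun t => Re (g t)) a b) as [M1 H1];
    [ intros; apply H | ].
  destruct (bounded_continuity (V := R_NormedModule) (fun t => Im (g t)) a b) as [M2 H2];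
    [ intros; apply H | ].
  exists (M1 + M2). intros t Ht.
  eapply Rle_trans; [ apply Cmod_le_Rabs | ].
  specialize (H1 t Ht). specialize (H2 t Ht).
  unfold norm in H1, H2; simpl in H1, H2; unfold abs in H1, H2; simpl in H1, H2. lra.
Qed.

(** Near [z0], both [h] and [h'] are Cauchy integrals over a circle around [z0],
    and such integrals are differentiable. *)
Theorem C_derive_holomorphic (h : C -> C) (z0 : C) (r : R) : 0 < r ->
  (forall z, Cmod (z - z0) < r -> exists d, is_C_derive h z d) ->
  exists d2, is_C_derive (C_derive h) z0 d2.
Proof.
  intros Hr H. assert (HPI := PI_RGT_0).
  set (R := r / 2). assert (HR : 0 < R) by (unfold R; lra).
  set (zeta := fun t => (z0 + R * cis t)%C).
  set (dz := fun t => (R * (Ci * cis t))%C).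
  assert (Hzeta : forall t, is_path_derive zeta t (dz t)).
  { intros t. unfold zeta, dz. replace (R * (Ci * cis t))%C with (0 + R * (Ci * cis t))%C by ring.
    apply is_path_derive_plus; [ apply is_path_derive_const | ].
    apply is_path_derive_scal, is_path_derive_cis. }
  assert (Hdz : forall t, is_path_derive dz t (R * (Ci * (Ci * cis t)))%C).
  { intros t. apply is_path_derive_scal, is_path_derive_scal, is_path_derive_cis. }
  assert (Hmod : forall t, Cmod (zeta t - z0) = R).
  { intros t. unfold zeta. replace (z0 + R * cis t - z0)%C with (R * cis t)%C by ring.
    rewrite Cmod_mult, Cmod_R, Cmod_cis, Rabs_pos_eq; lra. }
  assert (Hdmod : forall t, Cmod (dz t) = R).
  { intros t. unfold dz. rewrite !Cmod_mult, Cmod_R, Cmod_cis, Cmod_Ci, Rabs_pos_eq; lra. }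
  assert (Hin : forall w, Cmod (w - z0) < R -> forall t, R - Cmod (w - z0) <= Cmod (zeta t - w)).
  { intros w Hw t. assert (T := Cmod_triangle_inv (zeta t - z0)%C (w - z0)%C).
    replace (zeta t - z0 - (w - z0))%C with (zeta t - w)%C in T by ring.
    rewrite Hmod in T. lra. }
  assert (Hne : forall w, Cmod (w - z0) < R -> forall t, (zeta t - w)%C <> 0).
  { intros w Hw t. apply Cmod_gt_0. specialize (Hin w Hw t). lra. }
  (* The integral of [k w] is 2 pi i for [w = z0] by a direct computation. It does
     not depend on [w], because its derivative in [w] integrates
     [zeta' / (zeta - w)^2], the derivative of a periodic function. *)
  set (k := fun w t => (dz t * / (zeta t - w))%C).
  assert (Hk : forall w, Cmod (w - z0) < R -> forall t, is_path_derive (k w) t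
    (R * (Ci * (Ci * cis t)) * / (zeta t - w) +
     dz t * (- / ((zeta t - w) * (zeta t - w)) * (dz t - 0)))%C).
  { intros w Hw t. unfold k.
    apply is_path_derive_mult; [ apply Hdz | ].
    apply (is_path_derive_comp Cinv (fun t => zeta t - w)%C).
    - apply is_C_derive_inv, Hne, Hw.
    - apply is_path_derive_minus; [ apply Hzeta | apply is_path_derive_const ]. }
  assert (Cz : forall t, continuous_path zeta t)
    by (intros t; eapply is_path_derive_continuous, Hzeta).
  assert (Cdz : forall t, continuous_path dz t)
    by (intros t; eapply is_path_derive_continuous, Hdz).
  set (N := fun w => C_int (k w) 0 (2 * PI)).
  assert (HN' : forall w, Cmod (w - z0) < R -> is_C_derive N w 0).
  { intros w Hw.
    destruct (cauchy_integral_derive dz zeta w (R - Cmod (w - z0)) R 0 (2 * PI)) as [HD _];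
      try lra; try assumption.
    - intros t _; rewrite Hdmod; lra.
    - apply Hin, Hw.
    - replace (RtoC 0) with (C_int (fun t => dz t * (/ (zeta t - w) * / (zeta t - w)))%C 0 (2 * PI)); [ exact HD | ].
      rewrite (C_int_derive (fun t => (- (1))%C * / (zeta t - w))%C).
      + unfold zeta, cis. rewrite cos_2PI, sin_2PI, cos_0, sin_0. ring.
      + intros t. replace (dz t * (/ (zeta t - w) * / (zeta t - w)))%C with
          ((- (1))%C * (- / ((zeta t - w) * (zeta t - w)) * (dz t - 0)))%C
          by (field; apply Hne, Hw).
        apply is_path_derive_scal.
        apply (is_path_derive_comp Cinv (fun t => zeta t - w)%C).
        * apply is_C_derive_inv, Hne, Hw.
        * apply is_path_derive_minus; [ apply Hzeta | apply is_path_derive_const ].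
      + assert (Ci : forall t, continuous_path (fun s => / (zeta s - w))%C t).
        { intros t. apply continuous_path_inv_minus; [ apply Cz | ].
          intros E. apply (Hne w Hw t). rewrite E. ring. }
        continuous_path_tac. }
  assert (Hz00 : Cmod (z0 - z0) < R) by (replace (z0 - z0)%C with (RtoC 0) by ring; rewrite Cmod_0; lra).
  assert (HN0 : N z0 = (2 * PI * Ci)%C).
  { unfold N. rewrite (C_int_ext _ (fun _ => Ci)).
    - unfold C_int, Ci; simpl. rewrite !RInt_const. unfold scal; simpl; unfold mult; simpl.
      apply injective_projections; simpl; ring.
    - intros t. unfold k, dz. assert (E := Hne z0 Hz00 t). unfold zeta in E |- *.
      replace (z0 + R * cis t - z0)%C with (R * cis t)%C in * by ring.
      field. split; intros E0; apply E; rewrite E0; ring. }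
  assert (HN : forall w, Cmod (w - z0) < R -> N w = (2 * PI * Ci)%C).
  { intros w Hw. rewrite <- HN0. apply is_C_derive_zero_const. intros t Ht.
    apply HN'. replace (z0 + t * (w - z0) - z0)%C with (t * (w - z0))%C by ring.
    rewrite Cmod_mult, Cmod_R, Rabs_pos_eq by lra.
    assert (H0 := Cmod_ge_0 (w - z0)). nra. }
  assert (H2pi : (2 * PI * Ci)%C <> 0).
  { apply Cmult_neq_0; [ | apply Ci_nz ].
    rewrite <- RtoC_mult. intros E. apply RtoC_inj in E. lra. }
  assert (Hcauchy : forall w, Cmod (w - z0) < R ->
    h w = (/ (2 * PI * Ci) * C_int (fun t => h (zeta t) * dz t * / (zeta t - w)) 0 (2 * PI))%C).
  { intros w Hw.
    assert (Hw0 := Cmod_ge_0 (w - z0)).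
    assert (F := fun G K Hh Hd Hg Hgk =>
      cauchy_formula h w (fun t => zeta t - w)%C dz (k w) _ G K Hh Hd Hg (Hk w Hw) Hgk).
    rewrite (C_int_ext _ (fun t => h (w + (zeta t - w)) * k w t)%C).
    - rewrite (F (2 * R) (R * / (R - Cmod (w - z0)))).
      + fold (N w). rewrite HN by exact Hw. field. split; [ apply Ci_nz | ].
        intros E; apply RtoC_inj in E; lra.
      + intros s t Hs. apply H.
        assert (Hes : 0 < exp s <= 1).
        { split; [ apply exp_pos | ]. rewrite <- exp_0.
          destruct (Rle_lt_or_eq_dec _ _ Hs) as [Hs' | ->]; [ left; now apply exp_increasing | lra ]. }
        replace (w + exp s * (zeta t - w) - z0)%C
          with ((1 - exp s)%R * (w - z0) + exp s * (zeta t - z0))%C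
          by (rewrite RtoC_minus; ring).
        eapply Rle_lt_trans; [ apply Cmod_triangle | ].
        rewrite !Cmod_mult, !Cmod_R, Hmod, !Rabs_pos_eq by lra.
        apply Rle_lt_trans with R; [ nra | unfold R; lra ].
      + apply H. apply Rlt_trans with R; [ exact Hw | unfold R; lra ].
      + intros t. replace (dz t) with (dz t - 0)%C by ring.
        apply is_path_derive_minus; [ apply Hzeta | apply is_path_derive_const ].
      + intros t. unfold k. field. apply Hne, Hw.
      + unfold zeta, cis. rewrite cos_2PI, sin_2PI, cos_0, sin_0. reflexivity.
      + intros t. replace (zeta t - w)%C with ((zeta t - z0) + - (w - z0))%C by ring.
        eapply Rle_trans; [ apply Cmod_triangle | ]. rewrite Cmod_opp, Hmod. lra.
      + intros t. unfold k. rewrite Cmod_mult, Hdmod.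
        apply Rmult_le_compat_l; [ lra | ]. apply Cmod_inv_le; [ lra | apply Hin, Hw ].
    - intros t. unfold k. replace (w + (zeta t - w))%C with (zeta t) by ring. ring. }
  assert (Hbd : forall t, exists d, is_C_derive h (zeta t) d).
  { intros t. apply H. rewrite Hmod. unfold R; lra. }
  assert (Ch : forall t, continuous_path (fun t => h (zeta t)) t).
  { intros t. destruct (Hbd t) as [d Hd]. eapply is_path_derive_continuous.
    apply (is_path_derive_comp h zeta); [ exact Hd | apply Hzeta ]. }
  assert (Cphi : forall t, continuous_path (fun t => h (zeta t) * dz t)%C t) by continuous_path_tac.
  destruct (continuous_path_bounded _ 0 (2 * PI) Cphi) as [M HM].
  set (c := (/ (2 * PI * Ci))%C) in *.
  assert (HD : forall w, Cmod (w - z0) < R ->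
    is_C_derive h w (c * C_int (fun t => h (zeta t) * dz t * (/ (zeta t - w) * / (zeta t - w))) 0 (2 * PI))%C).
  { intros w Hw.
    apply is_C_derive_ext_loc with (r := R - Cmod (w - z0))
      (f := fun w => (c * C_int (fun t => h (zeta t) * dz t * / (zeta t - w)) 0 (2 * PI))%C); [ lra | | ].
    - intros v Hv. symmetry. apply Hcauchy.
      replace (v - z0)%C with ((v - w) + (w - z0))%C by ring.
      eapply Rle_lt_trans; [ apply Cmod_triangle | lra ].
    - apply is_C_derive_scal.
      destruct (cauchy_integral_derive (fun t => h (zeta t) * dz t)%C zeta w
        (R - Cmod (w - z0)) M 0 (2 * PI)) as [D _]; try lra; try assumption.
      apply Hin, Hw. }
  eexists.
  apply is_C_derive_ext_loc with (r := R)
    (f := fun w => (c * C_int (fun t => h (zeta t) * dz t * (/ (zeta t - w) * / (zeta t - w))) 0 (2 * PI))%C); [ exact HR | | ].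
  - intros w Hw. symmetry. apply is_C_derive_unique, HD, Hw.
  - apply is_C_derive_scal.
    destruct (cauchy_integral_derive (fun t => h (zeta t) * dz t)%C zeta z0
      (R - Cmod (z0 - z0)) M 0 (2 * PI)) as [_ D]; try lra; try assumption.
    + apply Hin, Hz00.
    + exact D.
Qed.

(** * Holomorphic functions on open sets and their real parts *)

Definition open_C (U : C -> Prop) : Prop :=
  forall z, U z -> exists r, 0 < r /\ forall w, Cmod (w - z) < r -> U w.

Definition holomorphic (U : C -> Prop) (h : C -> C) : Prop :=
  forall z, U z -> exists d, is_C_derive h z d.

Lemma holomorphic_derive (U : C -> Prop) (h : C -> C) (z : C) :
  holomorphic U h -> U z -> is_C_derive h z (C_derive h z).
Proof.
  intros H Hz. destruct (H z Hz) as [d Hd].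
  replace (C_derive h z) with d; [ exact Hd | ].
  symmetry. apply is_C_derive_unique, Hd.
Qed.

Lemma holomorphic_C_derive (U : C -> Prop) (h : C -> C) :
  open_C U -> holomorphic U h -> holomorphic U (C_derive h).
Proof.
  intros HU H z Hz. destruct (HU z Hz) as [r [Hr Hw]].
  apply C_derive_holomorphic with r; [ exact Hr | ].
  intros w Hwz. apply H, Hw, Hwz.
Qed.

Lemma open_disk : open_C in_disk.
Proof.
  intros z Hz. unfold in_disk in *. exists (1 - Cmod z). split; [ lra | ].
  intros w Hw. replace w with ((w - z) + z)%C by ring.
  eapply Rle_lt_trans; [ apply Cmod_triangle | lra ].
Qed.

Definition left_half_plane (z : C) : Prop := Re z < 0.

Lemma open_left_half_plane : open_C left_half_plane.
Proof.
  intros z Hz. unfold left_half_plane in *. exists (- Re z). split; [ lra | ].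
  intros w Hw.
  assert (H := Re_le_Cmod (w - z)).
  assert (E : Re (w - z)%C = Re w - Re z) by (unfold Re; simpl; ring).
  rewrite E in H. apply Rabs_le_between in H. lra.
Qed.

Lemma open_C_locally_2d (U : C -> Prop) (x y : R) :
  open_C U -> U (x, y) -> locally_2d (fun u v => U (u, v)) x y.
Proof.
  intros HU Hz. destruct (HU _ Hz) as [r [Hr Hw]].
  assert (Hr2 : 0 < r / 2) by lra.
  exists (mkposreal _ Hr2). simpl. intros u v Hu Hv. apply Hw.
  eapply Rle_lt_trans; [ apply Cmod_le_Rabs | ].
  unfold Re, Im; simpl. unfold Rminus in Hu, Hv. lra.
Qed.

Lemma is_C_derive_Re_partial (h : C -> C) (x y : R) (d : C) :
  is_C_derive h (x, y) d ->
  is_derive (fun u => Re (h (u, y))) x (Re d) /\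
  is_derive (fun v => Re (h (x, v))) y (- Im d) /\
  is_derive (fun u => Im (h (u, y))) x (Im d) /\
  is_derive (fun v => Im (h (x, v))) y (Re d).
Proof.
  intros H.
  assert (Px : is_path_derive (fun u => (u, y)) x 1).
  { split; [ exact (@is_derive_id R_AbsRing x) | exact (@is_derive_const R_AbsRing R_NormedModule y x) ]. }
  assert (Py : is_path_derive (fun v => (x, v)) y Ci).
  { split; [ exact (@is_derive_const R_AbsRing R_NormedModule x y) | exact (@is_derive_id R_AbsRing y) ]. }
  destruct (is_path_derive_comp h _ _ _ _ H Px) as [X1 X2].
  destruct (is_path_derive_comp h _ _ _ _ H Py) as [Y1 Y2].
  replace (d * 1)%C with d in X1, X2 by ring.
  replace (Re (d * Ci)) with (- Im d) in Y1 by (unfold Re, Im; simpl; ring).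
  replace (Im (d * Ci)) with (Re d) in Y2 by (unfold Re, Im; simpl; ring).
  exact (conj X1 (conj Y1 (conj X2 Y2))).
Qed.

Lemma is_C_derive_continuity_2d (h : C -> C) (x y : R) (d : C) :
  is_C_derive h (x, y) d ->
  continuity_2d_pt (fun u v => Re (h (u, v))) x y /\
  continuity_2d_pt (fun u v => Im (h (u, v))) x y.
Proof.
  intros H. destruct (is_C_derive_differentiable _ _ _ _ H) as [D1 D2].
  split; apply differentiable_continuity_pt; eexists; eexists; eassumption.
Qed.

Lemma holomorphic_scal (U : C -> Prop) (c : C) (h : C -> C) :
  holomorphic U h -> holomorphic U (fun z => c * h z)%C.
Proof.
  intros H z Hz. destruct (H z Hz) as [d Hd]. exists (c * d)%C. now apply is_C_derive_scal.
Qed.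

Lemma holomorphic_plus (U : C -> Prop) (f g : C -> C) :
  holomorphic U f -> holomorphic U g -> holomorphic U (fun z => f z + g z)%C.
Proof.
  intros Hf Hg z Hz. destruct (Hf z Hz) as [a Ha], (Hg z Hz) as [b Hb].
  exists (a + b)%C. now apply is_C_derive_plus.
Qed.

Lemma locally_2d_section_l (P : R -> R -> Prop) (x y : R) :
  locally_2d P x y -> locally x (fun u => P u y).
Proof.
  intros [d Hd]. exists d. intros u Hu. apply Hd; [ exact Hu | ].
  rewrite Rminus_diag, Rabs_R0. apply cond_pos.
Qed.

Lemma locally_2d_section_r (P : R -> R -> Prop) (x y : R) :
  locally_2d P x y -> locally y (fun v => P x v).
Proof.
  intros [d Hd]. exists d. intros v Hv. apply Hd; [ | exact Hv ].
  rewrite Rminus_diag, Rabs_R0. apply cond_pos.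
Qed.

(** Both partial derivatives of the real part of a holomorphic [F] are real
    parts of holomorphic functions, namely of [F'] and [i F']. *)
Lemma ex_diff_n_Re_holomorphic (U : C -> Prop) (n : nat) : open_C U ->
  forall F, holomorphic U F -> forall x y, U (x, y) ->
  ex_diff_n (fun u v => Re (F (u, v))) n x y.
Proof.
  intros HU. induction n as [|n IH]; intros F HF x y Hxy;
    assert (HD := holomorphic_derive U F _ HF Hxy).
  - split; [ | exact I ]. apply (is_C_derive_continuity_2d F x y _ HD).
  - destruct (is_C_derive_Re_partial F x y _ HD) as (X1 & Y1 & _).
    split; [ apply (is_C_derive_continuity_2d F x y _ HD) | ].
    split; [ eexists; exact X1 | ]. split; [ eexists; exact Y1 | ].
    assert (HF' := holomorphic_C_derive U F HU HF).
    destruct (open_C_locally_2d U x y HU Hxy) as [del Hdel].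
    split.
    + apply ex_diff_n_ext_loc with (2 := IH (C_derive F) HF' x y Hxy).
      exists del. intros u v Hu Hv. symmetry. apply is_derive_unique.
      exact (proj1 (is_C_derive_Re_partial F u v _ (holomorphic_derive U F _ HF (Hdel u v Hu Hv)))).
    + apply ex_diff_n_ext_loc with (2 := IH _ (holomorphic_scal U Ci _ HF') x y Hxy).
      exists del. intros u v Hu Hv. symmetry. apply is_derive_unique.
      replace (Re (Ci * C_derive F (u, v))) with (- Im (C_derive F (u, v)))
        by (unfold Re, Im; simpl; ring).
      exact (proj1 (proj2 (is_C_derive_Re_partial F u v _ (holomorphic_derive U F _ HF (Hdel u v Hu Hv))))).
Qed.

Lemma real_harmonic_Re (F : C -> C) (u : R -> R -> R) :
  holomorphic in_disk F -> (forall x y, in_disk (x, y) -> u x y = Re (F (x, y))) ->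
  real_harmonic u.
Proof.
  intros HF Hu x y Hxy.
  assert (HF' := holomorphic_C_derive _ F open_disk HF).
  destruct (open_C_locally_2d _ x y open_disk Hxy) as [del Hdel].
  assert (L : locally_2d (fun a b => Re (F (a, b)) = u a b) x y).
  { exists del. intros a b Ha Hb. symmetry. apply Hu, Hdel; assumption. }
  split.
  - apply ex_diff_n_ext_loc with (1 := L).
    apply (ex_diff_n_Re_holomorphic in_disk); [ exact open_disk | exact HF | exact Hxy ].
  - rewrite <- !(partial_derive_ext_loc _ _ _ _ _ _ L).
    unfold partial_derive; simpl.
    assert (L' : locally_2d (fun a b => in_disk (a, b)) x y) by (exists del; exact Hdel).
    assert (D2 := is_C_derive_Re_partial _ _ _ _ (holomorphic_derive _ _ _ HF' Hxy)).
    destruct D2 as (X1 & Y1 & X2 & Y2).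
    replace (Derive (fun t => Derive (fun z => Re (F (z, y))) t) x) with (Re (C_derive (C_derive F) (x, y))).
    + replace (Derive (fun z => Derive (fun z0 => Re (F (x, z0))) z) y)
        with (- Re (C_derive (C_derive F) (x, y))); [ ring | ].
      symmetry. apply is_derive_unique.
      apply is_derive_ext_loc with (fun v => - Im (C_derive F (x, v))).
      * generalize (locally_2d_section_r _ _ _ L'). apply filter_imp.
        intros v Hv. symmetry. apply is_derive_unique.
        exact (proj1 (proj2 (is_C_derive_Re_partial F x v _ (holomorphic_derive _ F _ HF Hv)))).
      * exact (is_derive_opp _ _ _ Y2).
    + symmetry. apply is_derive_unique.
      apply is_derive_ext_loc with (fun v => Re (C_derive F (v, y))).
      * generalize (locally_2d_section_l _ _ _ L'). apply filter_imp.
        intros v Hv. symmetry. apply is_derive_unique.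
        exact (proj1 (is_C_derive_Re_partial F v y _ (holomorphic_derive _ F _ HF Hv))).
      * exact X1.
Qed.

(** With [f = h + conj g], [Re f = Re (h + g)] and [Im f = Im (h - g)]. *)
Lemma canonical_decomposition_harmonic (f h g : C -> C) :
  canonical_decomposition f h g -> harmonic f.
Proof.
  intros (Hh & Hg & Hf & _).
  assert (Hh' : holomorphic in_disk h) by exact Hh.
  assert (Hg' : holomorphic in_disk g) by exact Hg.
  split.
  - apply real_harmonic_Re with (fun z => h z + g z)%C; [ now apply holomorphic_plus | ].
    intros x y Hxy. rewrite Hf by exact Hxy. unfold Re; simpl; ring.
  - apply real_harmonic_Re with (fun z => (- Ci) * h z + Ci * g z)%C;
      [ apply holomorphic_plus; now apply holomorphic_scal | ].
    intros x y Hxy. rewrite Hf by exact Hxy. unfold Re, Im; simpl; ring.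
Qed.

(** * Second derivative of circular means in logarithmic polar coordinates *)

(** [us], [ut], [uss], [utt] are the partial derivatives of [u], all continuous. They
    are kept as explicit functions so that the Laplacian of a composite
    expression can be read off from the lemmas below. *)
Definition C2_left (u us ut uss utt : R -> R -> R) : Prop :=
  forall s t, s < 0 ->
    (is_derive (fun x => u x t) s (us s t) /\ is_derive (fun y => u s y) t (ut s t) /\
     is_derive (fun x => us x t) s (uss s t) /\ is_derive (fun y => ut s y) t (utt s t)) /\
    (continuity_2d_pt u s t /\ continuity_2d_pt us s t /\ continuity_2d_pt ut s t /\
     continuity_2d_pt uss s t /\ continuity_2d_pt utt s t).

Lemma C2_left_holomorphic (A : C -> C) : holomorphic left_half_plane A ->
  C2_left (fun s t => Re (A (s, t))) (fun s t => Re (C_derive A (s, t)))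
    (fun s t => - Im (C_derive A (s, t))) (fun s t => Re (C_derive (C_derive A) (s, t)))
    (fun s t => - Re (C_derive (C_derive A) (s, t))) /\
  C2_left (fun s t => Im (A (s, t))) (fun s t => Im (C_derive A (s, t)))
    (fun s t => Re (C_derive A (s, t))) (fun s t => Im (C_derive (C_derive A) (s, t)))
    (fun s t => - Im (C_derive (C_derive A) (s, t))).
Proof.
  intros HA.
  assert (HA' := holomorphic_C_derive _ _ open_left_half_plane HA).
  assert (HA'' := holomorphic_C_derive _ _ open_left_half_plane HA').
  assert (K : forall s t, s < 0 -> left_half_plane (s, t)) by (intros; assumption).
  split; intros s t Hs;
    assert (D0 := holomorphic_derive _ _ _ HA (K s t Hs));
    assert (D1 := holomorphic_derive _ _ _ HA' (K s t Hs));
    assert (D2 := holomorphic_derive _ _ _ HA'' (K s t Hs));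
    destruct (is_C_derive_continuity_2d _ _ _ _ D0) as [C1 C2];
    destruct (is_C_derive_continuity_2d _ _ _ _ D1) as [C3 C4];
    destruct (is_C_derive_continuity_2d _ _ _ _ D2) as [C5 C6];
    destruct (is_C_derive_Re_partial _ _ _ _ D0) as (X1 & X2 & X3 & X4);
    destruct (is_C_derive_Re_partial _ _ _ _ D1) as (Y1 & Y2 & Y3 & Y4).
  - split.
    + split; [ exact X1 | ]. split; [ exact X2 | ]. split; [ exact Y1 | ].
      exact (is_derive_opp _ _ _ Y4).
    + split; [ exact C1 | ]. split; [ exact C3 | ]. split; [ apply continuity_2d_pt_opp, C4 | ].
      split; [ exact C5 | apply continuity_2d_pt_opp, C5 ].
  - split.
    + split; [ exact X3 | ]. split; [ exact X4 | ]. split; [ exact Y3 | exact Y2 ].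
    + split; [ exact C2 | ]. split; [ exact C4 | ]. split; [ exact C3 | ].
      split; [ exact C6 | apply continuity_2d_pt_opp, C6 ].
Qed.

Lemma C2_left_plus (u us ut uss utt v vs vt vss vtt : R -> R -> R) :
  C2_left u us ut uss utt -> C2_left v vs vt vss vtt ->
  C2_left (fun s t => u s t + v s t) (fun s t => us s t + vs s t) (fun s t => ut s t + vt s t)
    (fun s t => uss s t + vss s t) (fun s t => utt s t + vtt s t).
Proof.
  intros Hu Hv s t Hs.
  destruct (Hu s t Hs) as [(U1 & U2 & U3 & U4) (U5 & U6 & U7 & U8 & U9)].
  destruct (Hv s t Hs) as [(V1 & V2 & V3 & V4) (V5 & V6 & V7 & V8 & V9)].
  split.
  - split; [ exact (is_derive_plus _ _ _ _ _ U1 V1) | ].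
    split; [ exact (is_derive_plus _ _ _ _ _ U2 V2) | ].
    split; [ exact (is_derive_plus _ _ _ _ _ U3 V3) | exact (is_derive_plus _ _ _ _ _ U4 V4) ].
  - repeat (split; [ apply continuity_2d_pt_plus; assumption | ]).
    apply continuity_2d_pt_plus; assumption.
Qed.

Lemma continuity_2d_pt_comp1 (f : R -> R) (u : R -> R -> R) (s t : R) :
  continuous f (u s t) -> continuity_2d_pt u s t -> continuity_2d_pt (fun x y => f (u x y)) s t.
Proof.
  intros Hf Hu. apply continuity_1d_2d_pt_comp; [ | exact Hu ].
  apply continuity_pt_filterlim. exact Hf.
Qed.

Lemma C2_left_comp (phi dphi ddphi : R -> R) (u us ut uss utt : R -> R -> R) :
  (forall s t, s < 0 -> is_derive phi (u s t) (dphi (u s t)) /\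
     is_derive dphi (u s t) (ddphi (u s t)) /\ continuous ddphi (u s t)) ->
  C2_left u us ut uss utt ->
  C2_left (fun s t => phi (u s t)) (fun s t => us s t * dphi (u s t)) (fun s t => ut s t * dphi (u s t))
    (fun s t => uss s t * dphi (u s t) + us s t * (us s t * ddphi (u s t)))
    (fun s t => utt s t * dphi (u s t) + ut s t * (ut s t * ddphi (u s t))).
Proof.
  intros Hphi Hu s t Hs.
  destruct (Hu s t Hs) as [(U1 & U2 & U3 & U4) (U5 & U6 & U7 & U8 & U9)].
  destruct (Hphi s t Hs) as (P1 & P2 & P3).
  assert (Cphi : continuous phi (u s t))
    by (apply (@ex_derive_continuous R_AbsRing R_NormedModule); eexists; exact P1).
  assert (Cdphi : continuous dphi (u s t))
    by (apply (@ex_derive_continuous R_AbsRing R_NormedModule); eexists; exact P2).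
  assert (M : forall (a b : R -> R) x da db, is_derive a x da -> is_derive b x db ->
    is_derive (fun z => a z * b z) x (da * b x + a x * db))
    by (intros a b x da db Ha Hb; exact (is_derive_mult a b x da db Ha Hb Rmult_comm)).
  split.
  - split; [ exact (is_derive_comp phi (fun x => u x t) s _ _ P1 U1) | ].
    split; [ exact (is_derive_comp phi (fun y => u s y) t _ _ P1 U2) | ].
    split.
    + exact (M _ _ _ _ _ U3 (is_derive_comp dphi (fun x => u x t) s _ _ P2 U1)).
    + exact (M _ _ _ _ _ U4 (is_derive_comp dphi (fun y => u s y) t _ _ P2 U2)).
  - split; [ apply continuity_2d_pt_comp1; assumption | ].
    split; [ apply continuity_2d_pt_mult; [ assumption | apply continuity_2d_pt_comp1; assumption ] | ].
    split; [ apply continuity_2d_pt_mult; [ assumption | apply continuity_2d_pt_comp1; assumption ] | ].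
    split; (apply continuity_2d_pt_plus;
      [ apply continuity_2d_pt_mult; [ assumption | apply continuity_2d_pt_comp1; assumption ]
      | apply continuity_2d_pt_mult; [ assumption | apply continuity_2d_pt_mult;
          [ assumption | apply continuity_2d_pt_comp1; assumption ] ] ]).
Qed.

Lemma C2_left_fst (f df ddf : R -> R) :
  (forall s, s < 0 -> is_derive f s (df s) /\ is_derive df s (ddf s) /\ continuous ddf s) ->
  C2_left (fun s _ => f s) (fun s _ => df s) (fun _ _ => 0) (fun s _ => ddf s) (fun _ _ => 0).
Proof.
  intros H s t Hs. destruct (H s Hs) as (H1 & H2 & H3).
  assert (Cf : continuous f s)
    by (apply (@ex_derive_continuous R_AbsRing R_NormedModule); eexists; exact H1).
  assert (Cdf : continuous df s)
    by (apply (@ex_derive_continuous R_AbsRing R_NormedModule); eexists; exact H2).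
  split.
  - split; [ exact H1 | ]. split; [ exact (@is_derive_const R_AbsRing R_NormedModule (f s) t) | ].
    split; [ exact H2 | exact (@is_derive_const R_AbsRing R_NormedModule 0 t) ].
  - split; [ apply (continuity_2d_pt_comp1 f (fun x _ => x)); [ assumption | apply continuity_2d_pt_id1 ] | ].
    split; [ apply (continuity_2d_pt_comp1 df (fun x _ => x)); [ assumption | apply continuity_2d_pt_id1 ] | ].
    split; [ apply continuity_2d_pt_const | ].
    split; [ apply (continuity_2d_pt_comp1 ddf (fun x _ => x)); [ assumption | apply continuity_2d_pt_id1 ] | ].
    apply continuity_2d_pt_const.
Qed.

Lemma locally_negative (s : R) : s < 0 -> locally s (fun x => x < 0).
Proof.
  intros Hs. assert (H : 0 < - s) by lra. exists (mkposreal _ H). intros y Hy.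
  unfold ball in Hy; simpl in Hy; unfold AbsRing_ball, abs, minus, plus, opp in Hy; simpl in Hy.
  apply Rabs_def2 in Hy. lra.
Qed.

Lemma is_derive_RInt_left (u us : R -> R -> R) (a b s : R) : s < 0 ->
  (forall s t, s < 0 -> is_derive (fun x => u x t) s (us s t)) ->
  (forall s t, s < 0 -> continuity_2d_pt u s t) ->
  (forall s t, s < 0 -> continuity_2d_pt us s t) ->
  is_derive (fun x => RInt (fun t => u x t) a b) s (RInt (fun t => us s t) a b).
Proof.
  intros Hs Hd Hc Hcs.
  assert (L := locally_negative s Hs).
  replace (RInt (fun t => us s t) a b) with (RInt (fun t => Derive (fun x => u x t) s) a b)
    by (apply RInt_ext; intros t _; apply is_derive_unique, Hd, Hs).
  apply is_derive_RInt_param.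
  - revert L. apply filter_imp. intros x Hx t _. eexists. apply Hd, Hx.
  - intros t _. apply continuity_2d_pt_ext_loc with us; [ | apply Hcs, Hs ].
    destruct L as [d L]. exists d. intros x y Hx _. symmetry.
    apply is_derive_unique, Hd, L, Hx.
  - revert L. apply filter_imp. intros x Hx.
    apply (@ex_RInt_continuous R_CompleteNormedModule). intros t _.
    apply (continuity_2d_pt_section_r u), Hc, Hx.
Qed.

(** In the coordinates [z = e^(s + i t)] the part [utt] of the Laplacian has
    integral zero by periodicity, so it may be added freely to [uss]. *)
Lemma circular_mean_derive2 (u us ut uss utt : R -> R -> R) (s : R) :
  C2_left u us ut uss utt -> (forall s, s < 0 -> ut s (2 * PI) = ut s 0) -> s < 0 ->
  is_derive (fun x => RInt (fun t => u x t) 0 (2 * PI)) s (RInt (fun t => us s t) 0 (2 * PI)) /\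
  is_derive (fun x => RInt (fun t => us x t) 0 (2 * PI)) s
    (RInt (fun t => uss s t + utt s t) 0 (2 * PI)).
Proof.
  intros H Hper Hs. split.
  - apply is_derive_RInt_left; [ exact Hs | .. ]; intros x t Hx; apply (H x t Hx).
  - assert (E : forall f : R -> R -> R, (forall s t, s < 0 -> continuity_2d_pt f s t) ->
      ex_RInt (fun t => f s t) 0 (2 * PI)).
    { intros f Hf. apply (@ex_RInt_continuous R_CompleteNormedModule). intros t _.
      apply (continuity_2d_pt_section_r f), Hf, Hs. }
    assert (Htt : is_RInt (fun t => utt s t) 0 (2 * PI) (minus (ut s (2 * PI)) (ut s 0))).
    { apply (is_RInt_derive (fun t => ut s t)); intros t _.
      - apply (H s t Hs).
      - apply (continuity_2d_pt_section_r utt), (H s t Hs). }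
    assert (Ett : RInt (fun t => utt s t) 0 (2 * PI) = 0).
    { rewrite (is_RInt_unique _ _ _ _ Htt), Hper by exact Hs.
      unfold minus, plus, opp; simpl; ring. }
    replace (RInt (fun t => uss s t + utt s t) 0 (2 * PI)) with (RInt (fun t => uss s t) 0 (2 * PI)).
    + apply is_derive_RInt_left; [ exact Hs | .. ]; intros x t Hx; apply (H x t Hx).
    + transitivity (plus (RInt (fun t => uss s t) 0 (2 * PI)) (RInt (fun t => utt s t) 0 (2 * PI))).
      2: { symmetry. apply (RInt_plus (V := R_CompleteNormedModule) (fun t => uss s t) (fun t => utt s t));
             apply E; intros; apply H; assumption. }
      rewrite Ett. symmetry. apply Rplus_0_r.
Qed.

Lemma derive_nonneg_le (f df : R -> R) (a b : R) : a <= b ->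
  (forall x, a <= x <= b -> is_derive f x (df x)) ->
  (forall x, a <= x <= b -> 0 <= df x) -> f a <= f b.
Proof.
  intros Hab Hd Hp.
  destruct (MVT_gen f a b df) as [c [Hc E]].
  - intros x. rewrite Rmin_left, Rmax_right by exact Hab. intros Hx. apply Hd; lra.
  - intros x. rewrite Rmin_left, Rmax_right by exact Hab. intros Hx.
    apply continuity_pt_filterlim, (@ex_derive_continuous R_AbsRing R_NormedModule).
    eexists; apply Hd, Hx.
  - rewrite Rmin_left, Rmax_right in Hc by exact Hab.
    assert (H := Hp c Hc). nra.
Qed.

Lemma concave_below_tangent (m dm ddm : R -> R) (a x b : R) : a <= x <= b ->
  (forall s, a <= s <= b -> is_derive m s (dm s)) ->
  (forall s, a <= s <= b -> is_derive dm s (ddm s)) ->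
  (forall s, a <= s <= b -> ddm s <= 0) ->
  m a <= m x + dm x * (a - x) /\ m b <= m x + dm x * (b - x).
Proof.
  intros Hx Hm Hdm Hdd.
  assert (Anti : forall p q, a <= p -> p <= q -> q <= b -> dm q <= dm p).
  { intros p q Hp Hpq Hq.
    assert (H := derive_nonneg_le (fun s => - dm s) (fun s => - ddm s) p q Hpq).
    enough (- dm p <= - dm q) by lra. apply H.
    - intros s Hs. exact (is_derive_opp _ _ _ (Hdm s ltac:(lra))).
    - intros s Hs. assert (D := Hdd s ltac:(lra)). lra. }
  assert (Lin : forall s c, is_derive (fun s => c * s) s c).
  { intros s c. auto_derive; [ exact I | ring ]. }
  split.
  - assert (H := derive_nonneg_le (fun s => m s - dm x * s) (fun s => dm s - dm x) a x).
    enough (m a - dm x * a <= m x - dm x * x) by lra. apply H; [ lra | | ].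
    + intros s Hs. exact (is_derive_minus _ _ _ _ _ (Hm s ltac:(lra)) (Lin s (dm x))).
    + intros s Hs. assert (D := Anti s x ltac:(lra) ltac:(lra) ltac:(lra)). lra.
  - assert (H := derive_nonneg_le (fun s => dm x * s - m s) (fun s => dm x - dm s) x b).
    enough (dm x * x - m x <= dm x * b - m b) by lra. apply H; [ lra | | ].
    + intros s Hs. exact (is_derive_minus _ _ _ _ _ (Lin s (dm x)) (Hm s ltac:(lra))).
    + intros s Hs. assert (D := Anti x s ltac:(lra) ltac:(lra) ltac:(lra)). lra.
Qed.

(** A tangent line of positive slope would push a concave function below zero
    near minus infinity; hence the slope is never positive and the values near
    minus infinity are the largest. *)
Lemma concave_half_line_le (m dm ddm : R -> R) (B s0 : R) :
  (forall s, s < 0 -> is_derive m s (dm s)) ->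
  (forall s, s < 0 -> is_derive dm s (ddm s)) ->
  (forall s, s < 0 -> ddm s <= 0) ->
  (forall s, s < 0 -> 0 <= m s) ->
  (forall s, s <= s0 -> m s <= B) ->
  forall s, s < 0 -> m s <= B.
Proof.
  intros Hm Hdm Hdd Hlow HB s Hs.
  destruct (Rle_lt_dec (m s) B) as [H | H]; [ exact H | exfalso ].
  assert (Hpos : forall a, a <= s -> dm a <= 0).
  { intros a Ha. destruct (Rle_lt_dec (dm a) 0) as [D | D]; [ exact D | exfalso ].
    set (b := a - (m a + 1) / dm a).
    assert (Hma := Hlow a ltac:(lra)).
    assert (Hb : b <= a).
    { unfold b. assert (0 < (m a + 1) / dm a) by (apply Rdiv_lt_0_compat; lra). lra. }
    destruct (concave_below_tangent m dm ddm b a a) as [T _]; [ lra | .. ];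
      try (intros z Hz; (apply Hm || apply Hdm || apply Hdd); lra).
    assert (Hmb := Hlow b ltac:(lra)).
    unfold b in T at 2. replace (dm a * (a - (m a + 1) / dm a - a)) with (- (m a + 1)) in T by (field; lra).
    lra. }
  set (a := Rmin s s0).
  assert (Ha1 : a <= s) by apply Rmin_l. assert (Ha2 : a <= s0) by apply Rmin_r.
  assert (E := derive_nonneg_le (fun x => - m x) (fun x => - dm x) a s Ha1).
  enough (- m a <= - m s) by (assert (K := HB a Ha2); lra).
  apply E.
  - intros x Hx. exact (is_derive_opp _ _ _ (Hm x ltac:(lra))).
  - intros x Hx. assert (D := Hpos x ltac:(lra)). lra.
Qed.

(** * Growth of functions with bounded pre-Schwarzian norm *)

Lemma Re_Cconj_mult (a b : C) : Re (Cconj a * b)%C = Re a * Re b + Im a * Im b.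
Proof. unfold Re, Im; simpl; ring. Qed.

Lemma Cmod_Cconj (a : C) : Cmod (Cconj a) = Cmod a.
Proof. unfold Cmod, Cconj; simpl. f_equal; ring. Qed.

Lemma Cmod2_conj (z : C) : (RtoC (Cmod z ^ 2) = z * Cconj z)%C.
Proof.
  rewrite Cmod_sqr. apply injective_projections; unfold Re, Im; simpl; ring.
Qed.

Lemma Cconj_plus (a b : C) : Cconj (a + b) = (Cconj a + Cconj b)%C.
Proof. apply injective_projections; simpl; ring. Qed.

Lemma Cconj_mult (a b : C) : Cconj (a * b) = (Cconj a * Cconj b)%C.
Proof. apply injective_projections; simpl; ring. Qed.

Lemma Cconj_inv (a : C) : a <> 0 -> Cconj (/ a) = (/ Cconj a)%C.
Proof.
  intros Ha.
  assert (Hc : Cconj a <> 0) by (apply Cmod_gt_0; rewrite Cmod_Cconj; apply Cmod_gt_0, Ha).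
  assert (E : (Cconj (/ a) * Cconj a)%C = 1).
  { rewrite <- Cconj_mult, Cinv_l by exact Ha. apply injective_projections; simpl; ring. }
  replace (Cconj (/ a)) with (Cconj (/ a) * Cconj a * / Cconj a)%C by (field; exact Hc).
  rewrite E. ring.
Qed.

Lemma Cconj_conj (a : C) : Cconj (Cconj a) = a.
Proof. apply injective_projections; simpl; ring. Qed.

Lemma Re_mult_le (a b : C) : Re a * Re b + Im a * Im b <= Cmod a * Cmod b.
Proof.
  rewrite <- Re_Cconj_mult, <- (Cmod_Cconj a), <- Cmod_mult.
  eapply Rle_trans; [ apply Rle_abs | apply Re_le_Cmod ].
Qed.

Lemma is_path_derive_Cmod2 (g : R -> C) (t : R) (v : C) : is_path_derive g t v ->
  is_derive (fun s => Cmod (g s) ^ 2) t (2 * (Re (g t) * Re v + Im (g t) * Im v)).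
Proof.
  intros [H1 H2].
  apply (is_derive_ext (fun s => Re (g s) * Re (g s) + Im (g s) * Im (g s))).
  - intros s. rewrite Cmod_sqr. simpl. ring.
  - replace (2 * (Re (g t) * Re v + Im (g t) * Im v))
      with ((Re v * Re (g t) + Re (g t) * Re v) + (Im v * Im (g t) + Im (g t) * Im v)) by ring.
    exact (is_derive_plus _ _ _ _ _ (is_derive_mult _ _ _ _ _ H1 H1 Rmult_comm)
      (is_derive_mult _ _ _ _ _ H2 H2 Rmult_comm)).
Qed.

(** [|g|^2 e^(- 2 L)] is nonincreasing; unlike [ln |g|], it makes sense at the zeros
    of [g]. *)
Lemma gronwall_Cmod (g v : R -> C) (L dL : R -> R) (a b : R) : a <= b ->
  (forall t, a <= t <= b -> is_path_derive g t (v t)) ->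
  (forall t, a <= t <= b -> is_derive L t (dL t)) ->
  (forall t, a <= t <= b -> Cmod (v t) <= dL t * Cmod (g t)) ->
  Cmod (g b) <= Cmod (g a) * exp (L b - L a).
Proof.
  intros Hab Hg HL Hv.
  assert (Hd : forall t, a <= t <= b -> is_derive (fun s => - (Cmod (g s) ^ 2 * exp (- 2 * L s))) t
    (- (2 * (Re (g t) * Re (v t) + Im (g t) * Im (v t)) * exp (- 2 * L t) +
        Cmod (g t) ^ 2 * (exp (- 2 * L t) * (- 2 * dL t))))).
  { intros t Ht.
    assert (E : is_derive (fun s => exp (- 2 * L s)) t (exp (- 2 * L t) * (- 2 * dL t))).
    { rewrite Rmult_comm.
      exact (is_derive_comp exp (fun s => - 2 * L s) t _ _ (is_derive_exp _)
        (is_derive_scal L t (- 2) _ (HL t Ht))). }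
    exact (is_derive_opp _ _ _ (is_derive_mult _ _ _ _ _ (is_path_derive_Cmod2 g t (v t) (Hg t Ht)) E Rmult_comm)). }
  assert (H := derive_nonneg_le _ _ a b Hab Hd).
  assert (Hmono : Cmod (g b) ^ 2 * exp (- 2 * L b) <= Cmod (g a) ^ 2 * exp (- 2 * L a)).
  { enough (- (Cmod (g a) ^ 2 * exp (-2 * L a)) <= - (Cmod (g b) ^ 2 * exp (-2 * L b))) by lra.
    apply H. intros t Ht.
    assert (Hx := Re_mult_le (g t) (v t)). assert (Hvt := Hv t Ht).
    assert (H0 := Cmod_ge_0 (g t)). assert (He := exp_pos (- 2 * L t)).
    replace (- (2 * (Re (g t) * Re (v t) + Im (g t) * Im (v t)) * exp (- 2 * L t) +
        Cmod (g t) ^ 2 * (exp (- 2 * L t) * (- 2 * dL t))))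
      with (2 * exp (- 2 * L t) * (dL t * Cmod (g t) * Cmod (g t) -
        (Re (g t) * Re (v t) + Im (g t) * Im (v t)))) by ring.
    apply Rmult_le_pos; [ lra | ].
    assert (Cmod (g t) * Cmod (v t) <= dL t * Cmod (g t) * Cmod (g t)).
    { rewrite (Rmult_comm (dL t * Cmod (g t))). apply Rmult_le_compat_l; assumption. }
    lra. }
  assert (Ha0 := Cmod_ge_0 (g a)). assert (Hb0 := Cmod_ge_0 (g b)).
  assert (He := exp_pos (L b - L a)).
  apply Rsqr_incr_0; [ | exact Hb0 | apply Rmult_le_pos; lra ].
  rewrite !Rsqr_pow2.
  replace (Cmod (g b) ^ 2) with (Cmod (g b) ^ 2 * exp (- 2 * L b) * exp (2 * L b)).
  2: { rewrite Rmult_assoc, <- exp_plus. replace (-2 * L b + 2 * L b) with 0 by ring. rewrite exp_0; ring. }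
  replace ((Cmod (g a) * exp (L b - L a)) ^ 2) with (Cmod (g a) ^ 2 * exp (- 2 * L a) * exp (2 * L b)).
  2: { rewrite Rmult_assoc, <- exp_plus, Rpow_mult_distr. f_equal.
       rewrite <- Rsqr_pow2. unfold Rsqr. rewrite <- exp_plus. f_equal; ring. }
  apply Rmult_le_compat_r; [ left; apply exp_pos | exact Hmono ].
Qed.

(** The real mean value inequality for the projection of [g] on the direction
    [w = g b - g a]. *)
Lemma mean_value_Cmod (g v : R -> C) (B dB : R -> R) (a b : R) : a <= b ->
  (forall t, a <= t <= b -> is_path_derive g t (v t)) ->
  (forall t, a <= t <= b -> is_derive B t (dB t)) ->
  (forall t, a <= t <= b -> Cmod (v t) <= dB t) ->
  Cmod (g b - g a) <= B b - B a.
Proof.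
  intros Hab Hg HB Hv.
  set (w := (g b - g a)%C).
  assert (H := derive_nonneg_le
    (fun t => Cmod w * B t - (Re w * Re (g t) + Im w * Im (g t)))
    (fun t => Cmod w * dB t - (Re w * Re (v t) + Im w * Im (v t))) a b Hab).
  assert (H0 := Cmod_ge_0 w).
  assert (Hm : Cmod w * B a - (Re w * Re (g a) + Im w * Im (g a)) <=
               Cmod w * B b - (Re w * Re (g b) + Im w * Im (g b))).
  { apply H.
    - intros t Ht. destruct (Hg t Ht) as [G1 G2].
      assert (S : forall k (f : R -> R) d, is_derive f t d -> is_derive (fun s => k * f s) t (k * d))
        by (intros; apply is_derive_scal; assumption).
      exact (is_derive_minus _ _ _ _ _ (S _ _ _ (HB t Ht))
        (is_derive_plus _ _ _ _ _ (S _ _ _ G1) (S _ _ _ G2))).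
    - intros t Ht. assert (K := Re_mult_le w (v t)).
      assert (Cmod w * Cmod (v t) <= Cmod w * dB t) by (apply Rmult_le_compat_l; [ exact H0 | apply Hv, Ht ]).
      lra. }
  assert (E : Re w * (Re (g b) - Re (g a)) + Im w * (Im (g b) - Im (g a)) = Cmod w ^ 2).
  { rewrite Cmod_sqr. unfold w, Re, Im; simpl; ring. }
  destruct (Req_dec (Cmod w) 0) as [Z | Z].
  - rewrite Z. assert (HBm := derive_nonneg_le B dB a b Hab HB).
    enough (B a <= B b) by lra. apply HBm. intros t Ht.
    eapply Rle_trans; [ apply Cmod_ge_0 | apply Hv, Ht ].
  - nra.
Qed.

(** The pre-Schwarzian norm of [F] is at most [2 lambda], multiplied out. *)
Definition pre_Schwarzian_le (lambda : R) (F : C -> C) : Prop :=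
  holomorphic in_disk F /\
  forall z, in_disk z -> C_derive F z <> 0 /\
    (1 - Cmod z ^ 2) * Cmod (C_derive (C_derive F) z) <= 2 * lambda * Cmod (C_derive F z).

Lemma C_derive_combination (h g : C -> C) (c : C) :
  analytic h -> analytic g ->
  holomorphic in_disk (fun z => h z + c * g z)%C /\
  forall z, in_disk z ->
    C_derive (fun z => h z + c * g z)%C z = (C_derive h z + c * C_derive g z)%C /\
    C_derive (C_derive (fun z => h z + c * g z)%C) z =
      (C_derive (C_derive h) z + c * C_derive (C_derive g) z)%C.
Proof.
  intros Hh Hg.
  assert (Hh1 : holomorphic in_disk h) by exact Hh.
  assert (Hg1 : holomorphic in_disk g) by exact Hg.
  assert (Hh2 := holomorphic_C_derive _ _ open_disk Hh1).
  assert (Hg2 := holomorphic_C_derive _ _ open_disk Hg1).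
  assert (D : forall z, in_disk z ->
    C_derive (fun z => h z + c * g z)%C z = (C_derive h z + c * C_derive g z)%C).
  { intros z Hz. apply is_C_derive_unique.
    apply is_C_derive_plus; [ | apply is_C_derive_scal ]; apply (holomorphic_derive in_disk); assumption. }
  split; [ apply holomorphic_plus; [ exact Hh1 | apply holomorphic_scal, Hg1 ] | ].
  intros z Hz. split; [ exact (D z Hz) | ].
  apply is_C_derive_unique.
  destruct (open_disk z Hz) as [r [Hr Hw]].
  apply is_C_derive_ext_loc with (r := r) (f := fun z => (C_derive h z + c * C_derive g z)%C);
    [ exact Hr | intros w Hwz; symmetry; apply D, Hw, Hwz | ].
  apply is_C_derive_plus; [ | apply is_C_derive_scal ]; apply (holomorphic_derive in_disk); assumption.
Qed.

(** A finite norm excludes the value assigned to the zeros of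
    [h' + e^(it) g']. *)
Lemma class_B_pre_Schwarzian (lambda : R) (f : C -> C) : class_B lambda f ->
  exists h g, canonical_decomposition f h g /\
    forall t, 0 <= t <= 2 * PI -> pre_Schwarzian_le lambda (fun z => h z + cis t * g z)%C.
Proof.
  intros (h & g & Hd & Hn). exists h, g. split; [ exact Hd | ].
  intros t Ht. destruct Hd as (Hh & Hg & _).
  destruct (C_derive_combination h g (cis t) Hh Hg) as [Hhol HD].
  split; [ exact Hhol | ]. intros z Hz. destruct (HD z Hz) as [-> ->].
  assert (Hb : Rbar_le (preSchwarzian_term h g z t) (2 * lambda)).
  { eapply Rbar_le_trans; [ | exact Hn ].
    unfold preSchwarzian_norm, Rbar_lub.
    apply (proj1 (proj2_sig (Rbar_ex_lub _))). exists z, t. split; [ exact Hz | ]. split; [ exact Ht | reflexivity ]. }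
  unfold preSchwarzian_term in Hb.
  destruct Ceq_dec as [E | E]; [ destruct Hb | ].
  split; [ exact E | ]. simpl Rbar_le in Hb.
  rewrite Cmod_div in Hb by exact E.
  apply Cmod_gt_0 in E.
  set (a := Cmod (C_derive h z + cis t * C_derive g z)) in *.
  set (b := Cmod (C_derive (C_derive h) z + cis t * C_derive (C_derive g) z)) in *.
  replace ((1 - Cmod z ^ 2) * b) with ((1 - Cmod z ^ 2) * (b / a) * a) by (field; lra).
  apply Rmult_le_compat_r; [ lra | exact Hb ].
Qed.

Lemma in_disk_scal (z : C) (t : R) : in_disk z -> 0 <= t <= 1 -> in_disk (t * z)%C.
Proof.
  unfold in_disk. intros Hz Ht. rewrite Cmod_mult, Cmod_R, Rabs_pos_eq by lra.
  assert (H := Cmod_ge_0 z). nra.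
Qed.

Lemma is_path_derive_ray (z : C) (t : R) : is_path_derive (fun s => s * z)%C t z.
Proof.
  assert (H := is_path_derive_mult (fun s => RtoC s) (fun _ => z) t 1 0
    (is_path_derive_real (fun s => s) t 1 (@is_derive_id R_AbsRing t)) (is_path_derive_const z t)).
  cbv beta in H. replace (1 * z + t * 0)%C with z in H by ring. exact H.
Qed.

(** Gronwall's inequality along the radius, where [2 lambda / (1 - x^2)] is the
    derivative of [lambda ln ((1 + x) / (1 - x))]. *)
Lemma pre_Schwarzian_growth (lambda : R) (F : C -> C) (z : C) : 0 < lambda ->
  pre_Schwarzian_le lambda F -> in_disk z ->
  Cmod (C_derive F z) <= Cmod (C_derive F 0) * Rpower ((1 + Cmod z) / (1 - Cmod z)) lambda.
Proof.
  intros Hl [HF HS] Hz.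
  assert (HF' := holomorphic_C_derive _ _ open_disk HF).
  set (r := Cmod z). assert (Hr0 : 0 <= r) by apply Cmod_ge_0. assert (Hr1 : r < 1) by exact Hz.
  assert (Hpos : forall t, 0 <= t <= 1 -> 0 <= t * r < 1) by (intros; nra).
  assert (G := gronwall_Cmod (fun t : R => C_derive F (t * z)%C)
    (fun t : R => C_derive (C_derive F) (t * z) * z)%C
    (fun t => lambda * (ln (1 + t * r) - ln (1 - t * r)))
    (fun t => lambda * (2 * r / (1 - (t * r) ^ 2))) 0 1 ltac:(lra)).
  assert (E1 : (1 * z)%C = z) by ring. assert (E0 : (0 * z)%C = 0) by ring.
  cbv beta in G. rewrite E1, E0 in G.
  eapply Rle_trans; [ apply G | ].
  - intros t Ht. apply (is_path_derive_comp (C_derive F) (fun t : R => t * z)%C).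
    + apply (holomorphic_derive in_disk); [ exact HF' | now apply in_disk_scal ].
    + apply is_path_derive_ray.
  - intros t Ht. assert (Hp := Hpos t Ht).
    auto_derive; [ repeat split; lra | field; repeat split; nra ].
  - intros t Ht. assert (Hp := Hpos t Ht).
    destruct (HS (t * z)%C (in_disk_scal z t Hz Ht)) as [_ B].
    rewrite Cmod_mult, Cmod_R, (Rabs_pos_eq t) in B by lra. fold r in B.
    rewrite Cmod_mult. fold r.
    assert (Hq : 0 < 1 - (t * r) ^ 2) by nra.
    apply Rmult_le_reg_l with (1 - (t * r) ^ 2); [ exact Hq | ].
    replace ((1 - (t * r) ^ 2) * (lambda * (2 * r / (1 - (t * r) ^ 2)) * Cmod (C_derive F (t * z))))
      with (r * (2 * lambda * Cmod (C_derive F (t * z)))) by (field; lra).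
    rewrite (Rmult_comm (Cmod (C_derive (C_derive F) (t * z)))), <- Rmult_assoc, (Rmult_comm _ r), Rmult_assoc.
    apply Rmult_le_compat_l; [ exact Hr0 | exact B ].
  - right. f_equal. unfold Rpower. f_equal.
    replace (1 + 0 * r) with 1 by ring. replace (1 - 0 * r) with 1 by ring.
    rewrite !Rmult_1_l, ln_1. unfold Rdiv. rewrite ln_mult, ln_Rinv; try lra.
    apply Rinv_0_lt_compat; lra.
Qed.

Lemma radial_growth (lambda K : R) (F : C -> C) (z : C) : lambda <> 1 ->
  holomorphic in_disk F -> F 0 = 0 ->
  (forall z, in_disk z -> Cmod (C_derive F z) <= K * Rpower (1 - Cmod z) (- lambda)) ->
  in_disk z ->
  Cmod (F z) <= K * ((Rpower (1 - Cmod z) (1 - lambda) - 1) / (lambda - 1)).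
Proof.
  intros Hl HF F0 HK Hz.
  set (r := Cmod z). assert (Hr0 : 0 <= r) by apply Cmod_ge_0. assert (Hr1 : r < 1) by exact Hz.
  assert (Hpos : forall t, 0 <= t <= 1 -> 0 <= t * r < 1) by (intros; nra).
  assert (G := mean_value_Cmod (fun t : R => F (t * z)%C) (fun t : R => C_derive F (t * z) * z)%C
    (fun t => K * (Rpower (1 - t * r) (1 - lambda) / (lambda - 1)))
    (fun t => K * (r * Rpower (1 - t * r) (- lambda))) 0 1 ltac:(lra)).
  assert (E1 : (1 * z)%C = z) by ring. assert (E0 : (0 * z)%C = 0) by ring.
  cbv beta in G. rewrite E1, E0, F0 in G.
  replace (F z - 0)%C with (F z) in G by ring.
  replace (1 * r) with r in G by ring. replace (1 - 0 * r) with 1 in G by ring.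
  replace (Rpower 1 (1 - lambda)) with 1 in G by (unfold Rpower; rewrite ln_1, Rmult_0_r, exp_0; reflexivity).
  replace (K * ((Rpower (1 - r) (1 - lambda) - 1) / (lambda - 1)))
    with (K * (Rpower (1 - r) (1 - lambda) / (lambda - 1)) - K * (1 / (lambda - 1))) by (field; lra).
  apply G.
  - intros t Ht. apply (is_path_derive_comp F (fun t : R => t * z)%C).
    + apply (holomorphic_derive in_disk); [ exact HF | now apply in_disk_scal ].
    + apply is_path_derive_ray.
  - intros t Ht. assert (Hp := Hpos t Ht). unfold Rpower.
    auto_derive; [ lra | ].
    replace (- lambda * ln (1 - t * r)) with ((1 - lambda) * ln (1 - t * r) + - ln (1 - t * r)) by ring.
    rewrite exp_plus, exp_Ropp, exp_ln by lra.
    replace (1 + - (t * r)) with (1 - t * r) by ring. field. lra.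
  - intros t Ht. assert (B := HK (t * z)%C (in_disk_scal z t Hz Ht)).
    rewrite Cmod_mult. rewrite Cmod_mult, Cmod_R, (Rabs_pos_eq t) in B by lra. fold r in B |- *.
    replace (K * (r * Rpower (1 - t * r) (- lambda))) with (K * Rpower (1 - t * r) (- lambda) * r) by ring.
    apply Rmult_le_compat_r; assumption.
Qed.

Lemma cis_0 : cis 0 = 1.
Proof. unfold cis. rewrite cos_0, sin_0. reflexivity. Qed.

Lemma cis_PI : cis PI = (- (1))%C.
Proof. unfold cis. rewrite cos_PI, sin_PI. apply injective_projections; simpl; ring. Qed.

Lemma Cmod_half_sum (a b : C) (M : R) :
  Cmod (a + b) <= M -> Cmod (a - b) <= M -> Cmod a <= M /\ Cmod b <= M.
Proof.
  intros H1 H2.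
  assert (H3 := Cmod_triangle (a + b) (a - b)).
  assert (H4 := Cmod_triangle (a + b) (- (a - b))).
  replace (a + b + (a - b))%C with (2 * a)%C in H3 by ring.
  replace (a + b + - (a - b))%C with (2 * b)%C in H4 by ring.
  rewrite Cmod_opp in H4.
  rewrite Cmod_mult, Cmod_R, Rabs_pos_eq in H3, H4 by lra. lra.
Qed.

(** The rotations [t = 0] and [t = PI] control [h' + g'] and [h' - g'], hence their
    half sum and half difference. *)
Lemma class_B_derivative_growth (lambda : R) (h g : C -> C) : 0 < lambda ->
  analytic h -> analytic g ->
  (forall t, 0 <= t <= 2 * PI -> pre_Schwarzian_le lambda (fun z => h z + cis t * g z)%C) ->
  exists K, 0 <= K /\ forall z, in_disk z ->
    Cmod (C_derive h z) <= K * Rpower (1 - Cmod z) (- lambda) /\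
    Cmod (C_derive g z) <= K * Rpower (1 - Cmod z) (- lambda).
Proof.
  intros Hl Hh Hg HS. assert (HPI := PI_RGT_0).
  set (F0 := fun z => (h z + cis 0 * g z)%C). set (F1 := fun z => (h z + cis PI * g z)%C).
  set (C0 := Cmod (C_derive F0 0) + Cmod (C_derive F1 0)).
  assert (P0 := Cmod_ge_0 (C_derive F0 0)). assert (P1 := Cmod_ge_0 (C_derive F1 0)).
  exists (C0 * Rpower 2 lambda). split.
  { apply Rmult_le_pos; [ unfold C0; lra | left; apply exp_pos ]. }
  intros z Hz.
  assert (G0 := pre_Schwarzian_growth lambda F0 z Hl (HS 0 ltac:(lra)) Hz).
  assert (G1 := pre_Schwarzian_growth lambda F1 z Hl (HS PI ltac:(lra)) Hz).
  assert (Hr0 := Cmod_ge_0 z). assert (Hr1 : Cmod z < 1) by exact Hz.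
  assert (HR : Rpower ((1 + Cmod z) / (1 - Cmod z)) lambda <= Rpower 2 lambda * Rpower (1 - Cmod z) (- lambda)).
  { replace (- lambda) with (- (1) * lambda) by ring.
    rewrite <- Rpower_mult, Rpower_Ropp, Rpower_1 by lra.
    unfold Rdiv. rewrite <- Rpower_mult_distr; [ | lra | apply Rinv_0_lt_compat; lra ].
    apply Rmult_le_compat_r; [ left; apply exp_pos | ].
    apply Rle_Rpower_l; lra. }
  assert (HR0 : 0 < Rpower ((1 + Cmod z) / (1 - Cmod z)) lambda) by apply exp_pos.
  assert (D0 := proj1 (proj2 (C_derive_combination h g (cis 0) Hh Hg) z Hz)).
  assert (D1 := proj1 (proj2 (C_derive_combination h g (cis PI) Hh Hg) z Hz)).
  fold F0 in D0. fold F1 in D1. rewrite cis_0 in D0. rewrite cis_PI in D1.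
  rewrite D0 in G0. rewrite D1 in G1.
  apply Cmod_half_sum.
  - replace (C_derive h z + C_derive g z)%C with (C_derive h z + 1 * C_derive g z)%C by ring.
    unfold C0. nra.
  - replace (C_derive h z - C_derive g z)%C with (C_derive h z + - (1) * C_derive g z)%C by ring.
    unfold C0. nra.
Qed.

Lemma class_B_growth (lambda : R) (f h g : C -> C) : 0 < lambda -> lambda <> 1 ->
  canonical_decomposition f h g ->
  (forall t, 0 <= t <= 2 * PI -> pre_Schwarzian_le lambda (fun z => h z + cis t * g z)%C) ->
  exists K, 0 <= K /\ forall z, in_disk z ->
    Cmod (f z) <= K * ((Rpower (1 - Cmod z) (1 - lambda) - 1) / (lambda - 1)).
Proof.
  intros Hl Hl1 (Hh & Hg & Hf & h0 & g0 & _) HS.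
  destruct (class_B_derivative_growth lambda h g Hl Hh Hg HS) as [K [HK HD]].
  exists (2 * K). split; [ lra | ]. intros z Hz. rewrite (Hf z Hz).
  eapply Rle_trans; [ apply Cmod_triangle | ]. rewrite Cmod_Cconj.
  assert (Bh := radial_growth lambda K h z Hl1 Hh h0 (fun z Hz => proj1 (HD z Hz)) Hz).
  assert (Bg := radial_growth lambda K g z Hl1 Hg g0 (fun z Hz => proj2 (HD z Hz)) Hz).
  lra.
Qed.

Theorem class_B_bounded (lambda : R) (f : C -> C) : 0 < lambda < 1 ->
  class_B lambda f -> hardy_infty f.
Proof.
  intros Hl HB. destruct (class_B_pre_Schwarzian lambda f HB) as (h & g & Hd & HS).
  split; [ apply (canonical_decomposition_harmonic f h g Hd) | ].
  destruct (class_B_growth lambda f h g ltac:(lra) ltac:(lra) Hd HS) as [K [HK Hf]].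
  exists (K * (1 / (1 - lambda))). intros z Hz.
  eapply Rle_trans; [ apply Hf, Hz | ].
  apply Rmult_le_compat_l; [ exact HK | ].
  replace ((Rpower (1 - Cmod z) (1 - lambda) - 1) / (lambda - 1))
    with ((1 - Rpower (1 - Cmod z) (1 - lambda)) * / (1 - lambda)) by (field; lra).
  apply Rmult_le_compat_r; [ left; apply Rinv_0_lt_compat; lra | ].
  assert (H := exp_pos ((1 - lambda) * ln (1 - Cmod z))). unfold Rpower. lra.
Qed.

(** * Superharmonic functions and means over circles *)

Lemma C2_left_const (k : R) :
  C2_left (fun _ _ => k) (fun _ _ => 0) (fun _ _ => 0) (fun _ _ => 0) (fun _ _ => 0).
Proof.
  apply (C2_left_fst (fun _ => k) (fun _ => 0) (fun _ => 0)). intros s _.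
  split; [ exact (@is_derive_const R_AbsRing R_NormedModule k s) | ].
  split; [ exact (@is_derive_const R_AbsRing R_NormedModule 0 s) | apply continuous_const ].
Qed.

Lemma C2_left_scal (k : R) (u us ut uss utt : R -> R -> R) :
  C2_left u us ut uss utt ->
  C2_left (fun s t => k * u s t) (fun s t => k * us s t) (fun s t => k * ut s t)
    (fun s t => k * uss s t) (fun s t => k * utt s t).
Proof.
  intros Hu s t Hs.
  destruct (Hu s t Hs) as [(U1 & U2 & U3 & U4) (U5 & U6 & U7 & U8 & U9)].
  split.
  - split; [ exact (is_derive_scal _ _ k _ U1) | ]. split; [ exact (is_derive_scal _ _ k _ U2) | ].
    split; [ exact (is_derive_scal _ _ k _ U3) | exact (is_derive_scal _ _ k _ U4) ].
  - repeat (split; [ apply continuity_2d_pt_mult; [ apply continuity_2d_pt_const | assumption ] | ]).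
    apply continuity_2d_pt_mult; [ apply continuity_2d_pt_const | assumption ].
Qed.

Lemma C2_left_square (u us ut uss utt : R -> R -> R) :
  C2_left u us ut uss utt ->
  C2_left (fun s t => u s t ^ 2) (fun s t => us s t * (2 * u s t)) (fun s t => ut s t * (2 * u s t))
    (fun s t => uss s t * (2 * u s t) + us s t * (us s t * 2))
    (fun s t => utt s t * (2 * u s t) + ut s t * (ut s t * 2)).
Proof.
  apply (C2_left_comp (fun x => x ^ 2) (fun x => 2 * x) (fun _ => 2)).
  intros s t _. split; [ auto_derive; [ exact I | ring ] | ].
  split; [ auto_derive; [ exact I | ring ] | apply continuous_const ].
Qed.

Lemma C2_left_exp (k : R) (u us ut uss utt : R -> R -> R) :
  C2_left u us ut uss utt ->
  C2_left (fun s t => exp (k * u s t)) (fun s t => us s t * (k * exp (k * u s t)))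
    (fun s t => ut s t * (k * exp (k * u s t)))
    (fun s t => uss s t * (k * exp (k * u s t)) + us s t * (us s t * (k * (k * exp (k * u s t)))))
    (fun s t => utt s t * (k * exp (k * u s t)) + ut s t * (ut s t * (k * (k * exp (k * u s t))))).
Proof.
  apply (C2_left_comp (fun x => exp (k * x)) (fun x => k * exp (k * x)) (fun x => k * (k * exp (k * x)))).
  intros s t _. split; [ auto_derive; [ exact I | ring ] | ].
  split; [ auto_derive; [ exact I | ring ] | ].
  apply (@ex_derive_continuous R_AbsRing R_NormedModule). auto_derive; exact I.
Qed.

Lemma C2_left_ln (u us ut uss utt : R -> R -> R) : (forall s t, s < 0 -> 0 < u s t) ->
  C2_left u us ut uss utt ->
  C2_left (fun s t => ln (u s t)) (fun s t => us s t * / u s t) (fun s t => ut s t * / u s t)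
    (fun s t => uss s t * / u s t + us s t * (us s t * - / u s t ^ 2))
    (fun s t => utt s t * / u s t + ut s t * (ut s t * - / u s t ^ 2)).
Proof.
  intros Hpos. apply (C2_left_comp ln Rinv (fun x => - / x ^ 2)).
  intros s t Hs. assert (H := Hpos s t Hs). split; [ apply is_derive_ln, H | ].
  split; [ auto_derive; [ lra | field; lra ] | ].
  apply (@ex_derive_continuous R_AbsRing R_NormedModule). auto_derive.
  apply Rgt_not_eq, Rmult_lt_0_compat; lra.
Qed.

Lemma exp_opp_minus_exp_pos (s : R) : s < 0 -> 0 < exp (- s) - exp s.
Proof. intros Hs. assert (H := exp_increasing s (- s) ltac:(lra)). lra. Qed.

(** The conformal factor: with [r = e^s], [e^(- s) - e^s] is [(1 - r^2) / r]. *)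
Lemma C2_left_ln_sinh :
  C2_left (fun s _ => ln (exp (- s) - exp s))
    (fun s _ => - (exp (- s) + exp s) / (exp (- s) - exp s)) (fun _ _ => 0)
    (fun s _ => - 4 / (exp (- s) - exp s) ^ 2) (fun _ _ => 0).
Proof.
  apply C2_left_fst. intros s Hs. assert (H := exp_opp_minus_exp_pos s Hs).
  assert (E : exp (- s) * exp s = 1)
    by (rewrite <- exp_plus; replace (- s + s) with 0 by ring; apply exp_0).
  split; [ | split ].
  - auto_derive; [ lra | field; lra ].
  - auto_derive; [ lra | ].
    replace (- 4) with ((exp (- s) - exp s) ^ 2 - (exp (- s) + exp s) ^ 2)
      by (transitivity (- 4 * (exp (- s) * exp s)); [ ring | rewrite E; ring ]).
    field; lra.
  - apply (@ex_derive_continuous R_AbsRing R_NormedModule). auto_derive.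
    apply Rgt_not_eq. apply Rmult_lt_0_compat; lra.
Qed.

(** The integral of [u] over the circle [|z| = e^s] is a nonnegative concave
    function of [s], so it is largest near minus infinity. *)
Lemma circle_mean_superharmonic (u us ut uss utt : R -> R -> R) (B s0 : R) :
  C2_left u us ut uss utt -> (forall s, s < 0 -> ut s (2 * PI) = ut s 0) ->
  (forall s t, s < 0 -> uss s t + utt s t <= 0) ->
  (forall s t, s < 0 -> 0 <= u s t) ->
  s0 < 0 -> (forall s t, s <= s0 -> u s t <= B) ->
  forall s, s < 0 -> RInt (fun t => u s t) 0 (2 * PI) <= 2 * PI * B.
Proof.
  intros HC Hper Hsup Hpos Hs0 HB. assert (HPI := PI_RGT_0).
  assert (EX : forall f : R -> R -> R, (forall s t, s < 0 -> continuity_2d_pt f s t) ->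
    forall s, s < 0 -> ex_RInt (fun t => f s t) 0 (2 * PI)).
  { intros f Hf s Hs. apply (@ex_RInt_continuous R_CompleteNormedModule). intros t _.
    apply (continuity_2d_pt_section_r f), Hf, Hs. }
  assert (EU : forall s, s < 0 -> ex_RInt (fun t => u s t) 0 (2 * PI)).
  { apply EX. intros s t Hs. apply (HC s t Hs). }
  assert (C0 : forall c, RInt (fun _ => c) 0 (2 * PI) = 2 * PI * c).
  { intros c. rewrite RInt_const. unfold scal; simpl; unfold mult; simpl. ring. }
  apply (concave_half_line_le (fun s => RInt (fun t => u s t) 0 (2 * PI))
    (fun s => RInt (fun t => us s t) 0 (2 * PI))
    (fun s => RInt (fun t => uss s t + utt s t) 0 (2 * PI)) (2 * PI * B) s0).
  - intros s Hs. apply (circular_mean_derive2 u us ut uss utt s HC Hper Hs).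
  - intros s Hs. apply (circular_mean_derive2 u us ut uss utt s HC Hper Hs).
  - intros s Hs. apply Rle_trans with (RInt (fun _ => 0) 0 (2 * PI)); [ | rewrite C0; lra ].
    apply RInt_le; [ lra | | apply ex_RInt_const | intros; apply Hsup, Hs ].
    apply (EX (fun s t => uss s t + utt s t)); [ | exact Hs ].
    intros x t Hx. apply continuity_2d_pt_plus; apply (HC x t Hx).
  - intros s Hs. apply Rle_trans with (RInt (fun _ => 0) 0 (2 * PI)); [ rewrite C0; lra | ].
    apply RInt_le; [ lra | apply ex_RInt_const | apply EU, Hs | intros; apply Hpos, Hs ].
  - intros s Hs. rewrite <- C0.
    apply RInt_le; [ lra | apply EU; lra | apply ex_RInt_const | intros; apply HB, Hs ].
Qed.

(** With [S = e^(-s) - e^s], the hyperbolic derivative is [E = S |A'|]. Its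
    logarithm has Laplacian [- 4 / S^2] and gradient at most [4 / S], so
    [E^(1/8)] is superharmonic with Laplacian at most [- E^(1/8) / (4 S^2)].
    Since [E] is bounded, a multiple of it compensates the Laplacian
    [4 |A'|^2 = 4 E^2 / S^2] of [|A - c|^2]. *)
Lemma circle_mean_bound (A : C -> C) (c : C) (L s0 : R) :
  holomorphic left_half_plane A ->
  (forall s, s < 0 -> A (s, 2 * PI) = A (s, 0) /\ C_derive A (s, 2 * PI) = C_derive A (s, 0) /\
     C_derive (C_derive A) (s, 2 * PI) = C_derive (C_derive A) (s, 0)) ->
  (forall s t, s < 0 -> C_derive A (s, t) <> 0) ->
  (forall s t, s < 0 -> (exp (- s) - exp s) * Cmod (C_derive A (s, t)) <= exp L) ->
  (forall s t, s < 0 ->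
     Cmod ((exp (- s) - exp s)%R * C_derive (C_derive A) (s, t)
           - (exp (- s) + exp s)%R * C_derive A (s, t)) <= 4 * Cmod (C_derive A (s, t))) ->
  s0 < 0 -> (forall s t, s <= s0 -> Cmod (A (s, t) - c) <= 1) ->
  forall s, s < 0 ->
  RInt (fun t => Cmod (A (s, t) - c)%C ^ 2) 0 (2 * PI) <= 2 * PI * (1 + 16 * exp (2 * L)).
Proof.
  intros HA Hper Hne HE HG Hs0 Hlim. assert (HPI := PI_RGT_0).
  assert (HA' := holomorphic_C_derive _ _ open_left_half_plane HA).
  destruct (C2_left_holomorphic _ HA) as [CX CY].
  destruct (C2_left_holomorphic _ HA') as [Cx Cy].
  set (A1 := C_derive A) in *. set (A2 := C_derive A1) in *. set (A3 := C_derive A2) in *.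
  assert (Hq : forall s t, s < 0 -> 0 < Re (A1 (s, t)) ^ 2 + Im (A1 (s, t)) ^ 2).
  { intros s t Hs. rewrite <- Cmod_sqr. apply pow_lt, Cmod_gt_0, Hne, Hs. }
  assert (Cl := C2_left_plus _ _ _ _ _ _ _ _ _ _ C2_left_ln_sinh
    (C2_left_scal (1 / 2) _ _ _ _ _ (C2_left_ln _ _ _ _ _ Hq
      (C2_left_plus _ _ _ _ _ _ _ _ _ _ (C2_left_square _ _ _ _ _ Cx) (C2_left_square _ _ _ _ _ Cy))))).
  (* With [e = E^(1/8)] and [E <= e^L]: [16 E^2 <= 16 e^(15 L / 8) e = K e]. *)
  set (K := 16 * exp (15 / 8 * L)).
  assert (HK : 0 < K) by (unfold K; assert (H := exp_pos (15 / 8 * L)); lra).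
  assert (Cv := C2_left_scal K _ _ _ _ _ (C2_left_exp (1 / 8) _ _ _ _ _ Cl)).
  assert (Cc := C2_left_const).
  assert (Cu := C2_left_plus _ _ _ _ _ _ _ _ _ _
    (C2_left_plus _ _ _ _ _ _ _ _ _ _
      (C2_left_square _ _ _ _ _ (C2_left_plus _ _ _ _ _ _ _ _ _ _ CX (Cc (- Re c))))
      (C2_left_square _ _ _ _ _ (C2_left_plus _ _ _ _ _ _ _ _ _ _ CY (Cc (- Im c))))) Cv).
  cbv beta in Cu.
  set (l := fun s t => ln (exp (- s) - exp s) + 1 / 2 * ln (Re (A1 (s, t)) ^ 2 + Im (A1 (s, t)) ^ 2)) in *.
  assert (Hl : forall s t, s < 0 -> exp (l s t) = (exp (- s) - exp s) * Cmod (A1 (s, t))).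
  { intros s t Hs. unfold l. rewrite exp_plus, exp_ln by (apply exp_opp_minus_exp_pos, Hs). f_equal.
    rewrite <- Cmod_sqr. assert (Hm : 0 < Cmod (A1 (s, t))) by (apply Cmod_gt_0, Hne, Hs).
    replace (Cmod (A1 (s, t)) ^ 2) with (Cmod (A1 (s, t)) * Cmod (A1 (s, t))) by ring.
    rewrite ln_mult by assumption.
    replace (1 / 2 * (ln (Cmod (A1 (s, t))) + ln (Cmod (A1 (s, t))))) with (ln (Cmod (A1 (s, t)))) by field.
    apply exp_ln, Hm. }
  assert (HlL : forall s t, s < 0 -> l s t <= L).
  { intros s t Hs. apply Rnot_lt_le. intros Hlt. apply exp_increasing in Hlt.
    rewrite Hl in Hlt by exact Hs. specialize (HE s t Hs). lra. }
  assert (Hexp_le : forall a b, a <= b -> exp a <= exp b).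
  { intros a b [Hab | ->]; [ left; now apply exp_increasing | lra ]. }
  assert (Hdist : forall s t, Cmod (A (s, t) - c) ^ 2 =
    (Re (A (s, t)) + - Re c) ^ 2 + (Im (A (s, t)) + - Im c) ^ 2).
  { intros s t. rewrite Cmod_sqr. unfold Re, Im; simpl; ring. }
  intros s Hs.
  apply Rle_trans with (RInt (fun t => (Re (A (s, t)) + - Re c) ^ 2 + (Im (A (s, t)) + - Im c) ^ 2 +
    K * exp (1 / 8 * l s t)) 0 (2 * PI)).
  - apply RInt_le; [ lra | | | ].
    + apply (@ex_RInt_continuous R_CompleteNormedModule). intros t _.
      apply (continuous_ext (fun t => (Re (A (s, t)) + - Re c) ^ 2 + (Im (A (s, t)) + - Im c) ^ 2));
        [ intros; symmetry; apply Hdist | ].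
      assert (C1 := C2_left_plus _ _ _ _ _ _ _ _ _ _
        (C2_left_square _ _ _ _ _ (C2_left_plus _ _ _ _ _ _ _ _ _ _ CX (Cc (- Re c))))
        (C2_left_square _ _ _ _ _ (C2_left_plus _ _ _ _ _ _ _ _ _ _ CY (Cc (- Im c))))).
      apply (continuity_2d_pt_section_r
        (fun s t => (Re (A (s, t)) + - Re c) ^ 2 + (Im (A (s, t)) + - Im c) ^ 2)).
      apply (C1 s t Hs).
    + apply (@ex_RInt_continuous R_CompleteNormedModule). intros t _.
      apply (continuity_2d_pt_section_r (fun s t => (Re (A (s, t)) + - Re c) ^ 2 + (Im (A (s, t)) + - Im c) ^ 2 +
    K * exp (1 / 8 * l s t))). apply (Cu s t Hs).
    + intros t _. rewrite Hdist.
      assert (0 < K * exp (1 / 8 * l s t)) by (apply Rmult_lt_0_compat; [ exact HK | apply exp_pos ]). lra.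
  - revert s Hs. apply (circle_mean_superharmonic _ _ _ _ _ _ s0 Cu).
    + intros s Hs. destruct (Hper s Hs) as (E0 & E1 & E2). unfold l. rewrite E0, E1, E2. reflexivity.
    + intros s t Hs. fold (l s t).
      assert (HS := exp_opp_minus_exp_pos s Hs). assert (Hqs := Hq s t Hs).
      assert (HGs := HG s t Hs). assert (Hls := Hl s t Hs). assert (HlLs := HlL s t Hs).
      assert (HG2 : Cmod ((exp (- s) - exp s)%R * A2 (s, t) - (exp (- s) + exp s)%R * A1 (s, t)) ^ 2
                    <= 16 * Cmod (A1 (s, t)) ^ 2).
      { replace (16 * Cmod (A1 (s, t)) ^ 2) with ((4 * Cmod (A1 (s, t))) ^ 2) by ring.
        apply pow_incr. split; [ apply Cmod_ge_0 | exact HGs ]. }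
      rewrite !Cmod_sqr in HG2.
      assert (Hl2 : exp (2 * l s t) = (exp (- s) - exp s) ^ 2 * (Re (A1 (s, t)) ^ 2 + Im (A1 (s, t)) ^ 2)).
      { rewrite <- Cmod_sqr, <- Rpow_mult_distr, <- Hls.
        replace (2 * l s t) with (l s t + l s t) by ring. rewrite exp_plus. ring. }
      assert (HKe : 16 * exp (2 * l s t) <= K * exp (1 / 8 * l s t)).
      { unfold K. rewrite Rmult_assoc, <- exp_plus. apply Rmult_le_compat_l; [ lra | ].
        apply Hexp_le. lra. }
      set (e := exp (1 / 8 * l s t)) in *. assert (He : 0 < e) by apply exp_pos.
      set (S := exp (- s) - exp s) in *. set (D := exp (- s) + exp s) in *.
      set (x := Re (A1 (s, t))) in *. set (y := Im (A1 (s, t))) in *.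
      set (p := Re (A2 (s, t))) in *. set (r := Im (A2 (s, t))) in *.
      set (a3 := Re (A3 (s, t))). set (b3 := Im (A3 (s, t))).
      set (X := Re (A (s, t))). set (Y := Im (A (s, t))).
      set (q := x ^ 2 + y ^ 2) in *.
      replace (Re (S * A2 (s, t) - D * A1 (s, t))) with (S * p - D * x) in HG2
        by (unfold p, x, Re; simpl; ring).
      replace (Im (S * A2 (s, t) - D * A1 (s, t))) with (S * r - D * y) in HG2
        by (unfold r, y, Im; simpl; ring).
      (* The Laplacian of [|A - c|^2 + K E^(1/8)]; the last fraction is the square
         of the gradient of [ln E]. The terms with [A'''] cancel since [ln |A'|] is
         harmonic. *)
      match goal with |- ?lhs <= 0 =>
        replace lhs with (4 * q + K * e * (1 / 8 * (- 4 / S ^ 2) +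
          1 / 64 * (((S * p - D * x) ^ 2 + (S * r - D * y) ^ 2) / (S ^ 2 * q)))) end.
      2: { unfold q in *; field; split; lra. }
      assert (HN : ((S * p - D * x) ^ 2 + (S * r - D * y) ^ 2) / (S ^ 2 * q) <= 16 / S ^ 2).
      { apply Rmult_le_reg_r with (S ^ 2 * q); [ apply Rmult_lt_0_compat; [ nra | exact Hqs ] | ].
        replace (((S * p - D * x) ^ 2 + (S * r - D * y) ^ 2) / (S ^ 2 * q) * (S ^ 2 * q))
          with ((S * p - D * x) ^ 2 + (S * r - D * y) ^ 2) by (field; split; lra).
        replace (16 / S ^ 2 * (S ^ 2 * q)) with (16 * q) by (field; lra). exact HG2. }
      assert (HKe0 : 0 < K * e) by (apply Rmult_lt_0_compat; assumption).
      apply Rle_trans with (4 * q + K * e * (1 / 8 * (- 4 / S ^ 2) + 1 / 64 * (16 / S ^ 2))).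
      { apply Rplus_le_compat_l, Rmult_le_compat_l; lra. }
      replace (4 * q + K * e * (1 / 8 * (- 4 / S ^ 2) + 1 / 64 * (16 / S ^ 2)))
        with ((16 * (S ^ 2 * q) - K * e) / (4 * S ^ 2)) by (field; lra).
      rewrite <- Hl2. unfold Rdiv.
      assert (0 < / (4 * S ^ 2)) by (apply Rinv_0_lt_compat; nra). nra.
    + intros s t Hs. fold (l s t).
      assert (0 < K * exp (1 / 8 * l s t)) by (apply Rmult_lt_0_compat; [ exact HK | apply exp_pos ]).
      assert (H1 := pow2_ge_0 (Re (A (s, t)) + - Re c)). assert (H2 := pow2_ge_0 (Im (A (s, t)) + - Im c)). lra.
    + exact Hs0.
    + intros s t Hs. fold (l s t). rewrite <- Hdist.
      assert (H1 := Hlim s t Hs). assert (H0 := Cmod_ge_0 (A (s, t) - c)).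
      apply Rplus_le_compat; [ nra | ].
      replace (16 * exp (2 * L)) with (K * exp (1 / 8 * L))
        by (unfold K; rewrite Rmult_assoc, <- exp_plus; do 2 f_equal; field).
      apply Rmult_le_compat_l; [ lra | ]. apply Hexp_le. assert (K1 := HlL s t ltac:(lra)). lra.
Qed.

(** * The exponential map and the automorphisms of the disk *)

Lemma is_C_derive_of_Cauchy_Riemann (h : C -> C) (x y a b : R) :
  differentiable_pt_lim (fun u v => Re (h (u, v))) x y a (- b) ->
  differentiable_pt_lim (fun u v => Im (h (u, v))) x y b a ->
  is_C_derive h (x, y) (a, b).
Proof.
  intros H1 H2. apply is_C_derive_eps. intros eps.
  assert (He : 0 < eps / 2) by (assert (H := cond_pos eps); lra).
  destruct (H1 (mkposreal _ He)) as [d1 D1]. destruct (H2 (mkposreal _ He)) as [d2 D2].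
  simpl in D1, D2.
  exists (mkposreal _ (Rmin_pos d1 d2 (cond_pos d1) (cond_pos d2))). simpl.
  intros [u v] Hw.
  assert (Hr := Re_le_Cmod ((u, v) - (x, y))). assert (Hi := Im_le_Cmod ((u, v) - (x, y))).
  replace (Re ((u, v) - (x, y))) with (u - x) in Hr by (unfold Re; simpl; ring).
  replace (Im ((u, v) - (x, y))) with (v - y) in Hi by (unfold Im; simpl; ring).
  assert (M1 := Rmin_l d1 d2). assert (M2 := Rmin_r d1 d2).
  specialize (D1 u v ltac:(lra) ltac:(lra)). specialize (D2 u v ltac:(lra) ltac:(lra)).
  set (m := Cmod ((u, v) - (x, y))) in *.
  assert (Hm : Rmax (Rabs (u - x)) (Rabs (v - y)) <= m) by (apply Rmax_lub; assumption).
  assert (Hm2 : eps / 2 * Rmax (Rabs (u - x)) (Rabs (v - y)) <= eps / 2 * m)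
    by (apply Rmult_le_compat_l; lra).
  eapply Rle_trans; [ apply Cmod_le_Rabs | ].
  replace (Re (h (u, v) - h (x, y) - (a, b) * ((u, v) - (x, y))))
    with (Re (h (u, v)) - Re (h (x, y)) - (a * (u - x) + - b * (v - y))) by (unfold Re; simpl; ring).
  replace (Im (h (u, v) - h (x, y) - (a, b) * ((u, v) - (x, y))))
    with (Im (h (u, v)) - Im (h (x, y)) - (b * (u - x) + a * (v - y))) by (unfold Im; simpl; ring).
  lra.
Qed.

Definition Cexp (z : C) : C := (exp (Re z) * cis (Im z))%C.

Lemma is_C_derive_Cexp (z : C) : is_C_derive Cexp z (Cexp z).
Proof.
  destruct z as [s t].
  replace (Cexp (s, t)) with (exp s * cos t, exp s * sin t)
    by (unfold Cexp, cis; apply injective_projections; simpl; ring).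
  assert (E : differentiable_pt_lim (fun u _ => exp u) s t (exp s) 0)
    by (apply differentiable_pt_lim_fst, is_derive_exp).
  apply is_C_derive_of_Cauchy_Riemann.
  - eapply differentiable_pt_lim_eq.
    + exact (differentiable_pt_lim_mult _ _ s t _ _ _ _ E
        (differentiable_pt_lim_snd cos s t _ (is_derive_cos t))).
    + intros u v. unfold Cexp, cis, Re, Im; simpl; ring.
    + cbv beta; ring.
    + cbv beta; ring.
  - eapply differentiable_pt_lim_eq.
    + exact (differentiable_pt_lim_mult _ _ s t _ _ _ _ E
        (differentiable_pt_lim_snd sin s t _ (is_derive_sin t))).
    + intros u v. unfold Cexp, cis, Re, Im; simpl; ring.
    + cbv beta; ring.
    + cbv beta; ring.
Qed.

Lemma Cmod_Cexp (z : C) : Cmod (Cexp z) = exp (Re z).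
Proof.
  unfold Cexp. rewrite Cmod_mult, Cmod_R, Cmod_cis, Rabs_pos_eq by (left; apply exp_pos). ring.
Qed.

Lemma Cexp_in_disk (z : C) : left_half_plane z -> in_disk (Cexp z).
Proof.
  unfold left_half_plane, in_disk. intros Hz. rewrite Cmod_Cexp, <- exp_0. apply exp_increasing, Hz.
Qed.

Lemma automorphism_denominator (a z : C) : in_disk a -> in_disk z -> (1 + Cconj a * z)%C <> 0.
Proof.
  unfold in_disk. intros Ha Hz E.
  assert (H : Cmod (Cconj a * z) = 1).
  { replace (Cconj a * z)%C with ((1 + Cconj a * z) + - (1))%C by ring. rewrite E.
    replace (0 + - (1))%C with (- (1))%C by ring. rewrite Cmod_opp. apply Cmod_1. }
  rewrite Cmod_mult, Cmod_Cconj in H.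
  assert (H1 := Cmod_ge_0 a). assert (H2 := Cmod_ge_0 z). nra.
Qed.

Lemma disk_automorphism_Cmod (a z : C) : in_disk a -> in_disk z ->
  1 - Cmod (disk_automorphism a z) ^ 2 =
  (1 - Cmod z ^ 2) * (1 - Cmod a ^ 2) / Cmod (1 + Cconj a * z) ^ 2.
Proof.
  intros Ha Hz. assert (HD := automorphism_denominator a z Ha Hz).
  assert (HD' : 0 < Cmod (1 + Cconj a * z)) by (apply Cmod_gt_0, HD).
  unfold disk_automorphism. rewrite Cmod_div by exact HD.
  assert (E : Cmod (1 + Cconj a * z) ^ 2 - Cmod (z + a) ^ 2 = (1 - Cmod z ^ 2) * (1 - Cmod a ^ 2)).
  { rewrite !Cmod_sqr. unfold Re, Im; simpl; ring. }
  rewrite <- E. field. lra.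
Qed.

Lemma disk_automorphism_in_disk (a z : C) : in_disk a -> in_disk z -> in_disk (disk_automorphism a z).
Proof.
  intros Ha Hz. assert (E := disk_automorphism_Cmod a z Ha Hz).
  assert (HD' : 0 < Cmod (1 + Cconj a * z)) by (apply Cmod_gt_0, automorphism_denominator; assumption).
  unfold in_disk in *. assert (H1 := Cmod_ge_0 a). assert (H2 := Cmod_ge_0 z).
  assert (H : 0 < (1 - Cmod z ^ 2) * (1 - Cmod a ^ 2) / Cmod (1 + Cconj a * z) ^ 2).
  { apply Rdiv_lt_0_compat; [ apply Rmult_lt_0_compat; nra | nra ]. }
  rewrite <- E in H. assert (H3 := Cmod_ge_0 (disk_automorphism a z)). nra.
Qed.

Lemma is_C_derive_disk_automorphism (a z : C) : in_disk a -> in_disk z ->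
  is_C_derive (disk_automorphism a) z
    ((1 - a * Cconj a) * / ((1 + Cconj a * z) * (1 + Cconj a * z)))%C.
Proof.
  intros Ha Hz. assert (HD := automorphism_denominator a z Ha Hz).
  assert (Hden : is_C_derive (fun z => 1 + Cconj a * z)%C z (Cconj a)).
  { eapply is_C_derive_eq;
      [ apply is_C_derive_plus; [ apply is_C_derive_const | apply is_C_derive_scal, is_C_derive_id ] | ring ]. }
  assert (Hnum : is_C_derive (fun z => z + a)%C z 1).
  { eapply is_C_derive_eq;
      [ apply is_C_derive_plus; [ apply is_C_derive_id | apply is_C_derive_const ] | ring ]. }
  assert (H := is_C_derive_mult _ _ z _ _ Hnum
    (is_C_derive_comp Cinv _ z _ _ (is_C_derive_inv _ HD) Hden)).
  cbv beta in H.
  replace ((1 - a * Cconj a) * / ((1 + Cconj a * z) * (1 + Cconj a * z)))%C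
    with (1 * / (1 + Cconj a * z) + (z + a) *
      (- / ((1 + Cconj a * z) * (1 + Cconj a * z)) * Cconj a))%C by (field; exact HD).
  exact H.
Qed.

(** [(1 - |z|^2) F'' / F' - 2 conj z] is the gradient of
    [ln ((1 - |z|^2) |F'|)], up to conjugation and the factor [1 - |z|^2]. Unlike the
    pre-Schwarzian bound, a bound on it is invariant under automorphisms. *)
Definition hyperbolic_gradient_le (M : R) (F : C -> C) (z : C) : Prop :=
  C_derive F z <> 0 /\
  Cmod ((1 - Cmod z ^ 2)%R * C_derive (C_derive F) z - 2 * Cconj z * C_derive F z)
    <= M * Cmod (C_derive F z).

(** Each of the two terms contributes at most 2. *)
Lemma pre_Schwarzian_hyperbolic_gradient (F : C -> C) (z : C) :
  pre_Schwarzian_le 1 F -> in_disk z -> hyperbolic_gradient_le 4 F z.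
Proof.
  intros [_ H] Hz. destruct (H z Hz) as [H1 H2]. split; [ exact H1 | ].
  eapply Rle_trans; [ apply Cmod_triangle | ]. rewrite Cmod_opp, !Cmod_mult, !Cmod_R, Cmod_Cconj.
  unfold in_disk in Hz. assert (H0 := Cmod_ge_0 z). assert (H3 := Cmod_ge_0 (C_derive F z)).
  rewrite (Rabs_pos_eq 2), (Rabs_pos_eq (1 - Cmod z ^ 2)) by nra. nra.
Qed.

Lemma C_derive_comp_automorphism (F : C -> C) (a : C) : holomorphic in_disk F -> in_disk a ->
  holomorphic in_disk (fun z => F (disk_automorphism a z)) /\
  forall z, in_disk z ->
    let D := (1 + Cconj a * z)%C in
    let w := disk_automorphism a z in
    C_derive (fun z => F (disk_automorphism a z)) z =
      (C_derive F w * ((1 - a * Cconj a) * / (D * D)))%C /\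
    C_derive (C_derive (fun z => F (disk_automorphism a z))) z =
      (C_derive (C_derive F) w * ((1 - a * Cconj a) * / (D * D)) * ((1 - a * Cconj a) * / (D * D))
       + C_derive F w * (- 2 * Cconj a * (1 - a * Cconj a) * / (D * D * D)))%C.
Proof.
  intros HF Ha. assert (HF' := holomorphic_C_derive _ _ open_disk HF).
  assert (D1 : forall z, in_disk z -> is_C_derive (fun z => F (disk_automorphism a z)) z
    (C_derive F (disk_automorphism a z) *
      ((1 - a * Cconj a) * / ((1 + Cconj a * z) * (1 + Cconj a * z))))%C).
  { intros z Hz. apply (is_C_derive_comp F (disk_automorphism a)).
    - apply (holomorphic_derive in_disk); [ exact HF | now apply disk_automorphism_in_disk ].
    - now apply is_C_derive_disk_automorphism. }
  split; [ intros z Hz; eexists; exact (D1 z Hz) | ].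
  intros z Hz D w. split; [ apply is_C_derive_unique, D1, Hz | ].
  assert (HD := automorphism_denominator a z Ha Hz).
  apply is_C_derive_unique.
  destruct (open_disk z Hz) as [r [Hr Hw]].
  apply is_C_derive_ext_loc with (r := r) (f := fun z => (C_derive F (disk_automorphism a z) *
      ((1 - a * Cconj a) * / ((1 + Cconj a * z) * (1 + Cconj a * z))))%C);
    [ exact Hr | intros v Hv; symmetry; apply is_C_derive_unique, D1, Hw, Hv | ].
  assert (Hden : is_C_derive (fun z => 1 + Cconj a * z)%C z (Cconj a)).
  { eapply is_C_derive_eq;
      [ apply is_C_derive_plus; [ apply is_C_derive_const | apply is_C_derive_scal, is_C_derive_id ] | ring ]. }
  eapply is_C_derive_eq.
  - apply is_C_derive_mult.
    + apply (is_C_derive_comp (C_derive F) (disk_automorphism a)).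
      * apply (holomorphic_derive in_disk); [ exact HF' | now apply disk_automorphism_in_disk ].
      * now apply is_C_derive_disk_automorphism.
    + apply is_C_derive_scal.
      apply (is_C_derive_comp Cinv (fun z => (1 + Cconj a * z) * (1 + Cconj a * z))%C).
      * apply is_C_derive_inv, Cmult_neq_0; exact HD.
      * apply is_C_derive_mult; exact Hden.
  - cbv beta. unfold w, D. field. exact HD.
Qed.

Lemma hyperbolic_gradient_automorphism (M : R) (F : C -> C) (a z : C) :
  holomorphic in_disk F -> in_disk a -> in_disk z ->
  hyperbolic_gradient_le M F (disk_automorphism a z) ->
  hyperbolic_gradient_le M (fun z => F (disk_automorphism a z)) z.
Proof.
  intros HF Ha Hz [H1 H2].
  destruct (C_derive_comp_automorphism F a HF Ha) as [_ HD].
  destruct (HD z Hz) as [E1 E2].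
  assert (Hden := automorphism_denominator a z Ha Hz).
  assert (HA := disk_automorphism_Cmod a z Ha Hz).
  assert (Hden' : 0 < Cmod (1 + Cconj a * z)) by (apply Cmod_gt_0, Hden).
  set (w := disk_automorphism a z) in *.
  assert (Ha1 : (1 - a * Cconj a)%C = RtoC (1 - Cmod a ^ 2))
    by (rewrite RtoC_minus, Cmod2_conj; reflexivity).
  assert (Ha2 : 0 < 1 - Cmod a ^ 2) by (unfold in_disk in Ha; assert (H := Cmod_ge_0 a); nra).
  assert (Hphi : ((1 - a * Cconj a) * / ((1 + Cconj a * z) * (1 + Cconj a * z)))%C <> 0).
  { intros E. apply Cmod_gt_0 in H1. apply (f_equal Cmod) in E.
    rewrite Cmod_mult, Ha1, Cmod_R, Rabs_pos_eq, Cmod_inv, Cmod_mult, Cmod_0 in E;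
      [ | apply Cmult_neq_0; exact Hden | lra ].
    apply Rmult_integral in E. destruct E as [E | E]; [ lra | ].
    revert E. apply Rinv_neq_0_compat. nra. }
  split; [ rewrite E1; apply Cmult_neq_0; assumption | ].
  rewrite E1, E2.
  set (Dc := (1 + a * Cconj z)%C).
  assert (HDc : Dc = Cconj (1 + Cconj a * z)).
  { unfold Dc. rewrite Cconj_plus, Cconj_mult, Cconj_conj. f_equal. apply injective_projections; simpl; ring. }
  assert (HDcm : Cmod Dc = Cmod (1 + Cconj a * z)) by (rewrite HDc; apply Cmod_Cconj).
  assert (HDc0 : Dc <> 0) by (apply Cmod_gt_0; rewrite HDcm; exact Hden').
  assert (Hwc : Cconj w = ((Cconj z + Cconj a) * / Dc)%C).
  { unfold w, disk_automorphism, Cdiv. rewrite Cconj_mult, Cconj_plus, Cconj_inv by exact Hden.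
    rewrite HDc. reflexivity. }
  assert (HwD : (RtoC (1 - Cmod w ^ 2) =
    (1 - z * Cconj z) * (1 - a * Cconj a) * / ((1 + Cconj a * z) * Dc))%C).
  { rewrite HA. rewrite Ha1. replace (1 - z * Cconj z)%C with (RtoC (1 - Cmod z ^ 2))
      by (rewrite RtoC_minus, Cmod2_conj; reflexivity).
    rewrite HDc, <- Cmod2_conj, <- RtoC_mult, <- RtoC_inv, <- RtoC_mult; [ reflexivity | nra ]. }
  replace (RtoC (1 - Cmod z ^ 2)) with (1 - z * Cconj z)%C
    by (rewrite RtoC_minus, Cmod2_conj; reflexivity).
  rewrite HwD, Hwc in H2.
  set (F1 := C_derive F w) in *. set (F2 := C_derive (C_derive F) w) in *.
  set (phi := ((1 - a * Cconj a) * / ((1 + Cconj a * z) * (1 + Cconj a * z)))%C) in *.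
  match goal with |- Cmod ?lhs <= _ => replace lhs with (phi * (Dc * / (1 + Cconj a * z)) *
    ((1 - z * Cconj z) * (1 - a * Cconj a) * / ((1 + Cconj a * z) * Dc) * F2
      - 2 * ((Cconj z + Cconj a) * / Dc) * F1))%C end.
  2: { unfold phi, Dc in *. field. split; assumption. }
  rewrite (Cmod_mult (phi * _)), (Cmod_mult phi), (Cmod_mult F1), (Cmod_mult Dc), Cmod_inv by exact Hden.
  rewrite HDcm, Rinv_r, Rmult_1_r by lra.
  rewrite (Rmult_comm (Cmod F1)), <- Rmult_assoc, (Rmult_comm M), Rmult_assoc.
  apply Rmult_le_compat_l; [ apply Cmod_ge_0 | exact H2 ].
Qed.

(** * Bounded mean oscillation when the pre-Schwarzian norm is at most 2 *)

Lemma pre_Schwarzian_Bloch (F : C -> C) (z : C) :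
  pre_Schwarzian_le 1 F -> in_disk z ->
  (1 - Cmod z ^ 2) * Cmod (C_derive F z) <= 4 * Cmod (C_derive F 0).
Proof.
  intros HF Hz. assert (G := pre_Schwarzian_growth 1 F z Rlt_0_1 HF Hz).
  assert (H0 := Cmod_ge_0 z). assert (H1 : Cmod z < 1) by exact Hz.
  rewrite Rpower_1 in G by (apply Rdiv_lt_0_compat; lra).
  assert (H2 := Cmod_ge_0 (C_derive F 0)).
  apply Rle_trans with ((1 - Cmod z ^ 2) * (Cmod (C_derive F 0) * ((1 + Cmod z) / (1 - Cmod z)))).
  - apply Rmult_le_compat_l; [ nra | exact G ].
  - replace ((1 - Cmod z ^ 2) * (Cmod (C_derive F 0) * ((1 + Cmod z) / (1 - Cmod z))))
      with ((1 + Cmod z) ^ 2 * Cmod (C_derive F 0)) by (field; lra).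
    apply Rmult_le_compat_r; [ exact H2 | nra ].
Qed.

Lemma hyperbolic_derivative_automorphism (F : C -> C) (a z : C) :
  holomorphic in_disk F -> in_disk a -> in_disk z ->
  (1 - Cmod z ^ 2) * Cmod (C_derive (fun z => F (disk_automorphism a z)) z) =
  (1 - Cmod (disk_automorphism a z) ^ 2) * Cmod (C_derive F (disk_automorphism a z)).
Proof.
  intros HF Ha Hz.
  destruct (C_derive_comp_automorphism F a HF Ha) as [_ HD].
  destruct (HD z Hz) as [E1 _]. rewrite E1, disk_automorphism_Cmod by assumption.
  assert (Hden := automorphism_denominator a z Ha Hz).
  assert (Hden' : 0 < Cmod (1 + Cconj a * z)) by (apply Cmod_gt_0, Hden).
  assert (Ha1 : (1 - a * Cconj a)%C = RtoC (1 - Cmod a ^ 2))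
    by (rewrite RtoC_minus, Cmod2_conj; reflexivity).
  assert (Ha2 : 0 < 1 - Cmod a ^ 2) by (unfold in_disk in Ha; assert (H := Cmod_ge_0 a); nra).
  rewrite !Cmod_mult, Ha1, Cmod_R, Rabs_pos_eq, Cmod_inv, Cmod_mult;
    [ field; lra | apply Cmult_neq_0; exact Hden | lra ].
Qed.

Lemma C_derive_comp_Cexp (F : C -> C) : holomorphic in_disk F ->
  holomorphic left_half_plane (fun z => F (Cexp z)) /\
  forall z, left_half_plane z ->
    C_derive (fun z => F (Cexp z)) z = (C_derive F (Cexp z) * Cexp z)%C /\
    C_derive (C_derive (fun z => F (Cexp z))) z =
      (C_derive (C_derive F) (Cexp z) * Cexp z * Cexp z + C_derive F (Cexp z) * Cexp z)%C.
Proof.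
  intros HF. assert (HF' := holomorphic_C_derive _ _ open_disk HF).
  assert (D1 : forall z, left_half_plane z ->
    is_C_derive (fun z => F (Cexp z)) z (C_derive F (Cexp z) * Cexp z)%C).
  { intros z Hz. apply (is_C_derive_comp F Cexp); [ | apply is_C_derive_Cexp ].
    apply (holomorphic_derive in_disk); [ exact HF | apply Cexp_in_disk, Hz ]. }
  split; [ intros z Hz; eexists; exact (D1 z Hz) | ].
  intros z Hz. split; [ apply is_C_derive_unique, D1, Hz | ].
  apply is_C_derive_unique.
  destruct (open_left_half_plane z Hz) as [r [Hr Hw]].
  apply is_C_derive_ext_loc with (r := r) (f := fun z => (C_derive F (Cexp z) * Cexp z)%C);
    [ exact Hr | intros v Hv; symmetry; apply is_C_derive_unique, D1, Hw, Hv | ].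
  apply (is_C_derive_mult (fun z => C_derive F (Cexp z)) Cexp); [ | apply is_C_derive_Cexp ].
  apply (is_C_derive_comp (C_derive F) Cexp); [ | apply is_C_derive_Cexp ].
  apply (holomorphic_derive in_disk); [ exact HF' | apply Cexp_in_disk, Hz ].
Qed.

Lemma Cexp_2PI (s : R) : Cexp (s, 2 * PI) = Cexp (s, 0).
Proof. unfold Cexp, cis; simpl. rewrite cos_2PI, sin_2PI, cos_0, sin_0. reflexivity. Qed.

Lemma holomorphic_near_minus_infinity (F : C -> C) : holomorphic in_disk F ->
  exists s0, s0 < 0 /\ forall s t, s <= s0 -> Cmod (F (Cexp (s, t)) - F 0) <= 1.
Proof.
  intros HF.
  assert (H0 : in_disk 0) by (unfold in_disk; rewrite Cmod_0; lra).
  destruct (HF 0 H0) as [d Hd]. rewrite is_C_derive_eps in Hd.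
  destruct (Hd (mkposreal 1 Rlt_0_1)) as [del Hdel]. simpl in Hdel.
  assert (Hd0 := Cmod_ge_0 d).
  destruct (exp_lt_pos_small (Rmin del (/ (1 + Cmod d)))) as [s0 [Hs0 He]].
  { apply Rmin_glb_lt; [ apply cond_pos | apply Rinv_0_lt_compat; lra ]. }
  exists s0. split; [ exact Hs0 | ]. intros s t Hs.
  assert (Hes : exp s <= exp s0).
  { destruct Hs as [Hs | ->]; [ left; now apply exp_increasing | lra ]. }
  assert (He1 : exp s < del) by (eapply Rle_lt_trans; [ exact Hes | eapply Rlt_le_trans; [ exact He | apply Rmin_l ] ]).
  assert (He2 : exp s < / (1 + Cmod d)) by (eapply Rle_lt_trans; [ exact Hes | eapply Rlt_le_trans; [ exact He | apply Rmin_r ] ]).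
  assert (Hm : Cmod (Cexp (s, t) - 0) = exp s).
  { replace (Cexp (s, t) - 0)%C with (Cexp (s, t)) by ring. apply Cmod_Cexp. }
  specialize (Hdel (Cexp (s, t)) ltac:(lra)). rewrite Hm in Hdel.
  replace (F (Cexp (s, t)) - F 0)%C with
    ((F (Cexp (s, t)) - F 0 - d * (Cexp (s, t) - 0)) + d * (Cexp (s, t) - 0))%C by ring.
  eapply Rle_trans; [ apply Cmod_triangle | ]. rewrite Cmod_mult, Hm.
  apply Rle_trans with ((1 + Cmod d) * exp s); [ lra | ].
  apply Rle_trans with ((1 + Cmod d) * / (1 + Cmod d)); [ | right; field; lra ].
  apply Rmult_le_compat_l; lra.
Qed.

(** The bounds on the hyperbolic derivative and on its logarithmic gradient pass
    from [F] to its compositions with automorphisms with the same constants, which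
    gives a bound independent of [a]. *)
Lemma pre_Schwarzian_mean_oscillation (F : C -> C) : pre_Schwarzian_le 1 F ->
  exists M, forall a s, in_disk a -> s < 0 ->
    RInt (fun t => Cmod (F (disk_automorphism a (Cexp (s, t))) - F a)%C ^ 2) 0 (2 * PI) <= M.
Proof.
  intros HP. assert (HF := proj1 HP).
  assert (Hd0 : in_disk 0) by (unfold in_disk; rewrite Cmod_0; lra).
  assert (HB0 : 0 < 4 * Cmod (C_derive F 0)).
  { assert (H := proj1 (proj2 HP 0 Hd0)). apply Cmod_gt_0 in H. lra. }
  set (L := ln (4 * Cmod (C_derive F 0))).
  assert (HL : exp L = 4 * Cmod (C_derive F 0)) by (apply exp_ln, HB0).
  exists (2 * PI * (1 + 16 * exp (2 * L))). intros a s Ha Hs.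
  set (Fa := fun z => F (disk_automorphism a z)).
  assert (HFa : holomorphic in_disk Fa) by apply (C_derive_comp_automorphism F a HF Ha).
  assert (HFa0 : Fa 0 = F a).
  { unfold Fa. f_equal. unfold disk_automorphism. field. }
  assert (Hgrad : forall z, in_disk z -> hyperbolic_gradient_le 4 Fa z).
  { intros z Hz. apply hyperbolic_gradient_automorphism; try assumption.
    apply pre_Schwarzian_hyperbolic_gradient; [ exact HP | now apply disk_automorphism_in_disk ]. }
  assert (Hbloch : forall z, in_disk z -> (1 - Cmod z ^ 2) * Cmod (C_derive Fa z) <= exp L).
  { intros z Hz. unfold Fa. rewrite hyperbolic_derivative_automorphism, HL by assumption.
    apply pre_Schwarzian_Bloch; [ exact HP | now apply disk_automorphism_in_disk ]. }
  destruct (C_derive_comp_Cexp Fa HFa) as [HA HAD].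
  destruct (holomorphic_near_minus_infinity Fa HFa) as [s0 [Hs0 Hlim]].
  assert (Hexp : forall s, exp (- s) * exp s = 1)
    by (intros x; rewrite <- exp_plus, <- exp_0; f_equal; ring).
  assert (Hmod : forall s t, Cmod (Cexp (s, t)) = exp s) by (intros; apply Cmod_Cexp).
  rewrite <- HFa0.
  change (RInt (fun t => Cmod ((fun z => Fa (Cexp z)) (s, t) - Fa 0)%C ^ 2) 0 (2 * PI)
    <= 2 * PI * (1 + 16 * exp (2 * L))).
  apply (circle_mean_bound (fun z => Fa (Cexp z)) (Fa 0) L s0 HA); [ .. | exact Hs ].
  - intros x Hx. assert (H1 : left_half_plane (x, 2 * PI)) by exact Hx.
    assert (H2 : left_half_plane (x, 0)) by exact Hx.
    destruct (HAD _ H1) as [-> ->]. destruct (HAD _ H2) as [-> ->].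
    rewrite Cexp_2PI. repeat split.
  - intros x t Hx. assert (H1 : left_half_plane (x, t)) by exact Hx.
    destruct (HAD _ H1) as [-> _]. apply Cmult_neq_0.
    + apply Hgrad, Cexp_in_disk, H1.
    + apply Cmod_gt_0. rewrite Hmod. apply exp_pos.
  - intros x t Hx. assert (H1 : left_half_plane (x, t)) by exact Hx.
    destruct (HAD _ H1) as [-> _]. rewrite Cmod_mult, Hmod.
    assert (H := Hbloch _ (Cexp_in_disk _ H1)). rewrite Hmod in H.
    replace ((exp (- x) - exp x) * (Cmod (C_derive Fa (Cexp (x, t))) * exp x))
      with ((exp (- x) * exp x - exp x ^ 2) * Cmod (C_derive Fa (Cexp (x, t)))) by ring.
    rewrite Hexp. exact H.
  - intros x t Hx. assert (H1 : left_half_plane (x, t)) by exact Hx.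
    destruct (HAD _ H1) as [-> ->].
    assert (H := proj2 (Hgrad _ (Cexp_in_disk _ H1))).
    set (z := Cexp (x, t)) in *. assert (Hz : Cmod z = exp x) by apply Hmod.
    assert (Hzc := Cmod2_conj z). rewrite Hz in H, Hzc.
    set (F1 := C_derive Fa z) in *. set (F2 := C_derive (C_derive Fa) z) in *.
    replace ((exp (- x) - exp x)%R * (F2 * z * z + F1 * z) - (exp (- x) + exp x)%R * (F1 * z))%C
      with (exp (- x) * (z * z) * ((1 - exp x ^ 2)%R * F2 - 2 * Cconj z * F1))%C.
    + rewrite !Cmod_mult, Cmod_R, Hz, Rabs_pos_eq by (left; apply exp_pos).
      replace (exp (- x) * (exp x * exp x)) with (exp (- x) * exp x * exp x) by ring.
      rewrite Hexp. assert (He := exp_pos x). nra.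
    + assert (Hc1 : (exp (- x) * exp x)%C = 1) by (rewrite <- RtoC_mult, Hexp; reflexivity).
      assert (Hc2 : (exp x * exp x)%C = (z * Cconj z)%C).
      { rewrite <- Hzc, <- RtoC_mult. f_equal. ring. }
      rewrite !RtoC_minus, RtoC_plus. replace (RtoC (exp x ^ 2)) with (exp x * exp x)%C
        by (rewrite <- RtoC_mult; f_equal; ring).
      transitivity (exp (- x) * (z * z) * F2 - exp (-x) * exp x * exp x * (z * z) * F2
        - 2 * exp (- x) * z * (z * Cconj z) * F1)%C; [ ring | ].
      rewrite <- Hc2, Hc1.
      transitivity (exp (- x) * (z * z) * F2 - exp x * (z * z) * F2
        - 2 * (exp (- x) * exp x) * exp x * z * F1)%C; [ ring | ].
      rewrite Hc1. ring.
  - exact Hs0.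
  - intros x t Hx. apply Hlim, Hx.
Qed.

Lemma circle_path_derive (r t : R) :
  is_path_derive (fun s => r * cis s)%C t (r * (Ci * cis t))%C.
Proof. apply is_path_derive_scal, is_path_derive_cis. Qed.

Lemma circle_in_disk (r t : R) : 0 <= r < 1 -> in_disk (r * cis t)%C.
Proof.
  intros Hr. unfold in_disk. rewrite Cmod_mult, Cmod_R, Cmod_cis, Rabs_pos_eq by lra. lra.
Qed.

Lemma continuous_path_circle (F : C -> C) (r t : R) : holomorphic in_disk F -> 0 <= r < 1 ->
  continuous_path (fun s => F (r * cis s)%C) t.
Proof.
  intros HF Hr. eapply is_path_derive_continuous.
  apply (is_path_derive_comp F (fun s => r * cis s)%C); [ | apply circle_path_derive ].
  apply (holomorphic_derive in_disk); [ exact HF | apply circle_in_disk, Hr ].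
Qed.

Lemma continuous_sqr (f : R -> R) (t : R) : continuous f t -> continuous (fun s => f s ^ 2) t.
Proof.
  intros Hf. apply (continuous_ext (fun s => f s * f s)); [ intros; simpl; ring | ].
  exact (continuous_mult f f t Hf Hf).
Qed.

(** Since [Re f = Re (h + g)] and [Im f = Im (h - g)], the oscillation of [f]
    is dominated by those of the two rotations [h + g] and [h - g]. *)
Theorem class_B_BMOH (f : C -> C) : class_B 1 f -> BMOH f.
Proof.
  intros HB. assert (HPI := PI_RGT_0).
  destruct (class_B_pre_Schwarzian 1 f HB) as (h & g & Hd & HS).
  split; [ apply (canonical_decomposition_harmonic f h g Hd) | ].
  destruct Hd as (Hh & Hg & Hf & _).
  set (F0 := fun z => (h z + cis 0 * g z)%C). set (F1 := fun z => (h z + cis PI * g z)%C).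
  assert (HS0 : pre_Schwarzian_le 1 F0) by (apply HS; lra).
  assert (HS1 : pre_Schwarzian_le 1 F1) by (apply HS; lra).
  destruct (pre_Schwarzian_mean_oscillation F0 HS0) as [M0 HM0].
  destruct (pre_Schwarzian_mean_oscillation F1 HS1) as [M1 HM1].
  exists (/ (2 * PI) * (M0 + M1)). intros a r Ha Hr.
  assert (Hr0 : 0 <= r < 1) by lra.
  apply Rmult_le_compat_l; [ left; apply Rinv_0_lt_compat; lra | ].
  assert (Hln : ln r < 0) by (rewrite <- ln_1; apply ln_increasing; lra).
  specialize (HM0 a (ln r) Ha Hln). specialize (HM1 a (ln r) Ha Hln).
  assert (HC : forall t, Cexp (ln r, t) = (r * cis t)%C)
    by (intros t; unfold Cexp; simpl; rewrite exp_ln by lra; reflexivity).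
  assert (Hin : forall t, in_disk (disk_automorphism a (r * cis t)%C))
    by (intros t; apply disk_automorphism_in_disk; [ exact Ha | apply circle_in_disk, Hr0 ]).
  assert (CF : forall F, pre_Schwarzian_le 1 F -> forall t,
    continuous (fun s => Re (F (disk_automorphism a (r * cis s)) - F a)%C ^ 2) t /\
    continuous (fun s => Im (F (disk_automorphism a (r * cis s)) - F a)%C ^ 2) t).
  { intros F [HF _] t.
    assert (Cp : continuous_path (fun s => F (disk_automorphism a (r * cis s)) + - F a)%C t).
    { apply continuous_path_plus.
      - apply (continuous_path_circle (fun z => F (disk_automorphism a z))); [ | exact Hr0 ].
        apply (C_derive_comp_automorphism F a HF Ha).
      - exact (is_path_derive_continuous _ _ _ (is_path_derive_const _ _)). }
    destruct Cp as [Cp1 Cp2]. split; [ exact (continuous_sqr _ _ Cp1) | exact (continuous_sqr _ _ Cp2) ]. }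
  assert (EX : forall u v : R -> R, (forall t, continuous u t) -> (forall t, continuous v t) ->
    ex_RInt (fun t => u t + v t) 0 (2 * PI)).
  { intros u v Hu Hv. apply (@ex_RInt_continuous R_CompleteNormedModule). intros t _.
    exact (continuous_plus u v t (Hu t) (Hv t)). }
  assert (E : forall t, Cmod (f (disk_automorphism a (r * cis t)) - f a)%C ^ 2 =
    Re (F0 (disk_automorphism a (r * cis t)) - F0 a)%C ^ 2 +
    Im (F1 (disk_automorphism a (r * cis t)) - F1 a)%C ^ 2).
  { intros t. rewrite Cmod_sqr, !Hf by (exact Ha || apply Hin). unfold F0, F1. rewrite cis_0, cis_PI.
    unfold Re, Im; simpl; ring. }
  assert (E0 : forall F, RInt (fun t => Cmod (F (disk_automorphism a (Cexp (ln r, t))) - F a)%C ^ 2) 0 (2 * PI) =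
    RInt (fun t => Cmod (F (disk_automorphism a (r * cis t)) - F a)%C ^ 2) 0 (2 * PI))
    by (intros F; apply RInt_ext; intros t _; rewrite HC; reflexivity).
  rewrite E0 in HM0, HM1.
  assert (EF : forall F, pre_Schwarzian_le 1 F ->
    ex_RInt (fun t => Cmod (F (disk_automorphism a (r * cis t)) - F a)%C ^ 2) 0 (2 * PI)).
  { intros F HF.
    apply (ex_RInt_ext (fun t => Re (F (disk_automorphism a (r * cis t)) - F a)%C ^ 2 +
      Im (F (disk_automorphism a (r * cis t)) - F a)%C ^ 2)); [ intros t _; symmetry; apply Cmod_sqr | ].
    exact (EX _ _ (fun t => proj1 (CF F HF t)) (fun t => proj2 (CF F HF t))). }
  apply Rle_trans with (RInt (fun t => Cmod (F0 (disk_automorphism a (r * cis t)) - F0 a)%C ^ 2) 0 (2 * PI) +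
    RInt (fun t => Cmod (F1 (disk_automorphism a (r * cis t)) - F1 a)%C ^ 2) 0 (2 * PI)); [ | lra ].
  apply Rle_trans with (RInt (fun t => Cmod (F0 (disk_automorphism a (r * cis t)) - F0 a)%C ^ 2 +
    Cmod (F1 (disk_automorphism a (r * cis t)) - F1 a)%C ^ 2) 0 (2 * PI)).
  - apply RInt_le; [ lra | | | ].
    + apply (ex_RInt_ext (fun t => Re (F0 (disk_automorphism a (r * cis t)) - F0 a)%C ^ 2 +
        Im (F1 (disk_automorphism a (r * cis t)) - F1 a)%C ^ 2)); [ intros t _; symmetry; apply E | ].
      exact (EX _ _ (fun t => proj1 (CF F0 HS0 t)) (fun t => proj2 (CF F1 HS1 t))).
    + apply (ex_RInt_plus (V := R_NormedModule)); apply EF; assumption.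
    + intros t _. rewrite E, !Cmod_sqr.
      assert (H1 := pow2_ge_0 (Im (F0 (disk_automorphism a (r * cis t)) - F0 a))).
      assert (H2 := pow2_ge_0 (Re (F1 (disk_automorphism a (r * cis t)) - F1 a))). lra.
  - right. apply (RInt_plus (V := R_CompleteNormedModule)); apply EF; assumption.
Qed.

(** * Images of small disks under quasiconformal harmonic mappings *)

(** A function that is both holomorphic and antiholomorphic has zero
    derivative; this applies to [h1 - h2 = conj (g2 - g1)]. *)
Lemma canonical_decomposition_derivatives (f h1 g1 h2 g2 : C -> C) (z : C) :
  canonical_decomposition f h1 g1 -> canonical_decomposition f h2 g2 -> in_disk z ->
  C_derive h1 z = C_derive h2 z /\ C_derive g1 z = C_derive g2 z.
Proof.
  intros (Hh1 & Hg1 & Hf1 & _) (Hh2 & Hg2 & Hf2 & _) Hz.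
  assert (Dh1 := holomorphic_derive in_disk h1 z Hh1 Hz).
  assert (Dh2 := holomorphic_derive in_disk h2 z Hh2 Hz).
  assert (Dg1 := holomorphic_derive in_disk g1 z Hg1 Hz).
  assert (Dg2 := holomorphic_derive in_disk g2 z Hg2 Hz).
  assert (Du := is_C_derive_minus _ _ _ _ _ Dh1 Dh2).
  assert (Dv := is_C_derive_minus _ _ _ _ _ Dg2 Dg1).
  destruct z as [x y].
  destruct (is_C_derive_differentiable _ _ _ _ Du) as [U1 U2].
  destruct (is_C_derive_differentiable _ _ _ _ Dv) as [V1 V2].
  destruct (open_C_locally_2d in_disk x y open_disk Hz) as [del Hdel].
  assert (E : forall u v, Rabs (u - x) < del -> Rabs (v - y) < del ->
    (h1 (u, v) - h2 (u, v))%C = Cconj (g2 (u, v) - g1 (u, v))).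
  { intros u v Hu Hv. assert (Huv := Hdel u v Hu Hv).
    assert (E1 := Hf1 _ Huv). rewrite (Hf2 _ Huv) in E1.
    apply (f_equal (fun w => w - Cconj (g1 (u, v)) - h2 (u, v))%C) in E1.
    replace (h1 (u, v) - h2 (u, v))%C with
      (h1 (u, v) + Cconj (g1 (u, v)) - Cconj (g1 (u, v)) - h2 (u, v))%C by ring.
    rewrite <- E1. apply injective_projections; simpl; ring. }
  apply (differentiable_pt_lim_ext _ (fun u v => Re (g2 (u, v) - g1 (u, v))%C)) in U1.
  2: { exists del. intros u v Hu Hv. rewrite E by assumption. reflexivity. }
  apply (differentiable_pt_lim_ext _ (fun u v => - 1 * Im (g2 (u, v) - g1 (u, v))%C + 0 * 0)) in U2.
  2: { exists del. intros u v Hu Hv. rewrite E by assumption. unfold Im; simpl; ring. }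
  assert (V2' := differentiable_pt_lim_lincomb _ (fun _ _ => 0) (- 1) 0 x y _ _ 0 0 V2
    (differentiable_pt_lim_fst (fun _ => 0) x y 0 (@is_derive_const R_AbsRing R_NormedModule 0 x))).
  destruct (differentiable_pt_lim_unique _ _ _ _ _ U1) as [A1 A2].
  destruct (differentiable_pt_lim_unique _ _ _ _ _ V1) as [B1 B2].
  destruct (differentiable_pt_lim_unique _ _ _ _ _ U2) as [A3 A4].
  destruct (differentiable_pt_lim_unique _ _ _ _ _ V2') as [B3 B4].
  rewrite A1 in B1. rewrite A2 in B2. rewrite A3 in B3. rewrite A4 in B4.
  split; apply Ceq_minus; apply injective_projections; unfold Re, Im in *; simpl in *; lra.
Qed.

(** What the area argument uses. The bounds on [h''] and [g''] are half sums and
    half differences of those for [h + g] and [h - g], where [|h' + g'|] and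
    [|h' - g'|] are at most [2 |h'|]. *)
Definition qc_harmonic (lambda k : R) (f h g : C -> C) : Prop :=
  holomorphic in_disk h /\ holomorphic in_disk g /\
  (forall z, in_disk z -> f z = h z + Cconj (g z))%C /\ univalent f /\ f 0 = 0 /\
  forall z, in_disk z -> C_derive h z <> 0 /\
    Cmod (C_derive g z) <= k * Cmod (C_derive h z) /\
    (1 - Cmod z ^ 2) * Cmod (C_derive (C_derive h) z) <= 4 * lambda * Cmod (C_derive h z) /\
    (1 - Cmod z ^ 2) * Cmod (C_derive (C_derive g) z) <= 4 * lambda * Cmod (C_derive h z).

Lemma class_S_qc_qc_harmonic (lambda k : R) (f h g : C -> C) : 0 < lambda -> 0 <= k < 1 ->
  class_S_qc k f -> canonical_decomposition f h g ->
  (forall t, 0 <= t <= 2 * PI -> pre_Schwarzian_le lambda (fun z => h z + cis t * g z)%C) ->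
  qc_harmonic lambda k f h g.
Proof.
  intros Hl Hk [[Hu (h2 & g2 & Hd2 & Hsp)] (h3 & g3 & Hd3 & Hqc)] Hd HS.
  assert (HPI := PI_RGT_0).
  assert (Hd' := Hd). destruct Hd' as (Hh & Hg & Hf & h0 & g0 & _).
  split; [ exact Hh | ]. split; [ exact Hg | ]. split; [ exact Hf | ]. split; [ exact Hu | ].
  split.
  { rewrite Hf by (unfold in_disk; rewrite Cmod_0; lra). rewrite h0, g0.
    apply injective_projections; simpl; ring. }
  intros z Hz.
  destruct (canonical_decomposition_derivatives f h g h2 g2 z Hd Hd2 Hz) as [Eh2 Eg2].
  destruct (canonical_decomposition_derivatives f h g h3 g3 z Hd Hd3 Hz) as [Eh3 Eg3].
  specialize (Hsp z Hz). specialize (Hqc z Hz).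
  rewrite <- Eh2, <- Eg2 in Hsp. rewrite <- Eh3, <- Eg3 in Hqc.
  assert (Hg0 := Cmod_ge_0 (C_derive g z)).
  assert (Hh' : C_derive h z <> 0) by (apply Cmod_gt_0; lra).
  assert (Hk' : Cmod (C_derive g z) <= k * Cmod (C_derive h z)).
  { rewrite Cmod_div in Hqc by exact Hh'.
    replace (Cmod (C_derive g z)) with (Cmod (C_derive g z) / Cmod (C_derive h z) * Cmod (C_derive h z))
      by (field; lra).
    apply Rmult_le_compat_r; lra. }
  split; [ exact Hh' | ]. split; [ exact Hk' | ].
  assert (Hz1 : 0 < 1 - Cmod z ^ 2) by (unfold in_disk in Hz; assert (H := Cmod_ge_0 z); nra).
  assert (B : forall t, 0 <= t <= 2 * PI ->
    Cmod (C_derive (C_derive h) z + cis t * C_derive (C_derive g) z)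
      <= 4 * lambda * Cmod (C_derive h z) / (1 - Cmod z ^ 2)).
  { intros t Ht. destruct (HS t Ht) as [_ Ht2]. destruct (Ht2 z Hz) as [_ H].
    destruct (C_derive_combination h g (cis t) Hh Hg) as [_ HD].
    destruct (HD z Hz) as [E1 E2]. rewrite E1, E2 in H.
    assert (T := Cmod_triangle (C_derive h z) (cis t * C_derive g z)).
    rewrite Cmod_mult, Cmod_cis in T.
    apply Rmult_le_reg_l with (1 - Cmod z ^ 2); [ exact Hz1 | ].
    replace ((1 - Cmod z ^ 2) * (4 * lambda * Cmod (C_derive h z) / (1 - Cmod z ^ 2)))
      with (2 * lambda * (2 * Cmod (C_derive h z))) by (field; lra).
    eapply Rle_trans; [ exact H | ]. apply Rmult_le_compat_l; lra. }
  destruct (Cmod_half_sum (C_derive (C_derive h) z) (C_derive (C_derive g) z)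
    (4 * lambda * Cmod (C_derive h z) / (1 - Cmod z ^ 2))) as [B1 B2].
  - assert (B0 := B 0 ltac:(lra)). rewrite cis_0 in B0.
    replace (1 * C_derive (C_derive g) z)%C with (C_derive (C_derive g) z) in B0 by ring. exact B0.
  - assert (B0 := B PI ltac:(lra)). rewrite cis_PI in B0.
    replace (C_derive (C_derive h) z + - (1) * C_derive (C_derive g) z)%C
      with (C_derive (C_derive h) z - C_derive (C_derive g) z)%C in B0 by ring. exact B0.
  - assert (Q : 4 * lambda * Cmod (C_derive h z) =
      (1 - Cmod z ^ 2) * (4 * lambda * Cmod (C_derive h z) / (1 - Cmod z ^ 2))) by (field; lra).
    rewrite Q. split; apply Rmult_le_compat_l; lra.
Qed.

Lemma segment_in_ball (z0 z1 z2 : C) (rho t : R) : 0 <= t <= 1 ->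
  Cmod (z1 - z0) <= rho -> Cmod (z2 - z0) <= rho -> Cmod (z1 + t * (z2 - z1) - z0) <= rho.
Proof.
  intros Ht H1 H2.
  replace (z1 + t * (z2 - z1) - z0)%C with ((1 - t)%R * (z1 - z0) + t * (z2 - z0))%C
    by (rewrite RtoC_minus; ring).
  eapply Rle_trans; [ apply Cmod_triangle | ].
  rewrite !Cmod_mult, !Cmod_R, !Rabs_pos_eq by lra. nra.
Qed.

Lemma is_path_derive_segment (z1 z2 : C) (t : R) :
  is_path_derive (fun s => z1 + s * (z2 - z1))%C t (z2 - z1)%C.
Proof.
  assert (H := is_path_derive_plus (fun _ => z1) (fun s => s * (z2 - z1))%C t _ _
    (is_path_derive_const z1 t) (is_path_derive_ray (z2 - z1)%C t)).
  replace (0 + (z2 - z1))%C with (z2 - z1)%C in H by ring. exact H.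
Qed.

Lemma mean_value_segment (F : C -> C) (z0 z1 z2 : C) (rho M : R) :
  (forall z, Cmod (z - z0) <= rho -> exists d, is_C_derive F z d /\ Cmod d <= M) ->
  Cmod (z1 - z0) <= rho -> Cmod (z2 - z0) <= rho ->
  Cmod (F z2 - F z1) <= M * Cmod (z2 - z1).
Proof.
  intros HF H1 H2.
  assert (HD : forall z, Cmod (z - z0) <= rho -> is_C_derive F z (C_derive F z) /\ Cmod (C_derive F z) <= M).
  { intros z Hz. destruct (HF z Hz) as [d [Hd HM]].
    replace (C_derive F z) with d by (symmetry; apply is_C_derive_unique, Hd). split; assumption. }
  assert (G := mean_value_Cmod (fun t : R => F (z1 + t * (z2 - z1))%C)
    (fun t : R => C_derive F (z1 + t * (z2 - z1)) * (z2 - z1))%C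
    (fun t => t * (M * Cmod (z2 - z1))) (fun _ => M * Cmod (z2 - z1)) 0 1 ltac:(lra)).
  cbv beta in G.
  replace (z1 + 1 * (z2 - z1))%C with z2 in G by ring.
  replace (z1 + 0 * (z2 - z1))%C with z1 in G by ring.
  replace (M * Cmod (z2 - z1)) with (1 * (M * Cmod (z2 - z1)) - 0 * (M * Cmod (z2 - z1))) by ring.
  apply G.
  - intros t Ht. apply (is_path_derive_comp F (fun t : R => z1 + t * (z2 - z1))%C);
      [ apply HD, segment_in_ball; assumption | apply is_path_derive_segment ].
  - intros t _. auto_derive; [ exact I | ring ].
  - intros t Ht. rewrite Cmod_mult. apply Rmult_le_compat_r; [ apply Cmod_ge_0 | ].
    apply HD, segment_in_ball; assumption.
Qed.

(** On the disk of radius [c d], where [d = 1 - |z0|], the bound on [h''] reads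
    [|h''| <= (8 lambda / d) |h'|]. By Gronwall [|h'|] grows at most by the factor
    [e <= 3] there, and integrating once more gives an increment of size
    [(24 lambda / d) |h'(z0)|] times the length [c d]. *)
Lemma qc_harmonic_distortion (lambda k c : R) (f h g : C -> C) (z0 z : C) :
  0 < lambda -> 0 < c -> c <= 1 / 8 -> 8 * lambda * c <= 1 ->
  qc_harmonic lambda k f h g -> in_disk z0 -> Cmod (z - z0) <= c * (1 - Cmod z0) ->
  in_disk z /\
  Cmod (C_derive h z - C_derive h z0) <= 24 * lambda * c * Cmod (C_derive h z0) /\
  Cmod (C_derive g z - C_derive g z0) <= 24 * lambda * c * Cmod (C_derive h z0).
Proof.
  intros Hl Hc Hc8 Hlc (Hh & Hg & _ & _ & _ & HD) Hz0 Hz.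
  assert (Hh1 := holomorphic_C_derive _ _ open_disk Hh).
  assert (Hg1 := holomorphic_C_derive _ _ open_disk Hg).
  set (d := 1 - Cmod z0) in *. assert (Hd : 0 < d <= 1).
  { unfold d. unfold in_disk in Hz0. assert (H := Cmod_ge_0 z0). lra. }
  assert (Hcd : c * d <= d / 8) by nra.
  assert (Hball : forall v, Cmod (v - z0) <= c * d -> in_disk v /\ d / 2 <= 1 - Cmod v ^ 2).
  { intros v Hv. assert (T := Cmod_triangle (v - z0) z0).
    replace (v - z0 + z0)%C with v in T by ring. assert (H := Cmod_ge_0 v).
    assert (Hv1 : Cmod v <= 1 - d / 2) by (unfold d in *; lra).
    unfold in_disk. split; [ lra | nra ]. }
  assert (Hzz : Cmod (z0 - z0) <= c * d) by (replace (z0 - z0)%C with (RtoC 0) by ring; rewrite Cmod_0; nra).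
  assert (Hgr : forall v, Cmod (v - z0) <= c * d -> Cmod (C_derive h v) <= 3 * Cmod (C_derive h z0)).
  { intros v Hv.
    assert (Hlen := Cmod_ge_0 (v - z0)).
    assert (G := gronwall_Cmod (fun t : R => C_derive h (z0 + t * (v - z0))%C)
      (fun t : R => C_derive (C_derive h) (z0 + t * (v - z0)) * (v - z0))%C
      (fun t => t * (8 * lambda / d * Cmod (v - z0))) (fun _ => 8 * lambda / d * Cmod (v - z0)) 0 1 ltac:(lra)).
    cbv beta in G.
    replace (z0 + 1 * (v - z0))%C with v in G by ring.
    replace (z0 + 0 * (v - z0))%C with z0 in G by ring.
    apply Rle_trans with (Cmod (C_derive h z0) * exp 1).
    - eapply Rle_trans; [ apply G | ].
      + intros t Ht. apply (is_path_derive_comp (C_derive h) (fun t : R => z0 + t * (v - z0))%C);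
          [ | apply is_path_derive_segment ].
        apply (holomorphic_derive in_disk); [ exact Hh1 | ].
        apply Hball, segment_in_ball; assumption.
      + intros t _. auto_derive; [ exact I | ring ].
      + intros t Ht.
        destruct (Hball _ (segment_in_ball z0 z0 v (c * d) t Ht Hzz Hv)) as [Hin Hb].
        destruct (HD _ Hin) as (_ & _ & B & _).
        rewrite Cmod_mult. set (w := (z0 + t * (v - z0))%C) in *.
        assert (P := Cmod_ge_0 (C_derive (C_derive h) w)).
        assert (B' : Cmod (C_derive (C_derive h) w) <= 8 * lambda / d * Cmod (C_derive h w)).
        { apply Rmult_le_reg_l with (d / 2); [ lra | ].
          replace (d / 2 * (8 * lambda / d * Cmod (C_derive h w)))
            with (4 * lambda * Cmod (C_derive h w)) by (field; lra).
          eapply Rle_trans; [ | exact B ]. apply Rmult_le_compat_r; assumption. }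
        rewrite (Rmult_comm (8 * lambda / d)), Rmult_assoc, Rmult_comm.
        apply Rmult_le_compat_l; [ exact Hlen | exact B' ].
      + apply Rmult_le_compat_l; [ apply Cmod_ge_0 | ].
        assert (Hle : 1 * (8 * lambda / d * Cmod (v - z0)) - 0 * (8 * lambda / d * Cmod (v - z0)) <= 1).
        { apply Rle_trans with (8 * lambda / d * (c * d)).
          - rewrite Rmult_1_l, Rmult_0_l, Rminus_0_r. apply Rmult_le_compat_l; [ | exact Hv ].
            left; apply Rdiv_lt_0_compat; lra.
          - replace (8 * lambda / d * (c * d)) with (8 * lambda * c) by (field; lra). exact Hlc. }
        destruct Hle as [Hlt | ->]; [ left; now apply exp_increasing | lra ].
    - assert (E := exp_le_3). assert (P := Cmod_ge_0 (C_derive h z0)). nra. }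
  assert (Hsec : forall v, Cmod (v - z0) <= c * d ->
    Cmod (C_derive (C_derive h) v) <= 24 * lambda / d * Cmod (C_derive h z0) /\
    Cmod (C_derive (C_derive g) v) <= 24 * lambda / d * Cmod (C_derive h z0)).
  { intros v Hv. destruct (Hball v Hv) as [Hin Hb]. destruct (HD v Hin) as (_ & _ & B1 & B2).
    assert (Q : 4 * lambda * Cmod (C_derive h v) <= d / 2 * (24 * lambda / d * Cmod (C_derive h z0))).
    { replace (d / 2 * (24 * lambda / d * Cmod (C_derive h z0)))
        with (4 * lambda * (3 * Cmod (C_derive h z0))) by (field; lra).
      apply Rmult_le_compat_l; [ lra | apply Hgr, Hv ]. }
    assert (P1 := Cmod_ge_0 (C_derive (C_derive h) v)). assert (P2 := Cmod_ge_0 (C_derive (C_derive g) v)).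
    split; apply Rmult_le_reg_l with (d / 2); try lra;
      (eapply Rle_trans; [ | exact Q ]);
      [ eapply Rle_trans; [ | exact B1 ] | eapply Rle_trans; [ | exact B2 ] ];
      apply Rmult_le_compat_r; assumption. }
  split; [ apply Hball, Hz | ].
  assert (Hfin : 24 * lambda / d * Cmod (C_derive h z0) * Cmod (z - z0) <=
                 24 * lambda * c * Cmod (C_derive h z0)).
  { assert (P := Cmod_ge_0 (C_derive h z0)).
    replace (24 * lambda * c * Cmod (C_derive h z0))
      with (24 * lambda / d * Cmod (C_derive h z0) * (c * d)) by (field; lra).
    apply Rmult_le_compat_l; [ | exact Hz ].
    apply Rmult_le_pos; [ left; apply Rdiv_lt_0_compat; lra | exact P ]. }
  split; (eapply Rle_trans; [ | exact Hfin ]).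
  - apply (mean_value_segment (C_derive h) z0 z0 z (c * d)); [ | exact Hzz | exact Hz ].
    intros v Hv. exists (C_derive (C_derive h) v).
    exact (conj (holomorphic_derive in_disk _ v Hh1 (proj1 (Hball v Hv))) (proj1 (Hsec v Hv))).
  - apply (mean_value_segment (C_derive g) z0 z0 z (c * d)); [ | exact Hzz | exact Hz ].
    intros v Hv. exists (C_derive (C_derive g) v).
    exact (conj (holomorphic_derive in_disk _ v Hg1 (proj1 (Hball v Hv))) (proj2 (Hsec v Hv))).
Qed.

Lemma geometric_cauchy_R (x : nat -> R) (d : R) : 0 <= d ->
  (forall n, Rabs (x (S n) - x n) <= d / 2 ^ n) ->
  exists l, forall n, Rabs (l - x n) <= 2 * d / 2 ^ n.
Proof.
  intros Hd H.
  assert (Hp : forall n, 0 < 2 ^ n) by (intros; apply pow_lt; lra).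
  assert (Hh : forall n, 2 * d / 2 ^ S n = d / 2 ^ n) by (intros n; specialize (Hp n); simpl; field; lra).
  assert (H2 : forall n, 2 * d / 2 ^ n = d / 2 ^ n + d / 2 ^ n) by (intros n; specialize (Hp n); field; lra).
  destruct (nested_intervals (fun n => x n - 2 * d / 2 ^ n) (fun n => x n + 2 * d / 2 ^ n)) as [l Hl].
  - intros n. rewrite Hh, H2. specialize (H n). apply Rabs_le_between in H. lra.
  - intros n. rewrite Hh, H2. specialize (H n). apply Rabs_le_between in H. lra.
  - intros n. specialize (Hp n). assert (0 <= 2 * d / 2 ^ n) by (apply Rdiv_le_0_compat; lra). lra.
  - exists l. intros n. specialize (Hl n). apply Rabs_le. lra.
Qed.

Lemma geometric_cauchy_C (z : nat -> C) (d : R) : 0 <= d ->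
  (forall n, Cmod (z (S n) - z n) <= d / 2 ^ n) ->
  exists l, forall n, Cmod (l - z n) <= 4 * d / 2 ^ n.
Proof.
  intros Hd H.
  destruct (geometric_cauchy_R (fun n => Re (z n)) d Hd) as [a Ha].
  { intros n. eapply Rle_trans; [ | apply H ]. eapply Rle_trans; [ | apply Re_le_Cmod ].
    right. f_equal. }
  destruct (geometric_cauchy_R (fun n => Im (z n)) d Hd) as [b Hb].
  { intros n. eapply Rle_trans; [ | apply H ]. eapply Rle_trans; [ | apply Im_le_Cmod ].
    right. f_equal. }
  exists (a, b). intros n. eapply Rle_trans; [ apply Cmod_le_Rabs | ].
  specialize (Ha n). specialize (Hb n).
  replace (Re ((a, b) - z n)%C) with (a - Re (z n)) by (unfold Re; simpl; ring).
  replace (Im ((a, b) - z n)%C) with (b - Im (z n)) by (unfold Im; simpl; ring).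
  replace (4 * d / 2 ^ n) with (2 * d / 2 ^ n + 2 * d / 2 ^ n)
    by (field; apply pow_nonzero; lra). lra.
Qed.

Lemma pow2_small (K e : R) : 0 <= K -> 0 < e -> exists n : nat, K / 2 ^ n <= e.
Proof.
  intros HK He.
  destruct (archimed_cor1 (e / (K + 1))) as (N & HN & HN0); [ apply Rdiv_lt_0_compat; lra | ].
  exists N. assert (HN1 : 0 < INR N) by (apply lt_0_INR; exact HN0).
  assert (HN2 : INR N <= 2 ^ N).
  { clear. induction N as [|N IH]; [ simpl; lra | ].
    rewrite S_INR. simpl. assert (1 <= 2 ^ N) by (apply pow_R1_Rle; lra). lra. }
  assert (Hinv : / 2 ^ N <= / INR N) by (apply Rinv_le_contravar; assumption).
  unfold Rdiv. apply Rle_trans with ((K + 1) * (e / (K + 1))).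
  - apply Rmult_le_compat; [ exact HK | left; apply Rinv_0_lt_compat, pow_lt; lra | lra | lra ].
  - right; field; lra.
Qed.

Lemma contraction_fixed_point (T : C -> C) (z0 : C) (rho : R) : 0 <= rho ->
  (forall z w, Cmod (z - z0) <= rho -> Cmod (w - z0) <= rho ->
     Cmod (T z - T w) <= 1 / 2 * Cmod (z - w)) ->
  Cmod (T z0 - z0) <= rho / 2 ->
  exists z, Cmod (z - z0) <= rho /\ T z = z.
Proof.
  intros Hrho HT H0.
  set (z := fix z n := match n with O => z0 | S m => T (z m) end).
  assert (Hp : forall n, 0 < 2 ^ n) by (intros; apply pow_lt; lra).
  assert (Hz00 : Cmod (z0 - z0) = 0) by (replace (z0 - z0)%C with (RtoC 0) by ring; apply Cmod_0).
  assert (Inv : forall n, Cmod (z n - z0) <= rho - rho / 2 ^ n /\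
    Cmod (z (S n) - z n) <= rho / 2 / 2 ^ n).
  { induction n as [|n [I1 I2]].
    - simpl. rewrite Hz00. split; [ lra | ].
      replace (rho / 2 / 1) with (rho / 2) by field. exact H0.
    - assert (Hpn := Hp n).
      assert (Hn : 0 <= rho / 2 ^ n) by (apply Rdiv_le_0_compat; lra).
      assert (E1 : rho / 2 / 2 ^ n = rho / 2 ^ n / 2) by (field; lra).
      assert (E2 : rho / 2 ^ S n = rho / 2 ^ n / 2) by (simpl; field; lra).
      assert (E3 : rho / 2 / 2 ^ S n = rho / 2 ^ n / 4) by (simpl; field; lra).
      assert (J1 : Cmod (z (S n) - z0) <= rho - rho / 2 ^ S n).
      { replace (z (S n) - z0)%C with ((z (S n) - z n) + (z n - z0))%C by ring.
        eapply Rle_trans; [ apply Cmod_triangle | ]. lra. }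
      split; [ exact J1 | ].
      change (z (S (S n))) with (T (z (S n))). change (z (S n)) with (T (z n)) at 2.
      eapply Rle_trans; [ apply HT; lra | ]. lra. }
  destruct (geometric_cauchy_C z (rho / 2) ltac:(lra)) as [l Hl]; [ intros n; apply Inv | ].
  assert (Hlim : Cmod (l - z0) <= rho).
  { apply Rnot_lt_le. intros Hlt.
    destruct (pow2_small (4 * (rho / 2)) ((Cmod (l - z0) - rho) / 2) ltac:(lra) ltac:(lra)) as [n Hn].
    assert (T1 := Cmod_triangle (l - z n) (z n - z0)).
    replace (l - z n + (z n - z0))%C with (l - z0)%C in T1 by ring.
    assert (L := Hl n). destruct (Inv n) as [I1 _].
    assert (0 <= rho / 2 ^ n) by (apply Rdiv_le_0_compat; [ lra | apply Hp ]). lra. }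
  exists l. split; [ exact Hlim | ].
  apply eq_of_Cmod_le. intros e He.
  destruct (pow2_small (8 * (rho / 2)) e ltac:(lra) He) as [n Hn].
  assert (L1 := Hl n). assert (L2 := Hl (S n)). destruct (Inv n) as [I1 _].
  assert (Hpn := Hp n).
  assert (Hn0 : 0 <= rho / 2 ^ n) by (apply Rdiv_le_0_compat; lra).
  assert (D := HT l (z n) Hlim ltac:(lra)).
  change (T (z n)) with (z (S n)) in D.
  assert (T1 := Cmod_triangle (T l - z (S n)) (- (l - z (S n)))).
  replace (T l - z (S n) + - (l - z (S n)))%C with (T l - l)%C in T1 by ring.
  rewrite Cmod_opp in T1.
  replace (4 * (rho / 2) / 2 ^ S n) with (4 * (rho / 2) / 2 ^ n / 2) in L2 by (simpl; field; lra).
  replace (8 * (rho / 2) / 2 ^ n) with (2 * (4 * (rho / 2) / 2 ^ n)) in Hn by (field; lra).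
  lra.
Qed.

(** The differential of [h + conj g] at a point where [h' = a] and [g' = b]. *)
Definition real_linear (a b v : C) : C := (a * v + Cconj (b * v))%C.

Lemma real_linear_minus (a b u v : C) :
  real_linear a b (u - v) = (real_linear a b u - real_linear a b v)%C.
Proof. unfold real_linear. apply injective_projections; simpl; ring. Qed.

Lemma real_linear_lower (a b v : C) (k : R) : Cmod b <= k * Cmod a ->
  (1 - k) * Cmod a * Cmod v <= Cmod (real_linear a b v).
Proof.
  intros Hb. unfold real_linear.
  assert (T := Cmod_triangle_inv (a * v) (- Cconj (b * v))).
  rewrite Cmod_opp, Cmod_Cconj, !Cmod_mult in T.
  replace (a * v - - Cconj (b * v))%C with (a * v + Cconj (b * v))%C in T by ring.
  assert (Hv := Cmod_ge_0 v).
  assert (Cmod b * Cmod v <= k * Cmod a * Cmod v) by (apply Rmult_le_compat_r; assumption). lra.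
Qed.

Definition real_linear_inv (a b u : C) : C :=
  ((Cconj a * u - Cconj b * Cconj u) * / (a * Cconj a - b * Cconj b))%C.

Lemma real_linear_invK (a b u : C) (k : R) : k < 1 -> a <> 0 -> Cmod b <= k * Cmod a ->
  real_linear a b (real_linear_inv a b u) = u.
Proof.
  intros Hk Ha Hb.
  assert (Hab : (a * Cconj a - b * Cconj b)%C <> 0).
  { rewrite <- !Cmod2_conj, <- RtoC_minus. intros E. apply RtoC_inj in E.
    apply Cmod_gt_0 in Ha. assert (H := Cmod_ge_0 b).
    assert (Cmod b < Cmod a) by nra. nra. }
  unfold real_linear, real_linear_inv.
  assert (Hc : Cconj (a * Cconj a - b * Cconj b) = (a * Cconj a - b * Cconj b)%C).
  { unfold Cminus. rewrite Cconj_plus, Cconj_mult, Cconj_conj.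
    replace (Cconj (- (b * Cconj b))) with (- (Cconj b * b))%C;
      [ ring | apply injective_projections; simpl; ring ]. }
  rewrite !Cconj_mult, Cconj_inv, Hc by exact Hab.
  replace (Cconj (Cconj a * u - Cconj b * Cconj u)) with (a * Cconj u - b * u)%C
    by (apply injective_projections; simpl; ring).
  field. exact Hab.
Qed.

(** [8 lambda c <= 1] bounds the growth of [|h'|] on the disk of radius
    [c (1 - |z0|)]. [96 lambda c <= 1 - k] makes the deviation of [f] from its
    differential, [2 * 24 lambda c |h'(z0)|] in Lipschitz norm, at most half of the
    lower bound [(1 - k) |h'(z0)|] of the differential. *)
Definition admissible_radius (lambda k c : R) : Prop :=
  0 < lambda /\ 0 <= k < 1 /\ 0 < c /\ c <= 1 / 8 /\ 8 * lambda * c <= 1 /\ 96 * lambda * c <= 1 - k.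

Lemma admissible_radius_exists (lambda k : R) : 0 < lambda -> 0 <= k < 1 ->
  exists c, admissible_radius lambda k c.
Proof.
  intros Hl Hk. exists (Rmin (1 / 8) ((1 - k) / (96 * lambda))).
  assert (H1 := Rmin_l (1 / 8) ((1 - k) / (96 * lambda))).
  assert (H2 := Rmin_r (1 / 8) ((1 - k) / (96 * lambda))).
  set (c := Rmin (1 / 8) ((1 - k) / (96 * lambda))) in *.
  assert (Hc : 0 < c) by (apply Rmin_glb_lt; [ lra | apply Rdiv_lt_0_compat; lra ]).
  assert (H3 : 96 * lambda * c <= 1 - k).
  { replace (1 - k) with (96 * lambda * ((1 - k) / (96 * lambda))) by (field; lra).
    apply Rmult_le_compat_l; lra. }
  unfold admissible_radius. assert (0 < lambda * c) by nra. repeat split; lra.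
Qed.

(** On the disk of radius [c (1 - |z0|)] the map is so close to its differential
    that Newton's iteration with the differential at [z0] held fixed contracts;
    its fixed point solves [f z = w]. *)
Lemma qc_harmonic_covering (lambda k c : R) (f h g : C -> C) (z0 w : C) (rho : R) :
  admissible_radius lambda k c -> qc_harmonic lambda k f h g -> in_disk z0 ->
  0 <= rho <= c * (1 - Cmod z0) ->
  Cmod (w - f z0) <= (1 - k) / 2 * Cmod (C_derive h z0) * rho ->
  exists z, in_disk z /\ Cmod (z - z0) <= rho /\ f z = w.
Proof.
  intros (Hl & Hk & Hc & Hc8 & Hlc & Hlk) Hq Hz0 Hrho Hw.
  assert (Hdist := fun z Hz => qc_harmonic_distortion lambda k c f h g z0 z Hl Hc Hc8 Hlc Hq Hz0 Hz).
  destruct Hq as (Hh & Hg & Hf & _ & _ & HD).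
  set (a := C_derive h z0) in *. set (b := C_derive g z0) in *.
  destruct (HD z0 Hz0) as (Ha & Hb & _). fold a b in Ha, Hb.
  assert (Ha0 : 0 < Cmod a) by (apply Cmod_gt_0, Ha).
  assert (Hin : forall z, Cmod (z - z0) <= rho -> in_disk z)
    by (intros z Hz; apply Hdist; lra).
  assert (Hlin : forall z1 z2, Cmod (z1 - z0) <= rho -> Cmod (z2 - z0) <= rho ->
    Cmod (f z2 - f z1 - real_linear a b (z2 - z1)) <= (1 - k) / 2 * Cmod a * Cmod (z2 - z1)).
  { intros z1 z2 H1 H2.
    assert (Aff : forall (F : C -> C) (d z : C), holomorphic in_disk F -> in_disk z ->
      is_C_derive (fun v => F v - d * v)%C z (C_derive F z - d)%C).
    { intros F d z HF Hz. eapply is_C_derive_eq.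
      - apply is_C_derive_minus; [ exact (holomorphic_derive in_disk F z HF Hz) | ].
        apply is_C_derive_scal, is_C_derive_id.
      - ring. }
    assert (M1 := mean_value_segment (fun v => h v - a * v)%C z0 z1 z2 rho (24 * lambda * c * Cmod a)).
    assert (M2 := mean_value_segment (fun v => g v - b * v)%C z0 z1 z2 rho (24 * lambda * c * Cmod a)).
    assert (B1 : Cmod ((h z2 - a * z2) - (h z1 - a * z1)) <= 24 * lambda * c * Cmod a * Cmod (z2 - z1)).
    { apply M1; try assumption. intros z Hz. exists (C_derive h z - a)%C.
      split; [ apply Aff; [ exact Hh | apply Hin, Hz ] | exact (proj1 (proj2 (Hdist z (Rle_trans _ _ _ Hz (proj2 Hrho))))) ]. }
    assert (B2 : Cmod ((g z2 - b * z2) - (g z1 - b * z1)) <= 24 * lambda * c * Cmod a * Cmod (z2 - z1)).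
    { apply M2; try assumption. intros z Hz. exists (C_derive g z - b)%C.
      split; [ apply Aff; [ exact Hg | apply Hin, Hz ] | exact (proj2 (proj2 (Hdist z (Rle_trans _ _ _ Hz (proj2 Hrho))))) ]. }
    rewrite !Hf by (apply Hin; assumption).
    replace (h z2 + Cconj (g z2) - (h z1 + Cconj (g z1)) - real_linear a b (z2 - z1))%C
      with (((h z2 - a * z2) - (h z1 - a * z1)) + Cconj ((g z2 - b * z2) - (g z1 - b * z1)))%C
      by (unfold real_linear; apply injective_projections; simpl; ring).
    eapply Rle_trans; [ apply Cmod_triangle | ]. rewrite Cmod_Cconj.
    assert (P := Cmod_ge_0 (z2 - z1)).
    assert (Q : 0 <= Cmod a * Cmod (z2 - z1)) by (apply Rmult_le_pos; lra). nra. }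
  set (T := fun z => (z - real_linear_inv a b (f z - w))%C).
  assert (HLinv : forall u, real_linear a b (real_linear_inv a b u) = u)
    by (intros u; apply real_linear_invK with k; [ lra | exact Ha | exact Hb ]).
  assert (Hz00 : Cmod (z0 - z0) <= rho) by (replace (z0 - z0)%C with (RtoC 0) by ring; rewrite Cmod_0; lra).
  destruct (contraction_fixed_point T z0 rho) as [z [Hz HT]]; [ lra | | | ].
  - intros z1 z2 H1 H2.
    assert (Lo := real_linear_lower a b (T z1 - T z2) k Hb).
    replace (real_linear a b (T z1 - T z2)) with (real_linear a b (z1 - z2
        - (real_linear_inv a b (f z1 - w) - real_linear_inv a b (f z2 - w))))%C in Lo
      by (f_equal; unfold T; ring).
    rewrite !real_linear_minus, !HLinv, <- real_linear_minus in Lo.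
    assert (Up := Hlin z2 z1 H2 H1).
    replace (real_linear a b (z1 - z2) - (f z1 - w - (f z2 - w)))%C
      with (- (f z1 - f z2 - real_linear a b (z1 - z2)))%C in Lo by ring.
    rewrite Cmod_opp in Lo.
    apply Rmult_le_reg_l with ((1 - k) * Cmod a); [ apply Rmult_lt_0_compat; lra | lra ].
  - assert (Lo := real_linear_lower a b (T z0 - z0) k Hb).
    replace (real_linear a b (T z0 - z0))
      with (real_linear a b (z0 - z0 - real_linear_inv a b (f z0 - w)))%C in Lo
      by (f_equal; unfold T; ring).
    rewrite !real_linear_minus, HLinv in Lo.
    replace (real_linear a b z0 - real_linear a b z0 - (f z0 - w))%C with (w - f z0)%C in Lo by ring.
    apply Rmult_le_reg_l with ((1 - k) * Cmod a); [ apply Rmult_lt_0_compat; lra | lra ].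
  - exists z. split; [ apply Hin, Hz | ]. split; [ exact Hz | ].
    assert (E : real_linear_inv a b (f z - w) = 0).
    { unfold T in HT. replace (real_linear_inv a b (f z - w)) with (z - (z - real_linear_inv a b (f z - w)))%C by ring.
      rewrite HT. ring. }
    apply Ceq_minus. rewrite <- (HLinv (f z - w)%C), E. unfold real_linear.
    apply injective_projections; simpl; ring.
Qed.

(** If [f z1] were closer to [f z0], it would also be the value of [f] at a point of
    the disk of radius [c (1 - |z0|)], against univalence. *)
Lemma qc_harmonic_separation (lambda k c : R) (f h g : C -> C) (z0 z1 : C) :
  admissible_radius lambda k c -> qc_harmonic lambda k f h g -> in_disk z0 -> in_disk z1 ->
  c * (1 - Cmod z0) <= Cmod (z1 - z0) ->
  (1 - k) / 2 * Cmod (C_derive h z0) * (c * (1 - Cmod z0)) <= Cmod (f z1 - f z0).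
Proof.
  intros Hadm Hq Hz0 Hz1 Hfar. apply Rnot_lt_le. intros Hlt.
  assert (Hadm' := Hadm). destruct Hadm' as (_ & Hk & Hc & _).
  assert (Hq' := Hq). destruct Hq' as (_ & _ & _ & Hu & _ & HD).
  assert (Ha0 : 0 < Cmod (C_derive h z0)) by (apply Cmod_gt_0, (HD z0 Hz0)).
  set (m := (1 - k) / 2 * Cmod (C_derive h z0)) in *.
  assert (Hm : 0 < m) by (apply Rmult_lt_0_compat; lra).
  assert (P := Cmod_ge_0 (f z1 - f z0)).
  assert (Hrho : Cmod (f z1 - f z0) / m < c * (1 - Cmod z0)).
  { apply Rmult_lt_reg_l with m; [ exact Hm | ].
    replace (m * (Cmod (f z1 - f z0) / m)) with (Cmod (f z1 - f z0)) by (field; lra). exact Hlt. }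
  assert (Hrho0 : 0 <= Cmod (f z1 - f z0) / m) by (apply Rdiv_le_0_compat; lra).
  destruct (qc_harmonic_covering lambda k c f h g z0 (f z1) (Cmod (f z1 - f z0) / m))
    as (z & Hz & Hzr & E); try assumption; [ lra | | ].
  - fold m. right. field. lra.
  - apply Hu in E; [ | exact Hz | exact Hz1 ]. rewrite E in Hzr. lra.
Qed.

(** * Packing of squares and summation over dyadic layers *)

Fixpoint nsum (n : nat) (f : nat -> R) : R :=
  match n with O => 0 | S m => nsum m f + f m end.

Lemma nsum_le (n : nat) (f g : nat -> R) :
  (forall i, (i < n)%nat -> f i <= g i) -> nsum n f <= nsum n g.
Proof.
  induction n as [|n IH]; intros H; simpl; [ lra | ].
  apply Rplus_le_compat; [ apply IH; intros; apply H; lia | apply H; lia ].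
Qed.

Lemma nsum_ext (n : nat) (f g : nat -> R) :
  (forall i, (i < n)%nat -> f i = g i) -> nsum n f = nsum n g.
Proof.
  induction n as [|n IH]; intros H; simpl; [ reflexivity | ].
  f_equal; [ apply IH; intros; apply H; lia | apply H; lia ].
Qed.

Lemma nsum_scal (n : nat) (c : R) (f : nat -> R) : nsum n (fun i => c * f i) = c * nsum n f.
Proof. induction n as [|n IH]; simpl; [ ring | rewrite IH; ring ]. Qed.

Lemma nsum_plus (n : nat) (f g : nat -> R) : nsum n (fun i => f i + g i) = nsum n f + nsum n g.
Proof. induction n as [|n IH]; simpl; [ ring | rewrite IH; ring ]. Qed.

Lemma is_RInt_nsum (n : nat) (F : nat -> R -> R) (I : nat -> R) (a b : R) :
  (forall i, (i < n)%nat -> is_RInt (F i) a b (I i)) ->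
  is_RInt (fun x => nsum n (fun i => F i x)) a b (nsum n I).
Proof.
  induction n as [|n IH]; intros H; simpl.
  - eapply eq_rect with (P := fun v => is_RInt _ a b v); [ apply (@is_RInt_const R_NormedModule) | ].
    unfold scal; simpl; unfold mult; simpl; ring.
  - apply (is_RInt_plus (V := R_NormedModule)); [ apply IH; intros; apply H; lia | apply H; lia ].
Qed.

Lemma nsum_at_most_one (n : nat) (v : nat -> R) :
  (forall i, (i < n)%nat -> v i = 0 \/ v i = 1) ->
  (forall i j, (i < j < n)%nat -> v i = 1 -> v j = 1 -> False) ->
  nsum n v <= 1.
Proof.
  induction n as [|n IH]; intros H01 H; simpl; [ lra | ].
  destruct (H01 n ltac:(lia)) as [E | E]; rewrite E.
  - assert (nsum n v <= 1) by (apply IH; [ intros; apply H01; lia | intros i j Hij; apply H; lia ]). lra.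
  - assert (Z : nsum n v <= nsum n (fun _ => 0)).
    { apply nsum_le. intros i Hi. destruct (H01 i ltac:(lia)) as [E' | E']; [ lra | ].
      exfalso. apply (H i n); [ lia | assumption | assumption ]. }
    assert (Z0 : nsum n (fun _ => 0) = 0 * nsum n (fun _ => 0)) by (rewrite <- nsum_scal; apply nsum_ext; intros; ring).
    lra.
Qed.

Definition interval_indicator (c b x : R) : R := if Rlt_dec (Rabs (x - c)) b then 1 else 0.

Lemma interval_indicator_01 (c b x : R) : interval_indicator c b x = 0 \/ interval_indicator c b x = 1.
Proof. unfold interval_indicator. destruct Rlt_dec; [ right | left ]; reflexivity. Qed.

Lemma interval_indicator_1 (c b x : R) : interval_indicator c b x = 1 -> Rabs (x - c) < b.
Proof. unfold interval_indicator. destruct Rlt_dec as [H | H]; [ intros _; exact H | lra ]. Qed.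

Lemma is_RInt_indicator (c b S : R) : 0 <= b -> (0 < b -> Rabs c + b <= S) -> 0 <= S ->
  is_RInt (interval_indicator c b) (- S) S (2 * b).
Proof.
  intros Hb HS HS0.
  assert (K : forall v p q, is_RInt (fun _ => v) p q ((q - p) * v))
    by (intros; exact (is_RInt_const (V := R_NormedModule) p q v)).
  assert (Out : forall p q, p <= q -> (forall x, p < x < q -> ~ Rabs (x - c) < b) ->
    is_RInt (interval_indicator c b) p q 0).
  { intros p q Hpq H. apply (is_RInt_ext (fun _ => 0)).
    - rewrite Rmin_left, Rmax_right by exact Hpq. intros x Hx. unfold interval_indicator.
      destruct Rlt_dec as [E | E]; [ exfalso; apply (H x Hx E) | reflexivity ].
    - assert (K0 := K 0 p q). replace ((q - p) * 0) with 0 in K0 by ring. exact K0. }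
  destruct Hb as [Hb | <-].
  - specialize (HS Hb). assert (H1 := Rle_abs c). assert (H2 := Rle_abs (- c)). rewrite Rabs_Ropp in H2.
    assert (Ch : forall p q r' (I J : R), is_RInt (interval_indicator c b) p q I ->
      is_RInt (interval_indicator c b) q r' J -> is_RInt (interval_indicator c b) p r' (I + J))
      by (intros p q r' I J; exact (is_RInt_Chasles (V := R_NormedModule) _ p q r' I J)).
    replace (2 * b) with (0 + ((c + b) - (c - b)) * 1 + 0) by ring.
    apply Ch with (c + b); [ apply Ch with (c - b) | ].
    + apply Out; [ lra | ]. intros x Hx H. apply Rabs_def2 in H. lra.
    + apply (is_RInt_ext (fun _ => 1)); [ | apply K ].
      rewrite Rmin_left, Rmax_right by lra. intros x Hx. unfold interval_indicator.
      destruct Rlt_dec as [E | E]; [ reflexivity | ]. exfalso. apply E. apply Rabs_def1; lra.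
    + apply Out; [ lra | ]. intros x Hx H. apply Rabs_def2 in H. lra.
  - replace (2 * 0) with 0 by ring. apply Out; [ lra | ]. intros x _ H.
    assert (P := Rabs_pos (x - c)). lra.
Qed.

(** The areas of disjoint squares contained in a square: every vertical line
    meets them in disjoint segments of total length at most [2 S], and this is
    integrated over the lines. *)
Lemma square_packing (n : nat) (x y b : nat -> R) (S : R) : 0 <= S ->
  (forall i, (i < n)%nat -> 0 <= b i) ->
  (forall i, (i < n)%nat -> 0 < b i -> Rabs (x i) + b i <= S /\ Rabs (y i) + b i <= S) ->
  (forall i j, (i < j < n)%nat -> 0 < b i -> 0 < b j ->
     b i + b j <= Rabs (x i - x j) \/ b i + b j <= Rabs (y i - y j)) ->
  nsum n (fun i => (2 * b i) ^ 2) <= (2 * S) ^ 2.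
Proof.
  intros HS Hb HbS Hdisj.
  assert (Ix : forall i, (i < n)%nat -> is_RInt (interval_indicator (x i) (b i)) (- S) S (2 * b i)).
  { intros i Hi. apply is_RInt_indicator; [ apply Hb, Hi | intros H; apply (HbS i Hi H) | exact HS ]. }
  assert (Iy : forall i, (i < n)%nat -> is_RInt (interval_indicator (y i) (b i)) (- S) S (2 * b i)).
  { intros i Hi. apply is_RInt_indicator; [ apply Hb, Hi | intros H; apply (HbS i Hi H) | exact HS ]. }
  assert (Const : forall v, is_RInt (fun _ => v) (- S) S (2 * S * v)).
  { intros v. replace (2 * S * v) with ((S - - S) * v) by ring.
    exact (is_RInt_const (V := R_NormedModule) (- S) S v). }
  assert (Scal : forall f k I, is_RInt f (- S) S I -> is_RInt (fun t => k * f t) (- S) S (k * I))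
    by (intros f k I H; exact (is_RInt_scal (V := R_NormedModule) f (- S) S k I H)).
  assert (Line : forall t, nsum n (fun i => interval_indicator (x i) (b i) t * (2 * b i)) <= 2 * S).
  { intros t. replace (2 * S) with (2 * S * 1) by ring.
    apply (is_RInt_le (fun s => nsum n (fun i => interval_indicator (x i) (b i) t * interval_indicator (y i) (b i) s))
      (fun _ => 1) (- S) S); [ lra | | apply Const | ].
    - apply (is_RInt_nsum n (fun i s => interval_indicator (x i) (b i) t * interval_indicator (y i) (b i) s)
        (fun i => interval_indicator (x i) (b i) t * (2 * b i))).
      intros i Hi. apply Scal, Iy, Hi.
    - intros s _. apply nsum_at_most_one.
      + intros i Hi. destruct (interval_indicator_01 (x i) (b i) t) as [-> | ->],
          (interval_indicator_01 (y i) (b i) s) as [-> | ->]; lra.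
      + intros i j Hij Ei Ej.
        assert (Split : forall k, interval_indicator (x k) (b k) t * interval_indicator (y k) (b k) s = 1 ->
          Rabs (t - x k) < b k /\ Rabs (s - y k) < b k).
        { intros k E. destruct (interval_indicator_01 (x k) (b k) t) as [E1 | E1],
            (interval_indicator_01 (y k) (b k) s) as [E2 | E2]; rewrite E1, E2 in E; try lra.
          split; apply interval_indicator_1; assumption. }
        destruct (Split i Ei) as [X1 Y1]. destruct (Split j Ej) as [X2 Y2].
        assert (P1 := Rabs_pos (t - x i)). assert (P2 := Rabs_pos (t - x j)).
        apply Rabs_def2 in X1, X2, Y1, Y2.
        destruct (Hdisj i j Hij ltac:(lra) ltac:(lra)) as [D | D];
          revert D; unfold Rabs; destruct Rcase_abs; intros D; lra. }
  replace (nsum n (fun i => (2 * b i) ^ 2)) with (nsum n (fun i => (2 * b i) * (2 * b i)))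
    by (apply nsum_ext; intros; ring).
  replace ((2 * S) ^ 2) with (2 * S * (2 * S)) by ring.
  apply (is_RInt_le (fun t => nsum n (fun i => (2 * b i) * interval_indicator (x i) (b i) t))
    (fun _ => 2 * S) (- S) S); [ lra | | apply Const | ].
  - apply (is_RInt_nsum n (fun i t => (2 * b i) * interval_indicator (x i) (b i) t) (fun i => (2 * b i) * (2 * b i))).
    intros i Hi. apply Scal, Ix, Hi.
  - intros t _. rewrite (nsum_ext n _ (fun i => interval_indicator (x i) (b i) t * (2 * b i)))
      by (intros; ring). apply Line.
Qed.

Lemma two_thirds_bound (p q m : R) : 0 <= m -> Rabs p < 2 / 3 * m -> Rabs q < 2 / 3 * m ->
  p ^ 2 + q ^ 2 < m ^ 2.
Proof.
  intros Hm Hp Hq. rewrite <- (pow2_abs p), <- (pow2_abs q).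
  assert (P := Rabs_pos p). assert (Q := Rabs_pos q). nra.
Qed.

Definition layer (R0 : nat -> R) (rho : R) (f : nat -> R) (j : nat) : R :=
  if Rle_dec (R0 j) rho then f j else 0.

(** The squares of half-side [a_j / 3] around the points are disjoint: otherwise
    both coordinates of [w_i - w_j] would be less than 2/3 of its modulus, which
    is impossible. Since [a_j <= |w_j|], those with [|w_j| <= rho] lie in the square of
    half-side [2 rho] around 0, and [36 = 9 / 4 * 4^2]. *)
Lemma separated_points_sum (n : nat) (w : nat -> C) (a : nat -> R) (rho : R) :
  0 <= rho ->
  (forall i, (i < n)%nat -> 0 <= a i /\ a i <= Cmod (w i)) ->
  (forall i j, (i < n)%nat -> (j < n)%nat -> i <> j -> a i <= Cmod (w j - w i)) ->
  nsum n (layer (fun j => Cmod (w j)) rho (fun j => a j ^ 2)) <= 36 * rho ^ 2.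
Proof.
  intros Hrho Ha Hsep.
  set (b := layer (fun j => Cmod (w j)) rho (fun j => a j / 3)).
  assert (P := square_packing n (fun i => Re (w i)) (fun i => Im (w i)) b (2 * rho) ltac:(lra)).
  assert (Hmax : nsum n (fun i => (2 * b i) ^ 2) <= (2 * (2 * rho)) ^ 2).
  { apply P; clear P.
    - intros i Hi. unfold b, layer. destruct (Ha i Hi) as [H _]. destruct Rle_dec; lra.
    - intros i Hi. unfold b, layer. destruct (Ha i Hi) as [H1 H2]. destruct Rle_dec as [L | L]; [ | lra ].
      intros _. assert (X : Rabs (Re (w i)) <= Cmod (w i)) by (eapply Rle_trans; [ apply Rmax_l | apply Rmax_Cmod ]).
      assert (Y : Rabs (Im (w i)) <= Cmod (w i)) by (eapply Rle_trans; [ apply Rmax_r | apply Rmax_Cmod ]). lra.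
    - intros i j Hij. unfold b, layer.
      destruct (Ha i ltac:(lia)) as [Ai _]. destruct (Ha j ltac:(lia)) as [Aj _].
      assert (S1 := Hsep i j ltac:(lia) ltac:(lia) ltac:(lia)).
      assert (S2 := Hsep j i ltac:(lia) ltac:(lia) ltac:(lia)).
      destruct Rle_dec as [Li | Li]; [ | intros; lra ]. destruct Rle_dec as [Lj | Lj]; [ | intros; lra ].
      intros Bi Bj.
      destruct (Rle_lt_dec (a i / 3 + a j / 3) (Rabs (Re (w i) - Re (w j)))) as [L | L]; [ now left | right ].
      apply Rnot_lt_le. intros L'.
      assert (Sym : Cmod (w j - w i) = Cmod (w i - w j)).
      { replace (w j - w i)%C with (- (w i - w j))%C by ring. apply Cmod_opp. }
      rewrite Sym in S1.
      set (m := Cmod (w i - w j)) in *.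
      assert (T := two_thirds_bound (Re (w i) - Re (w j)) (Im (w i) - Im (w j)) m
        (Cmod_ge_0 _) ltac:(lra) ltac:(lra)).
      assert (E : m ^ 2 = (Re (w i) - Re (w j)) ^ 2 + (Im (w i) - Im (w j)) ^ 2).
      { unfold m, Cmod. rewrite <- Rsqr_pow2, Rsqr_sqrt.
        - unfold Re, Im; simpl; ring.
        - apply Rplus_le_le_0_compat; apply pow2_ge_0. }
      lra. }
  apply Rle_trans with (9 / 4 * nsum n (fun i => (2 * b i) ^ 2)); [ | nra ].
  rewrite <- nsum_scal. right. apply nsum_ext. intros i _. unfold b, layer. destruct Rle_dec; field.
Qed.

Lemma Rpower_base_le (x a b y : R) : 0 < a -> a <= x <= b -> 1 <= b / a ->
  Rpower x y <= (1 + Rpower (b / a) y) * Rpower a y.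
Proof.
  intros Ha Hx Hba.
  assert (Pa : 0 < Rpower a y) by apply exp_pos.
  assert (Pb : 0 < Rpower (b / a) y) by apply exp_pos.
  destruct (Rle_lt_dec 0 y) as [Hy | Hy].
  - apply Rle_trans with (Rpower b y); [ apply Rle_Rpower_l; lra | ].
    replace b with (b / a * a) at 1 by (field; lra).
    rewrite <- Rpower_mult_distr; [ nra | apply Rdiv_lt_0_compat; lra | exact Ha ].
  - apply Rle_trans with (Rpower a y); [ | nra ].
    unfold Rpower. assert (L : ln a <= ln x).
    { destruct Hx as [[H | ->] _]; [ left; apply ln_increasing; lra | lra ]. }
    assert (L2 : y * ln x <= y * ln a) by nra.
    destruct L2 as [L2 | ->]; [ left; now apply exp_increasing | lra ].
Qed.

(** On the dyadic layer [2^L < R_j <= 2^(L+1)] the weight is comparable to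
    [4^(L (q-1))], and the sum of the [a_j^2] is at most [4 K 4^L]. Since [q > 0], the
    geometric sum of these bounds is dominated by its last term. *)
Lemma layered_sum_dyadic (q K : R) : 0 < q -> 0 <= K -> exists G, 0 <= G /\
  forall (n : nat) (R0 a : nat -> R) (L : nat),
  (forall j, (j < n)%nat -> 0 <= R0 j) ->
  (forall rho, 0 <= rho -> nsum n (layer R0 rho (fun j => a j ^ 2)) <= K * rho ^ 2) ->
  nsum n (layer R0 (2 ^ L) (fun j => a j ^ 2 * Rpower (1 + R0 j ^ 2) (q - 1))) <= G * Rpower (4 ^ L) q.
Proof.
  intros Hq HK.
  set (D := 1 + Rpower 16 (q - 1)). assert (HD : 0 < D) by (unfold D; assert (0 < Rpower 16 (q - 1)) by apply exp_pos; lra).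
  set (X := Rpower 4 q).
  assert (HX : 1 < X).
  { unfold X. rewrite <- (Rpower_O 4) by lra. apply Rpower_lt; lra. }
  exists (D * K + 4 * D * K / (X - 1)).
  assert (HG2 : 0 <= 4 * D * K / (X - 1)).
  { apply Rdiv_le_0_compat; [ | lra ]. apply Rmult_le_pos; lra. }
  assert (HG1 : 0 <= D * K) by (apply Rmult_le_pos; lra).
  split; [ lra | ].
  intros n R0 a L HR HS. induction L as [|L IH].
  - simpl. replace (Rpower 1 q) with 1 by (unfold Rpower; rewrite ln_1, Rmult_0_r, exp_0; reflexivity).
    apply Rle_trans with (D * nsum n (layer R0 1 (fun j => a j ^ 2))).
    + rewrite <- nsum_scal. apply nsum_le. intros j Hj. unfold layer. destruct Rle_dec as [E | E]; [ | lra ].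
      rewrite (Rmult_comm D). apply Rmult_le_compat_l; [ apply pow2_ge_0 | ].
      specialize (HR j Hj).
      eapply Rle_trans; [ apply (Rpower_base_le _ 1 16); nra | ].
      unfold D. replace (16 / 1) with 16 by field.
      replace (Rpower 1 (q - 1)) with 1 by (unfold Rpower; rewrite ln_1, Rmult_0_r, exp_0; reflexivity). lra.
    + specialize (HS 1 ltac:(lra)). nra.
  - assert (H4 : 0 < 4 ^ L) by (apply pow_lt; lra).
    assert (H2 : 0 < 2 ^ L) by (apply pow_lt; lra).
    assert (H24 : 4 ^ L = 2 ^ L * 2 ^ L) by (rewrite <- Rpow_mult_distr; f_equal; lra).
    set (P := Rpower (4 ^ L) q) in *.
    assert (HP : 0 < P) by apply exp_pos.
    assert (EP : Rpower (4 ^ S L) q = X * P).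
    { unfold X, P. rewrite Rpower_mult_distr by lra. reflexivity. }
    assert (EP1 : Rpower (4 ^ L) (q - 1) * 4 ^ L = P).
    { unfold P. rewrite <- (Rpower_1 (4 ^ L)) at 2 by exact H4.
      rewrite <- Rpower_plus. f_equal. ring. }
    rewrite EP.
    apply Rle_trans with (nsum n (layer R0 (2 ^ L) (fun j => a j ^ 2 * Rpower (1 + R0 j ^ 2) (q - 1))) +
      D * Rpower (4 ^ L) (q - 1) * nsum n (layer R0 (2 ^ S L) (fun j => a j ^ 2))).
    + rewrite <- nsum_scal, <- nsum_plus. apply nsum_le. intros j Hj. unfold layer.
      assert (Hc : 0 < Rpower (4 ^ L) (q - 1)) by apply exp_pos.
      assert (Hd : 0 < D * Rpower (4 ^ L) (q - 1)) by (apply Rmult_lt_0_compat; assumption).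
      assert (Ha := pow2_ge_0 (a j)). specialize (HR j Hj).
      destruct Rle_dec as [E1 | E1].
      * destruct Rle_dec as [E2 | E2]; [ nra | ].
        rewrite Rplus_0_l, (Rmult_comm _ (a j ^ 2)). apply Rmult_le_compat_l; [ exact Ha | ].
        simpl in E1. apply Rnot_le_lt in E2.
        eapply Rle_trans.
        { apply (Rpower_base_le _ (4 ^ L) (16 * 4 ^ L)); [ exact H4 | | ].
          - assert (H41 : 1 <= 4 ^ L) by (apply pow_R1_Rle; lra). rewrite H24 in *. split; nra.
          - replace (16 * 4 ^ L / 4 ^ L) with 16 by (field; lra). lra. }
        replace (16 * 4 ^ L / 4 ^ L) with 16 by (field; lra). unfold D. lra.
      * destruct Rle_dec as [E2 | E2]; [ | lra ].
        exfalso. apply E1. simpl. lra.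
    + specialize (HS (2 ^ S L) ltac:(simpl; lra)).
      assert (Hc : 0 < Rpower (4 ^ L) (q - 1)) by apply exp_pos.
      assert (Hd : 0 < D * Rpower (4 ^ L) (q - 1)) by (apply Rmult_lt_0_compat; assumption).
      assert (B : D * Rpower (4 ^ L) (q - 1) * nsum n (layer R0 (2 ^ S L) (fun j => a j ^ 2))
        <= 4 * D * K * P).
      { replace (4 * D * K * P) with (D * Rpower (4 ^ L) (q - 1) * (K * (2 ^ S L) ^ 2))
          by (rewrite <- EP1, H24; simpl; ring).
        apply Rmult_le_compat_l; lra. }
      assert (E : 4 * D * K * P = (4 * D * K / (X - 1)) * (X - 1) * P) by (field; lra).
      rewrite E in B.
      assert (Q : 0 <= D * K * (X - 1) * P) by (repeat apply Rmult_le_pos; lra).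
      nra.
Qed.

Lemma dyadic_above (M : R) : 1 <= M -> exists L : nat, M <= 2 ^ L /\ 2 ^ L <= 2 * M.
Proof.
  intros HM.
  assert (H : forall N : nat, M <= 2 ^ N -> exists L : nat, M <= 2 ^ L /\ 2 ^ L <= 2 * M).
  { induction N as [|N IH]; intros HN; [ exists 0%nat; simpl in *; lra | ].
    destruct (Rle_lt_dec M (2 ^ N)) as [E | E]; [ exact (IH E) | ].
    exists (S N). simpl in *. lra. }
  destruct (Pow_x_infinity 2 ltac:(rewrite Rabs_pos_eq; lra) M) as [N HN].
  apply (H N). specialize (HN N (Nat.le_refl N)). rewrite Rabs_pos_eq in HN by (apply pow_le; lra). lra.
Qed.

Lemma layered_sum (q K : R) : 0 < q -> 0 <= K -> exists G, 0 <= G /\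
  forall (n : nat) (R0 a : nat -> R) (M : R), 1 <= M ->
  (forall j, (j < n)%nat -> 0 <= R0 j <= M) ->
  (forall rho, 0 <= rho -> nsum n (layer R0 rho (fun j => a j ^ 2)) <= K * rho ^ 2) ->
  nsum n (fun j => a j ^ 2 * Rpower (1 + R0 j ^ 2) (q - 1)) <= G * Rpower (M ^ 2) q.
Proof.
  intros Hq HK. destruct (layered_sum_dyadic q K Hq HK) as [G [HG H]].
  exists (G * Rpower 4 q).
  assert (H4q : 0 < Rpower 4 q) by apply exp_pos.
  split; [ apply Rmult_le_pos; lra | ].
  intros n R0 a M HM HR HS. destruct (dyadic_above M HM) as [L [L1 L2]].
  rewrite (nsum_ext n _ (layer R0 (2 ^ L) (fun j => a j ^ 2 * Rpower (1 + R0 j ^ 2) (q - 1)))).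
  2: { intros j Hj. unfold layer. destruct Rle_dec as [E | E]; [ reflexivity | ].
       exfalso. apply E. specialize (HR j Hj). lra. }
  eapply Rle_trans; [ apply (H n R0 a L); [ intros j Hj; apply HR, Hj | exact HS ] | ].
  rewrite Rmult_assoc. apply Rmult_le_compat_l; [ exact HG | ].
  rewrite Rpower_mult_distr by nra.
  apply Rle_Rpower_l; [ lra | ].
  assert (0 < 2 ^ L) by (apply pow_lt; lra).
  split; [ apply pow_lt; lra | ].
  replace (4 ^ L) with (2 ^ L * 2 ^ L) by (rewrite <- Rpow_mult_distr; f_equal; lra). nra.
Qed.

(** * Integrals over circles of quasiconformal harmonic mappings *)

Lemma half_le_sin (y : R) : 0 <= y <= 1 -> y / 2 <= sin y.
Proof.
  intros Hy. assert (HPI := PI2_3_2). assert (HPI3 := PI_RGT_0).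
  assert (H := derive_nonneg_le (fun x => sin x - x / 2) (fun x => cos x - / 2) 0 y ltac:(lra)).
  enough (sin 0 - 0 / 2 <= sin y - y / 2) by (rewrite sin_0 in *; lra).
  apply H.
  - intros x _. auto_derive; [ exact I | field ].
  - intros x Hx. replace (/ 2) with (cos (PI / 3)) by (rewrite cos_PI3; field).
    assert (cos (PI / 3) <= cos x) by (apply cos_decr_1; lra). lra.
Qed.

Lemma Cmod_cis_minus (a b : R) : 0 <= sin ((a - b) / 2) -> Cmod (cis a - cis b) = 2 * sin ((a - b) / 2).
Proof.
  intros H.
  assert (E : Cmod (cis a - cis b) ^ 2 = (2 * sin ((a - b) / 2)) ^ 2).
  { rewrite Cmod_sqr. unfold cis, Re, Im; simpl.
    assert (C1 := cos_minus a b).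
    replace (cos (a - b)) with (1 - 2 * sin ((a - b) / 2) * sin ((a - b) / 2)) in C1
      by (rewrite <- cos_2a_sin; f_equal; field).
    assert (Sa := sin2_cos2 a). assert (Sb := sin2_cos2 b). unfold Rsqr in Sa, Sb. nra. }
  apply Rsqr_inj; [ apply Cmod_ge_0 | lra | rewrite !Rsqr_pow2; exact E ].
Qed.

Lemma chord_lower_bound (n i j : nat) (tau : R) : (4 <= n)%nat -> (i < j < n)%nat ->
  / INR n <= Cmod (cis (tau + INR j * (2 * PI / INR n)) - cis (tau + INR i * (2 * PI / INR n))).
Proof.
  intros Hn Hij. assert (HPI := PI2_3_2). assert (HPI0 := PI_RGT_0). assert (HPI4 := PI_4).
  assert (Hn4 : 4 <= INR n) by (replace 4 with (INR 4) by (simpl; ring); apply le_INR; exact Hn).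
  assert (Hd1 : 1 <= INR j - INR i).
  { rewrite <- minus_INR by lia. change 1 with (INR 1). apply le_INR. lia. }
  assert (Hd2 : INR j - INR i <= INR n - 1).
  { rewrite <- minus_INR by lia. change 1 with (INR 1). rewrite <- minus_INR by lia. apply le_INR. lia. }
  set (u := PI / INR n).
  assert (Hu : 0 < u) by (apply Rdiv_lt_0_compat; lra).
  assert (Hun : u * INR n = PI) by (unfold u; field; lra).
  assert (Hu1 : u <= 1) by nra.
  set (y := (INR j - INR i) * u).
  assert (Hy1 : u <= y) by (unfold y; nra).
  assert (Hy2 : y <= PI - u) by (unfold y; nra).
  assert (Hsin : sin u <= sin y).
  { destruct (Rle_lt_dec y (PI / 2)) as [H | H].
    - apply sin_incr_1; lra.
    - rewrite <- (sin_PI_x y). apply sin_incr_1; lra. }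
  assert (Hs := half_le_sin u ltac:(lra)).
  assert (E : (tau + INR j * (2 * PI / INR n) - (tau + INR i * (2 * PI / INR n))) / 2 = y)
    by (unfold y, u; field; lra).
  rewrite Cmod_cis_minus by (rewrite E; lra). rewrite E.
  apply Rle_trans with u; [ | lra ].
  unfold u. rewrite <- (Rmult_1_l (/ INR n)). apply Rmult_le_compat_r; [ | lra ].
  left; apply Rinv_0_lt_compat; lra.
Qed.

(** The spacing of the [n] points is at least [c (1 - r)], so that each [f(z_i)] with
    [i <> j], as well as [f(0) = 0], has distance at least [a_j] to [f(z_j)], where
    [a_j] is a fixed multiple of [(1 - r) |h'(z_j)|]. *)
Lemma circle_sum_bound (lambda k c q : R) : admissible_radius lambda k c -> 0 < q ->
  exists G, 0 <= G /\ forall (f h g : C -> C) (n : nat) (r tau M : R),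
  qc_harmonic lambda k f h g -> (4 <= n)%nat -> 1 / 2 <= r < 1 ->
  INR n * (2 * c * (1 - r)) <= 1 -> 1 <= M ->
  (forall t, Cmod (f (r * cis t)%C) <= M) ->
  nsum n (fun j => Cmod (C_derive h (r * cis (tau + INR j * (2 * PI / INR n)))%C) ^ 2 *
      Rpower (1 + Cmod (f (r * cis (tau + INR j * (2 * PI / INR n)))%C) ^ 2) (q - 1))
    <= G * Rpower (M ^ 2) q / (1 - r) ^ 2.
Proof.
  intros Hadm Hq. destruct (layered_sum q 36 Hq ltac:(lra)) as [G [HG HL]].
  assert (Hadm' := Hadm). destruct Hadm' as (Hl & Hk & Hc & Hc8 & _).
  set (m := (1 - k) / 2 * c). assert (Hm : 0 < m) by (apply Rmult_lt_0_compat; lra).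
  exists (G / m ^ 2). split; [ apply Rdiv_le_0_compat; [ exact HG | apply pow_lt, Hm ] | ].
  intros f h g n r tau M Hqc Hn Hr Hnr HM HfM.
  set (z := fun j => (r * cis (tau + INR j * (2 * PI / INR n)))%C).
  assert (Hz : forall j, in_disk (z j)) by (intros j; apply circle_in_disk; lra).
  assert (Hzm : forall j, Cmod (z j) = r).
  { intros j. unfold z. rewrite Cmod_mult, Cmod_R, Cmod_cis, Rabs_pos_eq; lra. }
  set (d := 1 - r) in *. assert (Hd : 0 < d <= 1 / 2) by (unfold d; lra).
  set (a := fun j => m * d * Cmod (C_derive h (z j))).
  assert (Ha0 : forall j, 0 <= a j).
  { intros j. unfold a. apply Rmult_le_pos; [ nra | apply Cmod_ge_0 ]. }
  assert (Hsep : forall j w, in_disk w -> c * d <= Cmod (w - z j) -> a j <= Cmod (f w - f (z j))).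
  { intros j w Hw Hfar.
    assert (S := qc_harmonic_separation lambda k c f h g (z j) w Hadm Hqc (Hz j) Hw).
    rewrite Hzm in S. fold d in S. unfold a, m.
    replace ((1 - k) / 2 * c * d * Cmod (C_derive h (z j)))
      with ((1 - k) / 2 * Cmod (C_derive h (z j)) * (c * d)) by ring.
    apply S, Hfar. }
  assert (Hf0 : f 0 = 0) by apply Hqc.
  assert (Hai : forall i, (i < n)%nat -> 0 <= a i /\ a i <= Cmod (f (z i))).
  { intros i _. split; [ apply Ha0 | ].
    assert (S := Hsep i 0 ltac:(unfold in_disk; rewrite Cmod_0; lra)).
    rewrite Hf0 in S.
    replace (0 - z i)%C with (- z i)%C in S by ring. replace (0 - f (z i))%C with (- f (z i))%C in S by ring.
    rewrite !Cmod_opp, Hzm in S. apply S. nra. }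
  assert (Hn4 : 4 <= INR n) by (replace 4 with (INR 4) by (simpl; ring); apply le_INR; exact Hn).
  assert (Hcd : c * d <= r * / INR n).
  { apply Rmult_le_reg_r with (INR n); [ lra | ].
    rewrite (Rmult_assoc r), Rinv_l by lra. lra. }
  assert (Hchord : forall i j, (i < n)%nat -> (j < n)%nat -> i <> j -> c * d <= Cmod (z j - z i)).
  { assert (Hlt : forall i j, (i < j < n)%nat -> c * d <= Cmod (z j - z i)).
    { intros i j Hij. assert (B := chord_lower_bound n i j tau Hn Hij).
      unfold z. rewrite <- (Rmult_1_l 1) in Hr.
      replace (r * cis (tau + INR j * (2 * PI / INR n)) - r * cis (tau + INR i * (2 * PI / INR n)))%C
        with (r * (cis (tau + INR j * (2 * PI / INR n)) - cis (tau + INR i * (2 * PI / INR n))))%C by ring.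
      rewrite Cmod_mult, Cmod_R, Rabs_pos_eq by lra.
      eapply Rle_trans; [ exact Hcd | ]. apply Rmult_le_compat_l; [ lra | exact B ]. }
    intros i j Hi Hj Hne. destruct (Nat.lt_total i j) as [L | [L | L]]; [ apply Hlt; lia | lia | ].
    replace (z j - z i)%C with (- (z i - z j))%C by ring. rewrite Cmod_opp. apply Hlt; lia. }
  assert (Hsum := HL n (fun j => Cmod (f (z j))) a M HM).
  assert (Hfin : nsum n (fun j => a j ^ 2 * Rpower (1 + Cmod (f (z j)) ^ 2) (q - 1)) <= G * Rpower (M ^ 2) q).
  { apply Hsum.
    - intros j _. split; [ apply Cmod_ge_0 | apply HfM ].
    - intros rho Hrho. apply (separated_points_sum n (fun j => f (z j)) a rho Hrho Hai).
      intros i j Hi Hj Hne. apply Hsep; [ apply Hz | apply Hchord; assumption ]. }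
  change (nsum n (fun j => Cmod (C_derive h (z j)) ^ 2 * Rpower (1 + Cmod (f (z j)) ^ 2) (q - 1))
    <= G / m ^ 2 * Rpower (M ^ 2) q / d ^ 2).
  apply Rmult_le_reg_l with (m ^ 2 * d ^ 2); [ apply Rmult_lt_0_compat; apply pow_lt; lra | ].
  replace (m ^ 2 * d ^ 2 * (G / m ^ 2 * Rpower (M ^ 2) q / d ^ 2)) with (G * Rpower (M ^ 2) q)
    by (field; lra).
  eapply Rle_trans; [ | exact Hfin ]. rewrite <- nsum_scal. right. apply nsum_ext. intros j _.
  unfold a. ring.
Qed.

Lemma RInt_shift_sum (V : R -> R) (eta : R) (m : nat) : (forall t, continuous V t) ->
  RInt V 0 (INR m * eta) = RInt (fun tau => nsum m (fun j => V (tau + INR j * eta))) 0 eta.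
Proof.
  intros HV.
  assert (EX : forall p q, ex_RInt V p q)
    by (intros p q; apply (@ex_RInt_continuous R_CompleteNormedModule); intros; apply HV).
  assert (EXs : forall v, ex_RInt (fun t => V (t + v)) 0 eta).
  { intros v. apply (@ex_RInt_continuous R_CompleteNormedModule). intros t _.
    apply (continuous_comp (fun t => t + v) V); [ | apply HV ].
    apply (continuous_plus (V := R_NormedModule)); [ apply continuous_id | apply continuous_const ]. }
  assert (C0 : RInt (fun _ : R => 0) 0 eta = 0)
    by (rewrite RInt_const; unfold scal; simpl; unfold mult; simpl; ring).
  assert (Sh : forall v, RInt (fun t => V (t + v)) 0 eta = RInt V v (eta + v)).
  { intros v. assert (E := RInt_comp_lin V 1 v 0 eta (EX _ _)).
    replace (1 * 0 + v) with v in E by ring. replace (1 * eta + v) with (eta + v) in E by ring.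
    rewrite <- E. apply RInt_ext. intros t _. unfold scal; simpl; unfold mult; simpl.
    rewrite !Rmult_1_l. reflexivity. }
  assert (Exn : forall p, ex_RInt (fun tau => nsum p (fun j => V (tau + INR j * eta))) 0 eta).
  { intros p. eexists. apply (is_RInt_nsum p (fun j tau => V (tau + INR j * eta))
      (fun j => RInt (fun tau => V (tau + INR j * eta)) 0 eta)).
    intros i _. exact (RInt_correct (V := R_CompleteNormedModule) _ _ _ (EXs _)). }
  induction m as [|m IH].
  - simpl. rewrite Rmult_0_l, C0. apply (RInt_point (V := R_CompleteNormedModule)).
  - assert (Ch := RInt_Chasles V 0 (INR m * eta) (INR (S m) * eta) (EX _ _) (EX _ _)).
    rewrite <- Ch, IH. simpl nsum.
    assert (Pl := RInt_plus (V := R_CompleteNormedModule)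
      (fun tau => nsum m (fun j => V (tau + INR j * eta)))
      (fun tau => V (tau + INR m * eta)) 0 eta (Exn m) (EXs _)).
    transitivity (plus (RInt (fun tau => nsum m (fun j => V (tau + INR j * eta))) 0 eta)
      (RInt (fun tau => V (tau + INR m * eta)) 0 eta)); [ | symmetry; exact Pl ].
    f_equal. rewrite Sh. f_equal. rewrite S_INR. ring.
Qed.

(** The integral over the circle is the integral, over an arc of length
    [2 pi / n], of the sums over the regular [n]-gons starting on that arc. *)
Lemma RInt_le_shift_sum (V : R -> R) (n : nat) (B : R) : (0 < n)%nat ->
  (forall t, continuous V t) ->
  (forall tau, nsum n (fun j => V (tau + INR j * (2 * PI / INR n))) <= B) ->
  RInt V 0 (2 * PI) <= 2 * PI / INR n * B.
Proof.
  intros Hn HV HB. assert (HPI := PI_RGT_0).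
  assert (Hn0 : 0 < INR n) by (apply lt_0_INR, Hn).
  replace (RInt V 0 (2 * PI)) with (RInt V 0 (INR n * (2 * PI / INR n))) by (f_equal; field; lra).
  rewrite RInt_shift_sum by exact HV.
  assert (He : 0 < 2 * PI / INR n) by (apply Rdiv_lt_0_compat; lra).
  apply Rle_trans with (RInt (fun _ => B) 0 (2 * PI / INR n)).
  - apply RInt_le; [ lra | | apply ex_RInt_const | intros t _; apply HB ].
    eexists. apply (is_RInt_nsum n (fun j tau => V (tau + INR j * (2 * PI / INR n)))
      (fun j => RInt (fun tau => V (tau + INR j * (2 * PI / INR n))) 0 (2 * PI / INR n))).
    intros i _. apply (RInt_correct (V := R_CompleteNormedModule)).
    apply (@ex_RInt_continuous R_CompleteNormedModule). intros t _.
    apply (continuous_comp (fun t => t + INR i * (2 * PI / INR n)) V); [ | apply HV ].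
    apply (continuous_plus (V := R_NormedModule)); [ apply continuous_id | apply continuous_const ].
  - rewrite RInt_const. unfold scal; simpl; unfold mult; simpl. lra.
Qed.

Lemma point_count (x : R) : 8 <= x -> exists n : nat, (4 <= n)%nat /\ INR n <= x /\ x / 2 <= INR n.
Proof.
  intros Hx. destruct (nfloor_ex x ltac:(lra)) as [n [H1 H2]].
  exists n. split; [ | lra ].
  apply INR_le. replace (INR 4) with 4 by (simpl; ring). lra.
Qed.

(** * Hardy spaces of quasiconformal harmonic mappings *)

Definition gradient_sqr (A B : C -> C) (s t : R) : R :=
  Cmod (C_derive A (s, t)) ^ 2 + Cmod (C_derive B (s, t)) ^ 2.

(** For harmonic [X], [Y] and [N = 1 + X^2 + Y^2], the Laplacian of [N] is
    [2 (|grad X|^2 + |grad Y|^2)], and [|grad N|^2] is at most [4 N] times the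
    same sum of squared gradients. The summand 1 keeps [N^q] smooth at the common
    zeros of [X] and [Y]. *)
Lemma power_laplacian_bound (A B : C -> C) (q : R) : 0 < q ->
  holomorphic left_half_plane A -> holomorphic left_half_plane B ->
  (forall s, s < 0 -> A (s, 2 * PI) = A (s, 0) /\ C_derive A (s, 2 * PI) = C_derive A (s, 0)) ->
  (forall s, s < 0 -> B (s, 2 * PI) = B (s, 0) /\ C_derive B (s, 2 * PI) = C_derive B (s, 0)) ->
  let N := fun s t => 1 + (Re (A (s, t)) ^ 2 + Im (B (s, t)) ^ 2) in
  exists us ut uss utt, C2_left (fun s t => exp (q * ln (N s t))) us ut uss utt /\
    (forall s, s < 0 -> ut s (2 * PI) = ut s 0) /\
    (forall s t, s < 0 ->
      uss s t + utt s t <= (2 * q + 4 * q ^ 2) * (gradient_sqr A B s t * exp ((q - 1) * ln (N s t)))).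
Proof.
  intros Hq HA HB HpA HpB N.
  destruct (C2_left_holomorphic A HA) as [CX _]. destruct (C2_left_holomorphic B HB) as [_ CY].
  assert (HN : forall s t, s < 0 -> 0 < N s t).
  { intros s t _. unfold N. assert (P1 := pow2_ge_0 (Re (A (s, t)))).
    assert (P2 := pow2_ge_0 (Im (B (s, t)))). lra. }
  assert (CN := C2_left_plus _ _ _ _ _ _ _ _ _ _ (C2_left_const 1)
    (C2_left_plus _ _ _ _ _ _ _ _ _ _ (C2_left_square _ _ _ _ _ CX) (C2_left_square _ _ _ _ _ CY))).
  assert (CU := C2_left_exp q _ _ _ _ _ (C2_left_ln _ _ _ _ _ HN CN)).
  do 4 eexists. split; [ exact CU | ]. cbv beta. split.
  - intros s Hs. unfold N. destruct (HpA s Hs) as [-> ->]. destruct (HpB s Hs) as [-> ->]. reflexivity.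
  - intros s t Hs. fold (N s t). assert (Hn := HN s t Hs).
    replace (exp ((q - 1) * ln (N s t))) with (exp (q * ln (N s t)) * / N s t).
    2: { replace ((q - 1) * ln (N s t)) with (q * ln (N s t) + - ln (N s t)) by ring.
         rewrite exp_plus, exp_Ropp, exp_ln by exact Hn. reflexivity. }
    unfold gradient_sqr. rewrite !Cmod_sqr.
    set (U := exp (q * ln (N s t))). assert (HU : 0 < U) by apply exp_pos.
    set (X := Re (A (s, t))). set (Y := Im (B (s, t))).
    set (x := Re (C_derive A (s, t))). set (x' := Im (C_derive A (s, t))).
    set (y := Re (C_derive B (s, t))). set (y' := Im (C_derive B (s, t))).
    set (a := Re (C_derive (C_derive A) (s, t))). set (b := Im (C_derive (C_derive B) (s, t))).
    assert (EN : N s t = 1 + (X ^ 2 + Y ^ 2)) by reflexivity.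
    set (n := N s t) in *.
    set (S := x ^ 2 + x' ^ 2 + (y ^ 2 + y' ^ 2)).
    set (Q := (2 * (X * x + Y * y')) ^ 2 + (2 * (- X * x' + Y * y)) ^ 2).
    assert (HQ : Q <= 4 * n * S).
    { assert (E : 4 * (X ^ 2 + Y ^ 2) * S - Q =
        4 * ((X * y' - Y * x) ^ 2 + (X * y + Y * x') ^ 2)) by (unfold Q, S; ring).
      assert (P1 := pow2_ge_0 (X * y' - Y * x)). assert (P2 := pow2_ge_0 (X * y + Y * x')).
      assert (HS : 0 <= S).
      { unfold S. assert (K1 := pow2_ge_0 x). assert (K2 := pow2_ge_0 x').
        assert (K3 := pow2_ge_0 y). assert (K4 := pow2_ge_0 y'). lra. }
      rewrite EN. lra. }
    match goal with |- ?lhs <= _ =>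
      replace lhs with (U * / n * (q * (2 * S) - q * (Q * / n) + q ^ 2 * (Q * / n))) end.
    2: { unfold Q, S. field. lra. }
    assert (Hi : 0 < / n) by (apply Rinv_0_lt_compat, Hn).
    assert (HQn : Q * / n <= 4 * S).
    { apply Rmult_le_reg_r with n; [ exact Hn | ]. rewrite Rmult_assoc, Rinv_l by lra. lra. }
    assert (HQ0 : 0 <= Q * / n).
    { apply Rmult_le_pos; [ | lra ]. unfold Q.
      assert (P1 := pow2_ge_0 (2 * (X * x + Y * y'))). assert (P2 := pow2_ge_0 (2 * (- X * x' + Y * y))). lra. }
    replace ((2 * q + 4 * q ^ 2) * (S * (U * / n)))
      with (U * / n * (2 * q * S + q ^ 2 * (4 * S))) by ring.
    apply Rmult_le_compat_l; [ apply Rmult_le_pos; lra | ].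
    assert (K1 : 0 <= q * (Q * / n)) by (apply Rmult_le_pos; lra).
    assert (K2 : q ^ 2 * (Q * / n) <= q ^ 2 * (4 * S)) by (apply Rmult_le_compat_l; [ apply pow2_ge_0 | exact HQn ]).
    lra.
Qed.

Lemma Rpower_antitone (x y e : R) : 0 < x <= y -> e <= 0 -> Rpower y e <= Rpower x e.
Proof.
  intros Hx He. replace e with (- - e) by ring. rewrite !(Rpower_Ropp _ (- e)).
  apply Rinv_le_contravar; [ apply exp_pos | apply Rle_Rpower_l; lra ].
Qed.

Lemma half_le_one_minus_exp (s : R) : - 1 <= s <= 0 -> - s / 2 <= 1 - exp s.
Proof.
  intros Hs.
  assert (H : 1 + - s <= exp (- s)) by (destruct (Req_dec s 0) as [-> | Hn];
    [ rewrite Ropp_0, exp_0; lra | left; apply exp_ineq1; lra ]).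
  assert (E : exp s * exp (- s) = 1) by (rewrite <- exp_plus, <- exp_0; f_equal; ring).
  assert (P := exp_pos s). nra.
Qed.

(** The bound on [m''] has the antiderivative [b] of second order below, which is
    nonpositive because [beta < 1]. As [m - b] is concave, it lies below
    its tangent at [- 1 / 2]. *)
Lemma bounded_of_derive2_power (m dm ddm : R -> R) (D beta : R) : 0 <= D -> 0 < beta < 1 ->
  (forall s, s < 0 -> is_derive m s (dm s)) -> (forall s, s < 0 -> is_derive dm s (ddm s)) ->
  (forall s, - (1 / 2) <= s < 0 -> ddm s <= D * Rpower (- s) (- 1 - beta)) ->
  exists T, forall s, - (1 / 2) <= s < 0 -> m s <= T.
Proof.
  intros HD Hb Hm Hdm Hdd.
  set (b := fun s => - D / (beta * (1 - beta)) * exp ((1 - beta) * ln (- s))).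
  set (db := fun s => D / beta * exp (- beta * ln (- s))).
  set (s0 := - (1 / 2)).
  assert (Hb1 : forall s, s < 0 -> is_derive b s (db s)).
  { intros s Hs. unfold b, db. auto_derive; [ lra | ].
    replace ((1 - beta) * ln (- s)) with (ln (- s) + - beta * ln (- s)) by ring.
    rewrite exp_plus, exp_ln by lra. field. lra. }
  assert (Hb2 : forall s, s < 0 -> is_derive db s (D * Rpower (- s) (- 1 - beta))).
  { intros s Hs. unfold db. auto_derive; [ lra | ]. unfold Rpower.
    replace ((- 1 - beta) * ln (- s)) with (- ln (- s) + - beta * ln (- s)) by ring.
    rewrite exp_plus, exp_Ropp, exp_ln by lra. field. lra. }
  exists (Rabs (m s0 - b s0) + Rabs (dm s0 - db s0)). intros s Hs.
  destruct (concave_below_tangent (fun x => m x - b x) (fun x => dm x - db x)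
    (fun x => ddm x - D * Rpower (- x) (- 1 - beta)) s0 s0 s) as [_ H].
  - unfold s0 in *. lra.
  - intros x Hx. exact (is_derive_minus _ _ _ _ _ (Hm x ltac:(unfold s0 in *; lra)) (Hb1 x ltac:(unfold s0 in *; lra))).
  - intros x Hx. exact (is_derive_minus _ _ _ _ _ (Hdm x ltac:(unfold s0 in *; lra)) (Hb2 x ltac:(unfold s0 in *; lra))).
  - intros x Hx. assert (B := Hdd x ltac:(unfold s0 in *; lra)). lra.
  - assert (Hbs : b s <= 0).
    { unfold b. assert (E := exp_pos ((1 - beta) * ln (- s))).
      assert (Q : 0 <= D / (beta * (1 - beta))) by (apply Rdiv_le_0_compat; [ exact HD | nra ]).
      replace (- D / (beta * (1 - beta))) with (- (D / (beta * (1 - beta)))) by (field; lra). nra. }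
    assert (A1 := Rle_abs (m s0 - b s0)). assert (A2 := Rle_abs (dm s0 - db s0)).
    assert (A3 := Rabs_pos (dm s0 - db s0)).
    assert ((dm s0 - db s0) * (s - s0) <= Rabs (dm s0 - db s0)).
    { apply Rle_trans with (Rabs (dm s0 - db s0) * (s - s0)).
      - apply Rmult_le_compat_r; [ unfold s0 in *; lra | exact A2 ].
      - unfold s0 in *. nra. }
    lra.
Qed.

Lemma nonneg_power_le (x y p : R) : 0 <= x <= y -> 0 < y -> 0 < p -> nonneg_power x p <= Rpower y p.
Proof.
  intros Hx Hy Hp. unfold nonneg_power. destruct Req_EM_T as [E | E].
  - left; apply exp_pos.
  - apply Rle_Rpower_l; lra.
Qed.

(** [Re f] and [Im f] are the real and the imaginary part of the holomorphic
    functions [h + g] and [h - g], to which [power_laplacian_bound] applies; by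
    quasiconformality their derivatives are at most [2 |h'|]. *)
Lemma qc_harmonic_circular_mean (lambda k q : R) (f h g : C -> C) : 0 < q -> 0 <= k < 1 ->
  qc_harmonic lambda k f h g ->
  exists dm ddm : R -> R,
  (forall s, s < 0 -> is_derive (fun s => RInt (fun t => exp (q * ln (1 + Cmod (f (exp s * cis t)%C) ^ 2))) 0 (2 * PI)) s (dm s)) /\
  (forall s, s < 0 -> is_derive dm s (ddm s)) /\
  (forall s, s < 0 -> ddm s <= 8 * (2 * q + 4 * q ^ 2) * RInt (fun t =>
    Cmod (C_derive h (exp s * cis t)%C) ^ 2 * Rpower (1 + Cmod (f (exp s * cis t)%C) ^ 2) (q - 1)) 0 (2 * PI)) /\
  (forall s t, s < 0 -> continuous (fun t => Cmod (C_derive h (exp s * cis t)%C) ^ 2 *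
    Rpower (1 + Cmod (f (exp s * cis t)%C) ^ 2) (q - 1)) t) /\
  (forall s t, s < 0 -> continuous (fun t => Cmod (f (exp s * cis t)%C) ^ 2) t).
Proof.
  intros Hq Hk (Hh & Hg & Hf & _ & _ & HD).
  assert (HPI := PI_RGT_0).
  set (F0 := fun z => (h z + cis 0 * g z)%C). set (F1 := fun z => (h z + cis PI * g z)%C).
  destruct (C_derive_combination h g (cis 0) Hh Hg) as [HF0 HD0]. fold F0 in HF0, HD0.
  destruct (C_derive_combination h g (cis PI) Hh Hg) as [HF1 HD1]. fold F1 in HF1, HD1.
  set (A := fun z => F0 (Cexp z)). set (B := fun z => F1 (Cexp z)).
  destruct (C_derive_comp_Cexp F0 HF0) as [HA HAd]. fold A in HA, HAd.
  destruct (C_derive_comp_Cexp F1 HF1) as [HB HBd]. fold B in HB, HBd.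
  assert (Hin : forall s t, s < 0 -> in_disk (Cexp (s, t)))
    by (intros s t Hs; apply Cexp_in_disk; exact Hs).
  assert (Per : forall (G : C -> C) K, (forall z, left_half_plane z -> C_derive (fun z => G (Cexp z)) z = K (Cexp z)) ->
    forall s, s < 0 -> G (Cexp (s, 2 * PI)) = G (Cexp (s, 0)) /\
      C_derive (fun z => G (Cexp z)) (s, 2 * PI) = C_derive (fun z => G (Cexp z)) (s, 0)).
  { intros G K HG s Hs. rewrite !HG by exact Hs. rewrite Cexp_2PI. split; reflexivity. }
  assert (PA := Per F0 (fun w => C_derive F0 w * w)%C (fun z Hz => proj1 (HAd z Hz))).
  assert (PB := Per F1 (fun w => C_derive F1 w * w)%C (fun z Hz => proj1 (HBd z Hz))).
  destruct (power_laplacian_bound A B q Hq HA HB PA PB) as (us & ut & uss & utt & HC & Hper & Hlap).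
  assert (Hf2 : forall s t, s < 0 ->
    Re (A (s, t)) ^ 2 + Im (B (s, t)) ^ 2 = Cmod (f (exp s * cis t)%C) ^ 2).
  { intros s t Hs. change (exp s * cis t)%C with (Cexp (s, t)).
    rewrite Cmod_sqr, Hf by (apply Hin, Hs). unfold A, B, F0, F1. rewrite cis_0, cis_PI.
    unfold Re, Im; simpl; ring. }
  destruct (C2_left_holomorphic A HA) as [CX _]. destruct (C2_left_holomorphic B HB) as [_ CY].
  assert (Cf : forall s t, s < 0 -> continuous (fun t => Cmod (f (exp s * cis t)%C) ^ 2) t).
  { intros s t Hs. apply (continuous_ext (fun t => Re (A (s, t)) ^ 2 + Im (B (s, t)) ^ 2));
      [ intros; apply Hf2, Hs | ].
    assert (C1 := C2_left_plus _ _ _ _ _ _ _ _ _ _ (C2_left_square _ _ _ _ _ CX) (C2_left_square _ _ _ _ _ CY)).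
    apply (continuity_2d_pt_section_r (fun s t => Re (A (s, t)) ^ 2 + Im (B (s, t)) ^ 2)), (C1 s t Hs). }
  assert (Hpos : forall s t, 0 < 1 + Cmod (f (exp s * cis t)%C) ^ 2).
  { intros s t. assert (P := pow2_ge_0 (Cmod (f (exp s * cis t)%C))). lra. }
  assert (CV : forall s t, s < 0 -> continuous (fun t => Cmod (C_derive h (exp s * cis t)%C) ^ 2 *
    Rpower (1 + Cmod (f (exp s * cis t)%C) ^ 2) (q - 1)) t).
  { intros s t Hs. apply (continuous_mult (K := R_AbsRing)).
    - apply (continuous_ext (fun t => Re (C_derive h (exp s * cis t)%C) ^ 2 + Im (C_derive h (exp s * cis t)%C) ^ 2));
        [ intros; symmetry; apply Cmod_sqr | ].
      assert (Hes : 0 <= exp s < 1).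
      { split; [ left; apply exp_pos | rewrite <- exp_0; apply exp_increasing, Hs ]. }
      destruct (continuous_path_circle (C_derive h) (exp s) t
        (holomorphic_C_derive _ _ open_disk Hh) Hes) as [C1 C2].
      exact (continuous_plus _ _ _ (continuous_sqr _ _ C1) (continuous_sqr _ _ C2)).
    - apply (continuous_comp (fun t => Cmod (f (exp s * cis t)%C) ^ 2) (fun x => Rpower (1 + x) (q - 1)));
        [ apply Cf, Hs | ].
      apply (@ex_derive_continuous R_AbsRing R_NormedModule). unfold Rpower.
      auto_derive. apply Hpos. }
  exists (fun s => RInt (fun t => us s t) 0 (2 * PI)), (fun s => RInt (fun t => uss s t + utt s t) 0 (2 * PI)).
  assert (Hmean : forall s, s < 0 ->
    RInt (fun t => exp (q * ln (1 + (Re (A (s, t)) ^ 2 + Im (B (s, t)) ^ 2)))) 0 (2 * PI) =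
    RInt (fun t => exp (q * ln (1 + Cmod (f (exp s * cis t)%C) ^ 2))) 0 (2 * PI))
    by (intros s Hs; apply RInt_ext; intros t _; rewrite Hf2 by exact Hs; reflexivity).
  split; [ | split; [ | split; [ | split; [ exact CV | exact Cf ] ] ] ].
  - intros s Hs.
    apply (is_derive_ext_loc (fun s => RInt (fun t => exp (q * ln (1 + (Re (A (s, t)) ^ 2 + Im (B (s, t)) ^ 2)))) 0 (2 * PI))).
    + generalize (locally_negative s Hs). apply filter_imp. exact Hmean.
    + exact (proj1 (circular_mean_derive2 _ _ _ _ _ s HC Hper Hs)).
  - intros s Hs. exact (proj2 (circular_mean_derive2 _ _ _ _ _ s HC Hper Hs)).
  - intros s Hs.
    assert (EV : ex_RInt (fun t => Cmod (C_derive h (exp s * cis t)%C) ^ 2 *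
      Rpower (1 + Cmod (f (exp s * cis t)%C) ^ 2) (q - 1)) 0 (2 * PI))
      by (apply (@ex_RInt_continuous R_CompleteNormedModule); intros t _; apply CV, Hs).
    assert (Sc := RInt_scal (V := R_CompleteNormedModule) _ 0 (2 * PI) (8 * (2 * q + 4 * q ^ 2)) EV).
    eapply Rle_trans; [ | right; exact Sc ].
    apply RInt_le; [ lra | | apply (ex_RInt_scal (V := R_NormedModule)); exact EV | ].
    + apply (@ex_RInt_continuous R_CompleteNormedModule). intros t _.
      apply (continuous_plus (V := R_NormedModule)).
      * apply (continuity_2d_pt_section_r uss), (HC s t Hs).
      * apply (continuity_2d_pt_section_r utt), (HC s t Hs).
    + intros t _. eapply Rle_trans; [ apply Hlap, Hs | ].
      rewrite Hf2 by exact Hs.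
      match goal with |- _ <= scal ?a ?x => change (scal a x) with (a * x)%R end.
      change (exp ((q - 1) * ln (1 + Cmod (f (exp s * cis t)%C) ^ 2)))
        with (Rpower (1 + Cmod (f (exp s * cis t)%C) ^ 2) (q - 1)).
      set (W := Rpower (1 + Cmod (f (exp s * cis t)%C) ^ 2) (q - 1)).
      assert (HW : 0 < W) by apply exp_pos.
      assert (HG : gradient_sqr A B s t <= 8 * Cmod (C_derive h (exp s * cis t)%C) ^ 2).
      { assert (Hlh : left_half_plane (s, t)) by exact Hs.
        unfold gradient_sqr. rewrite (proj1 (HAd _ Hlh)), (proj1 (HBd _ Hlh)).
        change (exp s * cis t)%C with (Cexp (s, t)). set (z := Cexp (s, t)).
        assert (Hz : in_disk z) by (apply Hin, Hs).
        rewrite (proj1 (HD0 z Hz)), (proj1 (HD1 z Hz)), !Cmod_mult.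
        destruct (HD z Hz) as (_ & Hgk & _).
        assert (T0 := Cmod_triangle (C_derive h z) (cis 0 * C_derive g z)).
        assert (T1 := Cmod_triangle (C_derive h z) (cis PI * C_derive g z)).
        rewrite Cmod_mult, Cmod_cis in T0, T1.
        assert (Hz0 := Cmod_ge_0 z). unfold in_disk in Hz.
        assert (H0 := Cmod_ge_0 (C_derive h z)).
        assert (P0 := Cmod_ge_0 (C_derive h z + cis 0 * C_derive g z)).
        assert (P1 := Cmod_ge_0 (C_derive h z + cis PI * C_derive g z)).
        assert (Bd : forall x, 0 <= x -> x <= 2 * Cmod (C_derive h z) -> (x * Cmod z) ^ 2 <= 4 * Cmod (C_derive h z) ^ 2).
        { intros x Hx0 Hx. replace (4 * Cmod (C_derive h z) ^ 2) with ((2 * Cmod (C_derive h z)) ^ 2) by ring.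
          apply pow_incr. split; [ apply Rmult_le_pos; assumption | nra ]. }
        assert (Hg1 : Cmod (C_derive g z) <= Cmod (C_derive h z)) by nra.
        assert (B0 := Bd _ P0 ltac:(lra)). assert (B1 := Bd _ P1 ltac:(lra)). lra. }
      assert (Hq2 : 0 < 2 * q + 4 * q ^ 2) by nra.
      replace (8 * (2 * q + 4 * q ^ 2) * (Cmod (C_derive h (exp s * cis t)) ^ 2 * W))
        with ((2 * q + 4 * q ^ 2) * (8 * Cmod (C_derive h (exp s * cis t)) ^ 2 * W)) by ring.
      apply Rmult_le_compat_l; [ lra | ]. apply Rmult_le_compat_r; [ lra | exact HG ].
Qed.

Theorem class_S_qc_hardy (lambda k p : R) (f : C -> C) : 1 < lambda -> 0 <= k < 1 ->
  0 < p < 1 / (lambda - 1) -> class_B lambda f -> class_S_qc k f -> hardy p f.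
Proof.
  intros Hl Hk Hp HB HS. assert (HPI := PI_RGT_0).
  destruct (class_B_pre_Schwarzian lambda f HB) as (h & g & Hd & HT).
  split; [ apply (canonical_decomposition_harmonic f h g Hd) | ].
  assert (Hqc := class_S_qc_qc_harmonic lambda k f h g ltac:(lra) Hk HS Hd HT).
  destruct (class_B_growth lambda f h g ltac:(lra) ltac:(lra) Hd HT) as [K [HK HG]].
  destruct (admissible_radius_exists lambda k ltac:(lra) Hk) as [c Hc].
  set (q := p / 2). assert (Hq : 0 < q) by (unfold q; lra).
  destruct (circle_sum_bound lambda k c q Hc Hq) as [G [HG0 HGs]].
  destruct (qc_harmonic_circular_mean lambda k q f h g Hq Hk Hqc)
    as (dm & ddm & Hm & Hdm & Hddm & CV & Cf).
  set (m := fun s => RInt (fun t => exp (q * ln (1 + Cmod (f (exp s * cis t)%C) ^ 2))) 0 (2 * PI)) in Hm.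
  (* [|f|^p = O((1 - r)^(- beta))] on the circle of radius [r]; the hypothesis on [p]
     says that [beta < 1]. *)
  set (beta := p * (lambda - 1)).
  assert (Hbeta : 0 < beta < 1).
  { unfold beta. split; [ nra | ].
    apply Rlt_le_trans with (1 / (lambda - 1) * (lambda - 1)); [ | right; field; lra ].
    apply Rmult_lt_compat_r; lra. }
  assert (Hexp : forall s, s < 0 -> 0 < exp s < 1).
  { intros s Hs. split; [ apply exp_pos | rewrite <- exp_0; apply exp_increasing, Hs ]. }
  set (K1 := 1 + K / (lambda - 1)).
  assert (HK1 : 1 <= K1) by (unfold K1; assert (0 <= K / (lambda - 1)) by (apply Rdiv_le_0_compat; lra); lra).
  assert (Hgrow : forall s t, s < 0 -> Cmod (f (exp s * cis t)%C) <= K1 * Rpower (1 - exp s) (1 - lambda)).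
  { intros s t Hs. specialize (Hexp s Hs).
    assert (B := HG (exp s * cis t)%C (circle_in_disk (exp s) t ltac:(lra))).
    rewrite Cmod_mult, Cmod_R, Cmod_cis, Rabs_pos_eq, Rmult_1_r in B by lra.
    eapply Rle_trans; [ exact B | ].
    assert (P := exp_pos ((1 - lambda) * ln (1 - exp s))). fold (Rpower (1 - exp s) (1 - lambda)) in P.
    set (W := Rpower (1 - exp s) (1 - lambda)) in *.
    assert (Q : 0 <= K / (lambda - 1)) by (apply Rdiv_le_0_compat; lra).
    replace (K * ((W - 1) / (lambda - 1))) with (K / (lambda - 1) * (W - 1)) by (field; lra).
    unfold K1. nra. }
  destruct Hc as (_ & _ & Hc0 & Hc8 & _).
  set (E1 := 8 * (2 * q + 4 * q ^ 2) * (2 * PI * (4 * c) * (G * Rpower (K1 ^ 2) q))).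
  assert (HE1 : 0 <= E1).
  { unfold E1. assert (P := exp_pos (q * ln (K1 ^ 2))). fold (Rpower (K1 ^ 2) q) in P.
    apply Rmult_le_pos; [ nra | ]. apply Rmult_le_pos; [ nra | apply Rmult_le_pos; lra ]. }
  assert (Hbound : forall s, - (1 / 2) <= s < 0 ->
    ddm s <= E1 * Rpower (/ 2) (- 1 - beta) * Rpower (- s) (- 1 - beta)).
  { intros s Hs. assert (He := Hexp s ltac:(lra)).
    assert (Hr : 1 / 2 <= exp s).
    { assert (H := exp_ineq1_le s). lra. }
    set (d := 1 - exp s) in *. assert (Hd1 : 0 < d <= 1 / 2) by (unfold d; lra).
    assert (Hcd : 0 < 2 * c * d) by nra.
    (* About [1 / (2 c d)] points: few enough to be separated by [c d], and many
       enough for the factor [1 / n] to be [O(d)]. *)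
    destruct (point_count (/ (2 * c * d))) as (n & Hn4 & Hn1 & Hn2).
    { replace 8 with (/ (1 / 8)) by field. apply Rinv_le_contravar; nra. }
    assert (HnR : 0 < INR n) by (apply lt_0_INR; lia).
    assert (Hnd : INR n * (2 * c * d) <= 1).
    { apply Rle_trans with (/ (2 * c * d) * (2 * c * d)); [ apply Rmult_le_compat_r; lra | ].
      rewrite Rinv_l; lra. }
    assert (Hn3 : / INR n <= 4 * c * d).
    { apply Rmult_le_reg_r with (INR n); [ exact HnR | ]. rewrite Rinv_l by lra.
      apply Rle_trans with (4 * c * d * (/ (2 * c * d) / 2)).
      - right. field. lra.
      - apply Rmult_le_compat_l; [ nra | exact Hn2 ]. }
    set (W := Rpower d (1 - lambda)).
    assert (HW : 1 <= W).
    { apply Rle_trans with (Rpower 1 (1 - lambda)); [ | apply Rpower_antitone; lra ].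
      unfold Rpower; rewrite ln_1, Rmult_0_r, exp_0; lra. }
    assert (HM1 : 1 <= K1 * W) by nra.
    assert (Sum := fun tau => HGs f h g n (exp s) tau (K1 * W) Hqc Hn4 ltac:(lra) Hnd HM1
      (fun t => Hgrow s t ltac:(lra))).
    assert (I1 := RInt_le_shift_sum (fun t => Cmod (C_derive h (exp s * cis t)%C) ^ 2 *
      Rpower (1 + Cmod (f (exp s * cis t)%C) ^ 2) (q - 1)) n _ ltac:(lia)
      (fun t => CV s t ltac:(lra)) Sum). fold d in I1.
    assert (EW : Rpower ((K1 * W) ^ 2) q = Rpower (K1 ^ 2) q * Rpower d (- beta)).
    { rewrite Rpow_mult_distr, <- Rpower_mult_distr by (apply pow_lt; lra). f_equal.
      replace (W ^ 2) with (W * W) by ring. unfold W. rewrite <- Rpower_plus, Rpower_mult.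
      f_equal. unfold q, beta. field. }
    rewrite EW in I1.
    assert (HP1 : 0 < Rpower (K1 ^ 2) q) by apply exp_pos.
    assert (HP2 : 0 < Rpower d (- beta)) by apply exp_pos.
    assert (I2 : ddm s <= E1 * Rpower d (- 1 - beta)).
    { eapply Rle_trans; [ apply Hddm; lra | ].
      assert (Hd' : Rpower d (- 1 - beta) = Rpower d (- beta) / d).
      { replace (- 1 - beta) with (- beta + - (1)) by ring.
        rewrite Rpower_plus, (Rpower_Ropp d 1), Rpower_1 by lra. reflexivity. }
      rewrite Hd'. unfold E1.
      replace (8 * (2 * q + 4 * q ^ 2) * (2 * PI * (4 * c) * (G * Rpower (K1 ^ 2) q)) * (Rpower d (- beta) / d))
        with (8 * (2 * q + 4 * q ^ 2) * (2 * PI * (4 * c * d) *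
          (G * (Rpower (K1 ^ 2) q * Rpower d (- beta)) / d ^ 2))) by (field; lra).
      apply Rmult_le_compat_l; [ nra | ].
      eapply Rle_trans; [ exact I1 | ].
      apply Rmult_le_compat_r.
      - apply Rdiv_le_0_compat; [ | apply pow_lt; lra ].
        apply Rmult_le_pos; [ lra | apply Rmult_le_pos; lra ].
      - unfold Rdiv. apply Rmult_le_compat_l; lra. }
    eapply Rle_trans; [ exact I2 | ]. rewrite Rmult_assoc.
    apply Rmult_le_compat_l; [ exact HE1 | ].
    rewrite Rpower_mult_distr by lra. apply Rpower_antitone; [ | lra ].
    split; [ lra | ]. assert (H := half_le_one_minus_exp s ltac:(lra)). unfold d. lra. }
  destruct (bounded_of_derive2_power m dm ddm (E1 * Rpower (/ 2) (- 1 - beta)) beta) as [T HT1];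
    [ apply Rmult_le_pos; [ exact HE1 | left; apply exp_pos ] | exact Hbeta | exact Hm | exact Hdm | exact Hbound | ].
  assert (EU : forall s, s < 0 -> ex_RInt (fun t => exp (q * ln (1 + Cmod (f (exp s * cis t)%C) ^ 2))) 0 (2 * PI)).
  { intros s Hs. apply (@ex_RInt_continuous R_CompleteNormedModule). intros t _.
    apply (continuous_comp (fun t => Cmod (f (exp s * cis t)%C) ^ 2) (fun x => exp (q * ln (1 + x)))).
    - apply Cf, Hs.
    - apply (@ex_derive_continuous R_AbsRing R_NormedModule). auto_derive.
      assert (P := pow2_ge_0 (Cmod (f (exp s * cis t)%C))). lra. }
  (* On the disk of radius [e^(- 1 / 2)] the growth estimate alone is enough. *)
  set (T0 := K1 * Rpower (1 - exp (- (1 / 2))) (1 - lambda)).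
  set (T1 := 2 * PI * Rpower (1 + T0 ^ 2) q).
  assert (Hsmall : forall s, s <= - (1 / 2) -> m s <= T1).
  { assert (C0 : forall v : R, RInt (fun _ => v) 0 (2 * PI) = 2 * PI * v)
      by (intros v; rewrite RInt_const; unfold scal; simpl; unfold mult; simpl; ring).
    intros s Hs. unfold T1. rewrite <- C0.
    apply RInt_le; [ lra | apply EU; lra | apply ex_RInt_const | ].
    intros t _. apply Rle_Rpower_l; [ lra | ].
    assert (P := pow2_ge_0 (Cmod (f (exp s * cis t)%C))). split; [ lra | ].
    apply Rplus_le_compat_l. apply pow_incr. split; [ apply Cmod_ge_0 | ].
    eapply Rle_trans; [ apply Hgrow; lra | ]. unfold T0.
    apply Rmult_le_compat_l; [ lra | ]. apply Rpower_antitone; [ | lra ].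
    assert (H1 := Hexp (- (1 / 2)) ltac:(lra)).
    destruct Hs as [Hs | ->]; [ | lra ]. apply exp_increasing in Hs. lra. }
  set (Tm := Rabs T + Rabs T1 + 1).
  assert (Hmb : forall s, s < 0 -> m s <= Tm).
  { intros s Hs. assert (A1 := Rle_abs T). assert (A2 := Rle_abs T1).
    assert (A3 := Rabs_pos T). assert (A4 := Rabs_pos T1). unfold Tm.
    destruct (Rle_lt_dec s (- (1 / 2))) as [H | H].
    - assert (B := Hsmall s H). lra.
    - assert (B := HT1 s ltac:(lra)). lra. }
  exists (Rpower (/ (2 * PI) * Tm) (1 / p)). intros r Hr.
  assert (Hln : ln r < 0) by (rewrite <- ln_1; apply ln_increasing; lra).
  assert (Her : exp (ln r) = r) by (apply exp_ln; lra).
  assert (HTm : 0 < Tm) by (unfold Tm; assert (A3 := Rabs_pos T); assert (A4 := Rabs_pos T1); lra).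
  assert (Hinv : 0 < / (2 * PI)) by (apply Rinv_0_lt_compat; lra).
  (* By univalence [f] vanishes only at 0, so the means over circles involve only
     powers of positive numbers. *)
  assert (Hfr : forall t, 0 < Cmod (f (r * cis t)%C)).
  { intros t. apply Cmod_gt_0. destruct Hqc as (_ & _ & _ & Hu & Hf0 & _).
    intros E. rewrite <- Hf0 in E. apply Hu in E.
    - apply (f_equal Cmod) in E. rewrite Cmod_mult, Cmod_R, Cmod_cis, Cmod_0, Rabs_pos_eq in E; lra.
    - apply circle_in_disk; lra.
    - unfold in_disk; rewrite Cmod_0; lra. }
  assert (Hpow : forall t, nonneg_power (Cmod (f (r * cis t)%C)) p = exp (q * ln (Cmod (f (r * cis t)%C) ^ 2))).
  { intros t. unfold nonneg_power. specialize (Hfr t). destruct Req_EM_T as [E | _]; [ lra | ].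
    unfold Rpower. f_equal. simpl. rewrite Rmult_1_r, ln_mult by assumption. unfold q. field. }
  assert (EI : ex_RInt (fun t => nonneg_power (Cmod (f (r * cis t)%C)) p) 0 (2 * PI)).
  { apply (ex_RInt_ext (fun t => exp (q * ln (Cmod (f (r * cis t)%C) ^ 2)))); [ intros; symmetry; apply Hpow | ].
    apply (@ex_RInt_continuous R_CompleteNormedModule). intros t _.
    apply (continuous_comp (fun t => Cmod (f (r * cis t)%C) ^ 2) (fun x => exp (q * ln x))).
    - rewrite <- Her. apply (Cf (ln r) t Hln).
    - apply (@ex_derive_continuous R_AbsRing R_NormedModule). auto_derive.
      apply (pow_lt _ 2), Hfr. }
  assert (Hint : RInt (fun t => nonneg_power (Cmod (f (r * cis t)%C)) p) 0 (2 * PI) <= Tm).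
  { eapply Rle_trans; [ | apply (Hmb (ln r) Hln) ]. unfold m. rewrite Her.
    apply RInt_le; [ lra | exact EI | rewrite <- Her; apply EU, Hln | ].
    intros t _. rewrite Hpow. apply (Rle_Rpower_l _ _ q); [ lra | ].
    split; [ apply pow_lt, Hfr | lra ]. }
  assert (Hint0 : 0 <= RInt (fun t => nonneg_power (Cmod (f (r * cis t)%C)) p) 0 (2 * PI)).
  { apply RInt_ge_0; [ lra | exact EI | ]. intros t _. rewrite Hpow. left; apply exp_pos. }
  unfold integral_mean. apply nonneg_power_le.
  - split; [ apply Rmult_le_pos; lra | apply Rmult_le_compat_l; lra ].
  - apply Rmult_lt_0_compat; lra.
  - apply Rdiv_lt_0_compat; lra.
Qed.

Theorem theorem4p1 (lambda k : R) (hlambda : 0 < lambda) (hk : 0 <= k < 1) :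
  (lambda < 1 ->
    forall f : C -> C, class_B lambda f -> class_S f -> hardy_infty f) /\
  (lambda = 1 ->
    forall f : C -> C, class_B lambda f -> class_S f -> BMOH f) /\
  (1 < lambda ->
    forall p : R, 0 < p < 1 / (lambda - 1) ->
    forall f : C -> C, class_B lambda f -> class_S_qc k f -> hardy p f).
Proof.
  split; [ | split ].
  - intros Hl f HB _. exact (class_B_bounded lambda f (conj hlambda Hl) HB).
  - intros -> f HB _. exact (class_B_BMOH f HB).
  - intros Hl p Hp f HB HS. exact (class_S_qc_hardy lambda k p f Hl hk Hp HB HS).
Qed.
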